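(* Let $M$ be a map on the Euclidean plane $\mathbb{E}^2$ whose faces are convex polygons, which has at least two faces of different sizes (i.e. with different numbers of edges), and whose symmetry group contains two translations with respect to linearly independent vectors. Then the surface $\widetilde{S}$ underlying the minimal regular cover $\widetilde{M}$ of $M$ is homeomorphic to the Loch Ness monster.
   Context: Maps. A map $M=M(\Gamma,i,S)$ is an embedding $i$ of a locally finite graph $\Gamma$ in a surface $S$: vertices go bijectively to a discrete set of points of $S$, edges go to non-self-intersecting arcs joining the corresponding points, images of two edges meet only in images of common vertices, and the components of the complement of the image of $\Gamma$ (the faces) are homeomorphic to open discs. Standing conventions: graphs have no loops, every edge belongs to two distinct faces, and the flags (below) triangulate $S$. A symmetry of a map on $\mathbb{E}^2$ is an isometry of $\mathbb{E}^2$ preserving the vertex set and the edge set setwise. Flags and monodromy group. A flag of $M$ is a triangle whose corners are a vertex $v$, the midpoint of an edge $e$ containing $v$, and a chosen interior point of a face $F$ containing $e$ (the same point for all flags of $F$); it is identified with the incident triple $(v,e,F)$. $\mathcal{F}(M)$ is the set of flags. For $i\in\{0,1,2\}$, each flag $\Phi$ has a unique $i$-adjacent flag $\Phi^i$ that differs from $\Phi$ precisely in the vertex ($i=0$), the edge ($i=1$) or the face ($i=2$). Let $r_i$ be the permutation $\Phi\mapsto\Phi^i$ of $\mathcal{F}(M)$. The monodromy group is $\mathrm{Mon}(M)=\langle r_0,r_1,r_2\rangle\le \mathrm{Sym}(\mathcal{F}(M))$, acting on flags on the right; this action is transitive. Minimal regular cover. A map is regular if its automorphism group acts transitively on flags.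 The minimal regular cover $\widetilde{M}$ of $M$, on the surface $\widetilde{S}$, is the regular map with $\mathrm{Aut}(\widetilde{M})\cong\mathrm{Mon}(M)$ constructed as follows: take one triangle $t_g$ with sides labelled $0,1,2$ for each $g\in\mathrm{Mon}(M)$, and identify the side labelled $i$ of $t_{g_1}$ with the side labelled $i$ of $t_{g_2}$ whenever $g_1=g_2r_i$. The triangles are the flags of $\widetilde{M}$; the corners of $t_g$ opposite to sides $0,1,2$ are respectively a vertex, an edge midpoint and a face centre. $\widetilde{M}$ is covered by every regular cover of $M$. Loch Ness monster. Surfaces are connected, orientable 2-manifolds without boundary, not necessarily compact. An end of a space $X$ is a function $E$ assigning to each compact $K\subset X$ one connected component $E(K)$ of $X\setminus K$, with $E(K)\supset E(L)$ whenever $K\subset L$. A subsurface is a closed region whose boundary consists of finitely many disjoint simple closed curves; a compact bordered surface with Euler characteristic $\chi$ and $q$ boundary curves has genus $1-\frac12(\chi+q)$; the genus of a surface is the maximum of the genera of its compact subsurfaces (infinite if unbounded). The Loch Ness monster is the surface, unique up to homeomorphism, of infinite genus with exactly one end. *)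

(* Defs.v *)
From HB Require Import structures.
From Stdlib Require Import Relation_Operators.
From mathcomp Require Import all_boot all_order all_algebra.
From mathcomp Require Import all_classical all_reals all_analysis.
Import Order.TTheory GRing.Theory Num.Theory numFieldNormedType.Exports.

Set Implicit Arguments.
Unset Strict Implicit.
Unset Printing Implicit Defensive.

Local Open Scope classical_set_scope.
Local Open Scope ring_scope.

Definition is_component {X : topologicalType} (A C : set X) : Prop :=
  exists2 x, A x & C = connected_component A x.

Definition homeomorphic_sets {X Y : topologicalType} (A : set X) (B : set Y) :=
  exists (f : X -> Y) (g : Y -> X),
    [/\ {within A, continuous f}, {within B, continuous g},
        f @` A `<=` B, g @` B `<=` A &
        (forall x, A x -> g (f x) = x) /\ (forall y, B y -> f (g y) = y)].

Section EuclideanSpaces.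
Variable R : realType.

Notation plane := 'rV[R]_2.

Definition euclidean_dist n (p q : 'rV[R]_n) : R :=
  Num.sqrt (\sum_i (p ord0 i - q ord0 i) ^+ 2).

Definition open_disc : set plane := [set p | euclidean_dist p 0 < 1].

Definition simplex n : set 'rV[R]_n :=
  [set p | (forall i, 0 <= p ord0 i) /\ \sum_i p ord0 i = 1].

(* The open region bounded by a convex polygon.  Corners of the map at which
   the polygon has a straight angle are not excluded. *)
Definition convex_polygon (F : set plane) : Prop :=
  exists s : seq plane, F = (smallest (@convex_set R plane) [set` s])°.

Definition euclidean_isometry (f : plane -> plane) : Prop :=
  forall p q, euclidean_dist (f p) (f q) = euclidean_dist p q.

End EuclideanSpaces.
Arguments simplex {R} n.

(* A graph embedded in X, each edge being given by its image; edges with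
   disjoint relative interiors are determined by their images. *)
Record embedded_graph (X : topologicalType) := EmbeddedGraph {
  vertices : set X;
  edges : set (set X) }.

Section Maps.
Variables (X : topologicalType) (M : embedded_graph X).

Definition skeleton : set X := vertices M `|` \bigcup_(e in edges M) e.

Definition is_face (F : set X) : Prop := is_component (~` skeleton) F.

Definition edges_of_face (F : set X) : set (set X) :=
  [set e | edges M e /\ e `<=` closure F].

Definition is_flag : set (X * set X * set X) :=
  [set f | [/\ vertices M f.1.1, edges M f.1.2, is_face f.2,
               f.1.2 f.1.1 & f.1.2 `<=` closure f.2]].

Definition same_element (i : 'I_3) (f g : X * set X * set X) : Prop :=
  match val i with
  | 0%N => f.1.1 = g.1.1
  | 1%N => f.1.2 = g.1.2
  | _ => f.2 = g.2
  end.

(* [T f] parametrizes by barycentric coordinates the triangle of the flag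
   [f = (v, e, F)], with corners [v], an interior point of [e] and a point of
   [F].  Two triangles meet exactly along the face spanned by the corners
   corresponding to the elements that the two flags share. *)
Definition flags_triangulate (R : realType) : Prop :=
  exists T : X * set X * set X -> 'rV[R]_3 -> X,
    [/\ forall f, is_flag f ->
          [/\ {within simplex 3, continuous (T f)},
              forall p, simplex 3 p -> p ord0 0 = 1 -> T f p = f.1.1,
              forall p, simplex 3 p -> p ord0 2 = 0 -> f.1.2 (T f p) &
              forall p, simplex 3 p -> p ord0 2 != 0 -> f.2 (T f p)],
        forall f g p q, is_flag f -> is_flag g -> simplex 3 p -> simplex 3 q ->
          T f p = T g q <->
          p = q /\ (forall i, p ord0 i != 0 -> same_element i f g),
        \bigcup_(f in is_flag) (T f @` simplex 3) = setT &
        forall x : X, exists2 U : set X, nbhs x U &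
          finite_set [set f | is_flag f /\ (T f @` simplex 3) `&` U !=set0]].

Record is_map (R : realType) : Prop := IsMap {
  map_discrete : vertices M `<=` isolated (vertices M);
  map_arcs : forall e, edges M e -> exists gamma : R -> X,
    [/\ {within `[0, 1], continuous gamma},
        {in `[0, 1] &, injective gamma},
        e = gamma @` `[0, 1] &
        e `&` vertices M = [set gamma 0; gamma 1]];
  map_edges_meet : forall e e', edges M e -> edges M e' -> e <> e' ->
    e `&` e' `<=` vertices M;
  map_locally_finite : forall v, vertices M v ->
    finite_set [set e | edges M e /\ e v];
  map_faces : forall F, is_face F -> homeomorphic_sets F (@open_disc R);
  map_two_faces : forall e, edges M e -> exists F F',
    F <> F' /\ [set G | is_face G /\ e `<=` closure G] = [set F; F'];
  map_triangulated : flags_triangulate R }.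

Definition flag : choiceType := set_type is_flag.

Definition adjacent (i : 'I_3) (f g : flag) : Prop :=
  forall j, same_element j (val f) (val g) <-> j <> i.

(* In a map the i-adjacent flag exists and is unique. *)
Definition flag_adj (i : 'I_3) (f : flag) : flag := xget f [set g : flag | adjacent i f g].

(* Permutations act on the right: the product [g h] is [h \o g]. *)
Inductive Mon : set (flag -> flag) :=
| Mon_gen i : Mon (flag_adj i)
| Mon_one : Mon id
| Mon_mul g h : Mon g -> Mon h -> Mon (h \o g)
| Mon_inv g h : Mon g -> cancel g h -> cancel h g -> Mon h.

Variable R : realType.

Definition cover_triangles : topologicalType :=
  (discrete_topology Mon * @simplex R 3)%type.

(* [t_g1] and [t_g2] are glued along their sides labelled [i], which is the side
   opposite to corner [i], when [g1 = g2 r_i]. *)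
Definition side_identified (a b : cover_triangles) : Prop :=
  exists i : 'I_3, [/\ val (a.1 : Mon) = flag_adj i \o val (b.1 : Mon), a.2 = b.2 &
                       val a.2 ord0 i = 0].

Definition glued (a b : cover_triangles) : bool :=
  `[< clos_refl_sym_trans _ side_identified a b >].

Lemma glued_refl : reflexive glued.
Proof. by move=> a; apply/asboolP; apply: rst_refl. Qed.

Lemma glued_sym : symmetric glued.
Proof.
by move=> a b; apply/asboolP/asboolP => ab; apply: rst_sym.
Qed.

Lemma glued_trans : transitive glued.
Proof.
by move=> b a c /asboolP ab /asboolP bc; apply/asboolP; apply: rst_trans ab bc.
Qed.

Canonical glued_equiv := EquivRel glued glued_refl glued_sym glued_trans.

Definition minimal_regular_cover_surface : topologicalType :=
  quotient_topology {eq_quot glued_equiv}%qT.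

End Maps.

Section PlaneMaps.
Variables (R : realType) (M : embedded_graph 'rV[R]_2).

Definition is_symmetry (f : 'rV[R]_2 -> 'rV[R]_2) : Prop :=
  [/\ euclidean_isometry f, f @` vertices M = vertices M &
      [set f @` e | e in edges M] = edges M].

End PlaneMaps.

Section Surfaces.
Variables (R : realType) (X : topologicalType).

Notation plane := 'rV[R]_2.

Definition direction (a : R) : plane :=
  \row_(i < 2) if i == 0 then cos a else sin a.

(* The image under [f] of the circle of radius [r] about [p] has winding number
   [1] around [f p]. *)
Definition winds_once (f : plane -> plane) (p : plane) (r : R) : Prop :=
  exists theta : R -> R,
    [/\ {within `[0, 1], continuous theta}, theta 1 = theta 0 + 2 * pi &
        forall t, t \in `[0, 1] -> exists2 rho, 0 < rho &
          f (p + r *: direction (2 * pi * t)) =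
          f p + rho *: direction (theta t)].

Definition orientation_preserving (U : set plane) (f : plane -> plane) : Prop :=
  forall p, U p -> \forall r \near 0^'+, winds_once f p r.

Record chart := Chart {
  chart_dom : set X;
  chart_map : X -> plane;
  chart_inv : plane -> X }.

Definition is_chart (c : chart) : Prop :=
  [/\ open (chart_dom c), open (chart_map c @` chart_dom c),
      {within chart_dom c, continuous (chart_map c)},
      {within chart_map c @` chart_dom c, continuous (chart_inv c)} &
      forall x, chart_dom c x -> chart_inv c (chart_map c x) = x].

Definition is_atlas (A : set chart) : Prop :=
  A `<=` is_chart /\ \bigcup_(c in A) chart_dom c = setT.

Definition oriented_atlas (A : set chart) : Prop :=
  is_atlas A /\ forall c d, A c -> A d ->
    orientation_preserving (chart_map c @` (chart_dom c `&` chart_dom d))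
                           (chart_map d \o chart_inv c).

Definition manifold2 : Prop :=
  [/\ hausdorff_space X, @second_countable X & exists A, is_atlas A].

Definition orientable : Prop := exists A, oriented_atlas A.

Definition surface : Prop := [/\ connected [set: X], manifold2 & orientable].

Definition is_end (E : {K : set X | compact K} -> set X) : Prop :=
  (forall K, is_component (~` sval K) (E K)) /\
  (forall K L, sval K `<=` sval L -> E L `<=` E K).

Definition simple_closed_curve (C : set X) : Prop :=
  exists gamma : R -> X,
    [/\ {within `[0, 1], continuous gamma}, {in `[0, 1[ &, injective gamma},
        gamma 0 = gamma 1 & C = gamma @` `[0, 1]].

Definition is_complex n (K : {set {set 'I_n}}) : Prop :=
  finset.set0 \notin K /\
  forall s t : {set 'I_n}, s \in K -> t \subset s -> t != finset.set0 -> t \in K.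

Definition realization n (K : {set {set 'I_n}}) : set 'rV[R]_n :=
  [set p | simplex n p /\ [set i | p ord0 i != 0]%SET \in K].

Definition complex_euler_char n (K : {set {set 'I_n}}) : int :=
  \sum_(s in K) (-1) ^+ #|s|.-1.

Definition has_euler_char (A : set X) (chi : int) : Prop :=
  exists n (K : {set {set 'I_n}}),
    [/\ is_complex K, homeomorphic_sets (realization K) A &
        chi = complex_euler_char K].

(* [A] is a closed region whose boundary consists of [q] disjoint simple closed
   curves. *)
Definition is_subsurface (A : set X) (q : nat) : Prop :=
  [/\ A !=set0, connected A, closure A° = A &
      exists c : 'I_q -> set X,
        [/\ forall i, simple_closed_curve (c i), trivIset setT c &
            A `\` A° = \bigcup_i c i]].

Definition has_genus (A : set X) (g : rat) : Prop :=
  exists (q : nat) (chi : int),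
    [/\ is_subsurface A q, compact A, has_euler_char A chi &
        g = 1 - (chi + q%:Z)%:~R / 2].

Definition infinite_genus : Prop :=
  forall n : nat, exists A g, has_genus A g /\ n%:R <= g.

(* The surface of infinite genus with exactly one end, which is unique up to
   homeomorphism: these properties define its homeomorphism type. *)
Definition loch_ness_monster : Prop :=
  [/\ surface, infinite_genus & exists! E, is_end E].

End Surfaces.

(* Main.v *)
Require Import Defs.
From HB Require Import structures.
From mathcomp Require Import all_boot all_order all_algebra fingroup perm finmap.
From mathcomp Require Import all_classical all_reals all_analysis.
From mathcomp Require Import ring lra zify.
Import Order.TTheory GRing.Theory Num.Theory numFieldNormedType.Exports.

Set Implicit Arguments.
Unset Strict Implicit.
Unset Printing Implicit Defensive.

Local Open Scope classical_set_scope.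
Local Open Scope ring_scope.

(** The cover is glued from triangles indexed by the monodromy group G, which acts on flags
    commuting with the lattice of translations; flags form finitely many translation classes,
    so elements of G that preserve the classes act on each class as a translation.

    Parity of words orients the surface, and the open stars of corners are its charts.

    One end: let z in G be class preserving and of infinite order.  It has finitely many
    conjugates, so a subset of G with finite boundary is, up to finitely many elements,
    invariant under right multiplication by z, and whether the ray g, gz, gzz, ... ends up
    inside it does not depend on g.  As there are infinitely many disjoint lines of this
    kind, both ends of a line agree, and the subset is finite or has finite complement.

    Infinite genus: let P and Q be the orders of the rotations about vertices and faces.  Call
    an edge at a vertex up or down by lexicographic order.  Around each vertex there are at
    least two corners between an up and a down edge, around each face at least two of the other
    kind, and at least four along Q steps when the face has fewer than Q edges.  Averaging over
    translation classes gives 1/P + 1/Q < 1/2.  G has polynomial growth, so some balls have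
    arbitrarily small relative boundary; cutting off the corners of their triangles gives a
    compact subsurface whose genus is at least proportional to the size of the ball. *)

(** * Winding numbers *)

(** The cover depends only on the group G with its three involutions, so plane geometry enters only
    through the behaviour of flags. Class-preserving elements act on each translation class by its
    own translation; hence they commute and have finite index, which explains the polynomial growth.

    The rotation orders are governed by all vertices and all faces at once. On the quotient torus
    Euler's formula balances the valencies and face sizes of the map; the counting of corners
    replaces that formula, and a face with fewer than Q edges tips the balance. A closed surface
    built from n triangles of a regular map with orders P, 2, Q has Euler characteristic (n/2)(1/P +
    1/2 + 1/Q - 1), so negativity of this factor makes topology accumulate.

    Negativity alone does not give genus: the hyperbolic plane satisfies the same inequality, but
    there the boundary of every region absorbs the whole count. Genus appears because balls with
    small relative boundary exist, so that almost all boundary curves are small holes around single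
    corners, and these are already counted by the terms 1/P, 1/2 and 1/Q. *)

Section RealContinuity.
Variables (R : realType) (T : topologicalType) (x : T).
Implicit Types (f g : T -> R).

Lemma contD f g : {for x, continuous f} -> {for x, continuous g} ->
  {for x, continuous (fun t => f t + g t)}.
Proof. by move=> cf cg; apply: cvgD. Qed.

Lemma contB f g : {for x, continuous f} -> {for x, continuous g} ->
  {for x, continuous (fun t => f t - g t)}.
Proof. by move=> cf cg; apply: cvgB. Qed.

Lemma contM f g : {for x, continuous f} -> {for x, continuous g} ->
  {for x, continuous (fun t => f t * g t)}.
Proof. by move=> cf cg; apply: cvgM. Qed.

Lemma contV f : f x != 0 -> {for x, continuous f} -> {for x, continuous (fun t => (f t)^-1)}.
Proof. by move=> f0 cf; apply: cvgV. Qed.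

Lemma cont_norm f : {for x, continuous f} -> {for x, continuous (fun t => `|f t|)}.
Proof. by move=> cf; apply: cvg_norm. Qed.

Lemma cont_min f g : {for x, continuous f} -> {for x, continuous g} ->
  {for x, continuous (fun t => Num.min (f t) (g t))}.
Proof. by move=> cf cg; apply: (@continuous_min _ _ f g). Qed.

Lemma cont_max f g : {for x, continuous f} -> {for x, continuous g} ->
  {for x, continuous (fun t => Num.max (f t) (g t))}.
Proof. by move=> cf cg; apply: (@continuous_max _ _ f g). Qed.

Lemma cont_cst (c : R) : {for x, continuous (fun _ : T => c)}.
Proof. exact: cvg_cst. Qed.

Lemma near_gt f c : {for x, continuous f} -> c < f x -> \forall y \near x, c < f y.
Proof.
move=> cf cx; have : nbhs (f x) [set y | c < y] by apply: open_nbhs_nbhs; split=> //; exact: open_gt.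
exact: cf.
Qed.

Lemma near_lt f c : {for x, continuous f} -> f x < c -> \forall y \near x, f y < c.
Proof.
move=> cf cx; have : nbhs (f x) [set y | y < c] by apply: open_nbhs_nbhs; split=> //; exact: open_lt.
exact: cf.
Qed.

End RealContinuity.
Section RowVectors.
Variables (R : realType).

Lemma cvg_rV n (T : Type) (F : set_system T) (f : T -> 'rV[R]_n) (l : 'rV[R]_n) {FF : Filter F} :
  (forall i, (fun x => f x ord0 i) @ F --> l ord0 i) -> f @ F --> l.
Proof.
move=> fl A [P Pl PA].
have : \forall x \near F, forall i, P ord0 i (f x ord0 i).
  by apply: filter_forall => i; exact: fl _ (Pl ord0 i).
by apply: filterS => x Px; apply: PA => i j; rewrite (ord1 i).
Qed.

Lemma cvg_coord n (T : Type) (F : set_system T) (f : T -> 'rV[R]_n) (l : 'rV[R]_n) i {FF : Filter F} :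
  f @ F --> l -> (fun x => f x ord0 i) @ F --> l ord0 i.
Proof.
move=> fl.
by apply: (@cvg_comp _ _ _ f (fun v : 'rV[R]_n => v ord0 i) _ _ _ fl); exact: coord_continuous.
Qed.

Lemma continuous_rV n (T : topologicalType) (f : T -> 'rV[R]_n) :
  (forall i, continuous (fun x => f x ord0 i)) -> continuous f.
Proof. by move=> fc x; apply: cvg_rV => i; exact: fc. Qed.

Lemma vaddE n (v w : 'rV[R]_n) i : (v + w) ord0 i = v ord0 i + w ord0 i.
Proof. by rewrite mxE. Qed.
Lemma vscaleE n (a : R) (v : 'rV[R]_n) i : (a *: v) ord0 i = a * v ord0 i.
Proof. by rewrite mxE. Qed.
Lemma voppE n (v : 'rV[R]_n) i : (- v) ord0 i = - v ord0 i.
Proof. by rewrite mxE. Qed.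
Definition vecE := (vaddE, vscaleE, voppE).

Definition row2 (x y : R) : 'rV[R]_2 := \row_(i < 2) if i == 0 then x else y.

Definition i0 : 'I_2 := ord0.
Definition i1 : 'I_2 := lift ord0 ord0.

Lemma row2P (v w : 'rV[R]_2) : v ord0 i0 = w ord0 i0 -> v ord0 i1 = w ord0 i1 -> v = w.
Proof.
move=> v0 v1; apply/rowP => -[[|[|//]] lti].
  by have -> : Ordinal lti = i0 by exact: val_inj.
by have -> : Ordinal lti = i1 by exact: val_inj.
Qed.

Lemma row2_0 x y : row2 x y ord0 i0 = x. Proof. by rewrite mxE. Qed.
Lemma row2_1 x y : row2 x y ord0 i1 = y. Proof. by rewrite mxE. Qed.
Definition row2E := (row2_0, row2_1).

Lemma cvg_row2 (T : Type) (F : set_system T) (f g : T -> R) x y {FF : Filter F} :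
  f @ F --> x -> g @ F --> y -> (fun t => row2 (f t) (g t)) @ F --> row2 x y.
Proof.
move=> fx gy; apply: cvg_rV => -[[|[|//]] lti]; rewrite mxE /=.
  by under eq_cvg do rewrite mxE.
by under eq_cvg do rewrite mxE.
Qed.

Definition det2 (u v : 'rV[R]_2) : R :=
  u ord0 i0 * v ord0 i1 - u ord0 i1 * v ord0 i0.
Definition dot2 (u v : 'rV[R]_2) : R :=
  u ord0 i0 * v ord0 i0 + u ord0 i1 * v ord0 i1.

Lemma cvg_det2 (T : Type) (F : set_system T) (f g : T -> 'rV[R]_2) u v {FF : Filter F} :
  f @ F --> u -> g @ F --> v -> (fun t => det2 (f t) (g t)) @ F --> det2 u v.
Proof. by move=> fu gv; apply: cvgB; apply: cvgM; exact: cvg_coord. Qed.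

Lemma cvg_dot2 (T : Type) (F : set_system T) (f g : T -> 'rV[R]_2) u v {FF : Filter F} :
  f @ F --> u -> g @ F --> v -> (fun t => dot2 (f t) (g t)) @ F --> dot2 u v.
Proof. by move=> fu gv; apply: cvgD; apply: cvgM; exact: cvg_coord. Qed.

Lemma continuous_det2 (T : topologicalType) (f g : T -> 'rV[R]_2) x :
  {for x, continuous f} -> {for x, continuous g} -> {for x, continuous (fun t => det2 (f t) (g t))}.
Proof. exact: cvg_det2. Qed.

End RowVectors.
Arguments i0 : simpl never.
Arguments i1 : simpl never.

Section Winding.
Variables (R : realType).
Notation plane := 'rV[R]_2.
Implicit Types (p u v w d : plane) (x y : R).

(** The angle of [w] measured from [d1] and that of [v] measured from [d2] lie in the same open half
    turn, or are both 0, or are both pi. Thus the two angles always differ by less than pi, and no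
    angle function has to be constructed on the circle beforehand. *)
Definition same_side d1 w d2 v : Prop :=
  0 < det2 d1 w * det2 d2 v \/
  [/\ det2 d1 w = 0, det2 d2 v = 0 & 0 < dot2 d1 w * dot2 d2 v].

(** The half-angle formula: the argument of (x, y) is twice the arctangent of y / (n + x), which is
    continuous off the nonpositive half axis. *)
Lemma polar_atan x y : (0 < x) \/ (y != 0) ->
  let n := Num.sqrt (x ^+ 2 + y ^+ 2) in let b := 2 * atan (y / (n + x)) in
  [/\ 0 < n, 0 < n + x, x = n * cos b & y = n * sin b].
Proof.
move=> xy n b.
have s0 : 0 < x ^+ 2 + y ^+ 2.
  case: xy => [x0|y0]; first by rewrite ltr_pwDl ?sqr_ge0 ?exprn_gt0.
  by rewrite ltr_wpDl ?sqr_ge0 // lt_neqAle eq_sym sqrf_eq0 y0 sqr_ge0.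
have n0 : 0 < n by rewrite sqrtr_gt0.
have n2 : n ^+ 2 = x ^+ 2 + y ^+ 2 by rewrite sqr_sqrtr // ltW.
have nx : 0 < n + x.
  rewrite ltNge; apply/negP => h; case: xy => [x0|y0]; first by lra.
  have : y ^+ 2 <= 0 by nra.
  by rewrite leNgt lt_neqAle eq_sym sqrf_eq0 y0 sqr_ge0.
set q := y / (n + x) in b *.
have cq : cos (atan q) ^+ 2 = (n + x) / (2 * n).
  rewrite cos_atan exprVn sqr_sqrtr; last by rewrite addr_ge0 // sqr_ge0.
  have -> : 1 + q ^+ 2 = 2 * n / (n + x).
    by rewrite /q; apply: (canRL (mulfK _)); rewrite ?gt_eqF //; field: n2; rewrite gt_eqF.
  by rewrite invf_div.
have sq : sin (atan q) = q * cos (atan q).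
  rewrite -{2}(atanK q) /tan divfK // cos_atan invr_eq0 sqrtr_eq0 -ltNge.
  by rewrite ltr_pwDl // sqr_ge0.
split=> //.
  rewrite /b mulr_natl cos_mulr2n cq -mulr_natr; field; rewrite gt_eqF //.
rewrite /b mulr_natl sin_mulr2n sq mulrCA -expr2 cq /q -mulr_natr; field.
by rewrite !gt_eqF.
Qed.

Lemma polar_exists x y : (x != 0) \/ (y != 0) ->
  exists n a, [/\ 0 < n, x = n * cos a & y = n * sin a].
Proof.
move=> xy.
have [x0|x0] := ltP 0 x; first by have [n0 _ ? ?] := @polar_atan x y (or_introl x0); do 2!eexists; split; [exact: n0|eassumption|eassumption].
have [y0|y0] := eqVneq y 0; last first.
  by have [n0 _ ? ?] := @polar_atan x y (or_intror y0); do 2!eexists; split; [exact: n0|eassumption|eassumption].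
have {xy} x0' : x != 0 by case: xy => //; rewrite y0 eqxx.
exists (- x), pi; rewrite cospi sinpi y0; split; [|ring|ring].
by rewrite oppr_gt0 lt_neqAle x0' x0.
Qed.

(** In complex notation [dot2 d w] and [det2 d w] are the real and imaginary parts of conj(d) w. The
    quotient of the angle of [D] from [d2] by that of [w] from [d1] is represented by z = Re + i Im,
    which avoids the nonpositive half axis, so its argument [b] is continuous and returns to its
    initial value. The angle of the image is then 2 pi t plus the constant angle [a] from [d1] to
    [d2] plus [b]. *)
Lemma winds_once_same_side (f : plane -> plane) p r d1 d2 :
  0 < r -> {within `[0, 1], continuous (fun t : R => f (p + r *: direction (2 * pi * t)))} ->
  (forall a, same_side d1 (r *: direction a) d2 (f (p + r *: direction a) - f p)) ->
  winds_once f p r.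
Proof.
move=> r0 cf ss.
pose w t : plane := r *: direction (2 * pi * t).
pose D t := f (p + w t) - f p.
pose Re t := dot2 d2 (D t) * dot2 d1 (w t) + det2 d2 (D t) * det2 d1 (w t).
pose Im t := dot2 d1 (w t) * det2 d2 (D t) - dot2 d2 (D t) * det2 d1 (w t).
have wE t : w t = row2 (r * cos (2 * pi * t)) (r * sin (2 * pi * t)).
  by apply: row2P; rewrite row2E !mxE.
have zP t : 0 < Re t \/ Im t != 0.
  have := ss (2 * pi * t); rewrite /same_side -/(w t) -/(D t) /Re /Im.
  move: (det2 d1 _) (dot2 d1 _) (det2 d2 _) (dot2 d2 _) => c e a b [h|[-> -> h]]; last first.
    by left; rewrite mulrC; lra.
  have [E|] := eqVneq (e * a - b * c) 0; last by right.
  left; have : 0 < a * c * (b * e + a * c).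
    have -> : a * c * (b * e + a * c) = (a * e) ^+ 2 + (c * a) ^+ 2 - a * e * (e * a - b * c) by ring.
    by rewrite E mulr0 subr0 ltr_wpDl ?sqr_ge0 // exprn_gt0.
  by rewrite pmulr_rgt0 // mulrC.
pose u0 := dot2 d1 d2; pose u1 := det2 d1 d2.
have d12 : 0 < dot2 d1 d1 * dot2 d2 d2.
  rewrite ltNge; apply/negP => h; have := ss 0; rewrite /same_side.
  have h1 : 0 <= dot2 d1 d1 by rewrite addr_ge0 // -expr2 sqr_ge0.
  have h2 : 0 <= dot2 d2 d2 by rewrite addr_ge0 // -expr2 sqr_ge0.
  have {h h1 h2} : dot2 d1 d1 = 0 \/ dot2 d2 d2 = 0.
    have : dot2 d1 d1 * dot2 d2 d2 == 0 by rewrite eq_le h mulr_ge0.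
    by rewrite mulf_eq0 => /orP[] /eqP; [left|right].
  have z0 (d : plane) : dot2 d d = 0 -> (d ord0 i0 = 0) /\ (d ord0 i1 = 0).
    move/eqP; rewrite paddr_eq0 -?expr2 ?sqr_ge0 // !sqrf_eq0.
    by move=> /andP[/eqP ? /eqP ?].
  rewrite /det2 /dot2.
  by case=> /z0[-> ->]; rewrite !(mul0r, mulr0, addr0, subr0) ltxx; case=> // -[].
have [m [a [m0 u0E u1E]]] : exists n a, [/\ 0 < n, u0 = n * cos a & u1 = n * sin a].
  apply: polar_exists; have : u0 ^+ 2 + u1 ^+ 2 = dot2 d1 d1 * dot2 d2 d2 by rewrite /u0 /u1 /dot2 /det2; ring.
  have [->|] := eqVneq u0 0; last by left.
  have [->|] := eqVneq u1 0; last by right.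
  by rewrite expr0n addr0 => E; move: d12; rewrite -E ltxx.
pose n t := Num.sqrt (Re t ^+ 2 + Im t ^+ 2).
pose b t := 2 * atan (Im t / (n t + Re t)).
exists (fun t => 2 * pi * t + a + b t); split.
- have wc : continuous w.
    move=> t; rewrite /continuous_at wE; under eq_cvg do rewrite wE.
    have l : (fun x : R => 2 * pi * x) @ t --> 2 * pi * t by apply: cvgM; [exact: cvg_cst|exact: cvg_id].
    apply: cvg_row2; (apply: cvgM; first exact: cvg_cst).
      exact: (@cvg_comp _ _ _ _ (@cos R) _ _ _ l (@continuous_cos R _)).
    exact: (@cvg_comp _ _ _ _ (@sin R) _ _ _ l (@continuous_sin R _)).
  move=> t.
  have wt : w @ (t : subspace `[0,1]) --> w t by apply: continuous_subspaceT; exact: wc.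
  have Dt : D @ (t : subspace `[0,1]) --> D t by apply: cvgB; [exact: cf|exact: cvg_cst].
  have c1 : (fun=> d1) @ (t : subspace `[0, 1]) --> d1 by exact: cvg_cst.
  have c2 : (fun=> d2) @ (t : subspace `[0, 1]) --> d2 by exact: cvg_cst.
  have w1 := cvg_det2 c1 wt; have w2 := cvg_dot2 c1 wt.
  have D1 := cvg_det2 c2 Dt; have D2 := cvg_dot2 c2 Dt.
  have Rt : Re @ (t : subspace `[0,1]) --> Re t.
    by apply: cvgD; (apply: cvgM; [exact: D2|exact: w2]) || (apply: cvgM; [exact: D1|exact: w1]).
  have It : Im @ (t : subspace `[0,1]) --> Im t.
    by apply: cvgB; (apply: cvgM; [exact: w2|exact: D1]) || (apply: cvgM; [exact: D2|exact: w1]).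
  apply: cvgD.
    apply: cvgD; last exact: cvg_cst.
    by apply: continuous_subspaceT => x; apply: cvgM; [exact: cvg_cst|exact: cvg_id].
  apply: cvgM; first exact: cvg_cst.
  apply: (@cvg_comp _ _ _ _ (@atan R)); last exact: continuous_atan.
  have [n0 nR _ _] := polar_atan (zP t).
  apply: cvgM => //; apply: cvgV; first by rewrite gt_eqF.
  apply: cvgD => //; apply: (@cvg_comp _ _ _ _ (@Num.sqrt R)); last exact: sqrt_continuous.
  by apply: cvgD; rewrite expr2; apply: cvgM.
- have -> : b 1 = b 0.
    have E : w 1 = w 0.
      by rewrite !wE mulr1 mulr0 mulr_natl cos2pi sin2pi cos0 sin0.
    by rewrite /b /n /Re /Im /D E.
  by ring.
move=> t _.
have [n0 _ RE IE] := polar_atan (zP t); rewrite -/(n t) -/(b t) in n0 RE IE.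
(* With u = conj(d1) d2 the product w u z equals |d1|^2 |d2|^2 |w|^2 times [D t]; the radius is the
   quotient of the moduli. *)
exists (r * m * n t / (dot2 d1 d1 * dot2 d2 d2 * r ^+ 2)).
  by apply: divr_gt0; [rewrite !mulr_gt0|apply: mulr_gt0 => //; rewrite exprn_gt0].
rewrite -/(w t); have -> : f (p + w t) = f p + D t by rewrite /D [RHS]addrC subrK.
congr (_ + _).
have cs := cos2Dsin2 (2 * pi * t).
have [W0 W1] : w t ord0 i0 = r * cos (2 * pi * t) /\ w t ord0 i1 = r * sin (2 * pi * t) by rewrite wE !row2E.
set K := dot2 d1 d1 * dot2 d2 d2 * r ^+ 2.
have K0 : K != 0 by rewrite gt_eqF // mulr_gt0 // exprn_gt0.
apply: (scalerI K0); rewrite scalerA mulrCA mulfV // mulr1.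
have dirE x : direction x = row2 (cos x) (sin x) by [].
rewrite dirE !(cosD, sinD).
have e1 : r * m * n t * ((cos (2 * pi * t) * cos a - sin (2 * pi * t) * sin a) * cos (b t) -
   (sin (2 * pi * t) * cos a + cos (2 * pi * t) * sin a) * sin (b t)) =
   (w t ord0 i0 * u0 - w t ord0 i1 * u1) * Re t - (w t ord0 i1 * u0 + w t ord0 i0 * u1) * Im t.
  by rewrite RE IE W0 W1 u0E u1E; ring.
have e2 : r * m * n t * ((sin (2 * pi * t) * cos a + cos (2 * pi * t) * sin a) * cos (b t) +
   (cos (2 * pi * t) * cos a - sin (2 * pi * t) * sin a) * sin (b t)) =
   (w t ord0 i0 * u0 - w t ord0 i1 * u1) * Im t + (w t ord0 i1 * u0 + w t ord0 i0 * u1) * Re t.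
  by rewrite RE IE W0 W1 u0E u1E; ring.
have Kw : K = dot2 d1 d1 * dot2 d2 d2 * (w t ord0 i0 ^+ 2 + w t ord0 i1 ^+ 2).
  by rewrite W0 W1 /K; congr (_ * _); transitivity (r ^+ 2 * (cos (2 * pi * t) ^+ 2 + sin (2 * pi * t) ^+ 2)); [by rewrite cs mulr1|ring].
apply: row2P; rewrite [LHS]mxE [RHS]mxE row2E ?e1 ?e2 Kw /Re /Im /u0 /u1 /det2 /dot2; ring.
Qed.

Lemma continuous_addl p : continuous (fun w : plane => p + w).
Proof. by move=> x; apply: continuousD; [exact: cst_continuous|exact: cvg_id]. Qed.

Lemma near0_ball (A : set plane) : nbhs (0 : plane) A ->
  exists2 e : R, 0 < e & forall r a, 0 < r < e -> A (r *: direction a).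
Proof.
move=> /nbhs_ballP[e /= e0 eA]; exists e => // r a /andP[r0 re].
apply: eA; rewrite -ball_normE /= sub0r normrN.
apply: le_lt_trans re; rewrite /Num.norm /= mx_normE -[leRHS]/((NngNum (ltW r0))%:num).
rewrite [_ <= _]num_le; apply/bigmax_leP; split; first by rewrite -num_le /= ltW.
move=> [i j] _; rewrite -num_le /= !mxE normrM (gtr0_norm r0) -[leRHS]mulr1 ler_pM2l //.
by case: ifP => _; rewrite ler_norml ?cos_le1 ?cos_geN1 ?sin_le1 ?sin_geN1.
Qed.

Lemma same_side_orientation (U : set plane) (f : plane -> plane) : open U -> {in U, continuous f} ->
  (forall p, U p -> exists d1 d2, \forall w \near (0 : plane), w != 0 ->
     same_side d1 w d2 (f (p + w) - f p)) ->
  orientation_preserving U f.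
Proof.
move=> oU cf H p Up; have [d1 [d2 ss]] := H _ Up.
have Uw : \forall w \near (0 : plane), U (p + w).
  have := @continuous_addl p 0; rewrite /continuous_at addr0; apply; exact: open_nbhs_nbhs.
have [e e0 He] := near0_ball (filterI ss Uw).
near=> r.
have r0 : 0 < r by near: r; exact: nbhs_right_gt.
have re' : 0 < r < e by rewrite r0; near: r; exact: nbhs_right_lt.
have dn a : r *: (direction a : plane) != 0.
  rewrite scaler_eq0 negb_or gt_eqF //=; apply/eqP => E.
  have := cos2Dsin2 a; have := congr1 (fun v : plane => v ord0 i0) E.
  have := congr1 (fun v : plane => v ord0 i1) E; rewrite !mxE /= => -> ->.
  by rewrite expr0n /= addr0 => /eqP; rewrite eq_sym oner_eq0.
apply: (@winds_once_same_side _ _ _ d1 d2) => //; last first.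
  by move=> a; apply: (He r a re').1.
apply: continuous_subspaceT => t.
apply: (@cvg_comp _ _ _ (fun t => p + r *: direction (2 * pi * t)) f); last first.
  by apply: cf; rewrite inE; exact: (He r _ re').2.
apply: cvgD; first exact: cvg_cst.
apply: cvg_rV => i; rewrite mxE; under eq_cvg do rewrite mxE.
apply: cvgM; first exact: cvg_cst.
have l : (fun x : R => 2 * pi * x) @ t --> 2 * pi * t by apply: cvgM; [exact: cvg_cst|exact: cvg_id].
rewrite mxE; under eq_cvg do rewrite mxE.
case: ifP => _.
  exact: (@cvg_comp _ _ _ _ (@cos R) _ _ _ l (@continuous_cos R _)).
exact: (@cvg_comp _ _ _ _ (@sin R) _ _ _ l (@continuous_sin R _)).
Unshelve. all: by end_near.
Qed.

End Winding.

(** * Spaces glued from triangles *)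

Section Indices.
Implicit Types i j k : 'I_3.

(** Labels are treated cyclically as elements of Z/3, so that one argument relative to [j] serves
    all three corners. *)
Lemma ord3P (P : 'I_3 -> Prop) j : P j -> P (j + 1) -> P (j + 2%:R) -> forall i, P i.
Proof.
move=> P0 P1 P2 i; have : [|| i == j, i == j + 1 | i == j + 2%:R].
  by case: i => -[|[|[|//]]] ?; case: j {P0 P1 P2} => -[|[|[|//]]].
by case/or3P => /eqP ->.
Qed.

Lemma ord3_neq i j : (i != j) = (i == j + 1) || (i == j + 2%:R).
Proof. by case: i => -[|[|[|//]]] ?; case: j => -[|[|[|//]]]. Qed.

Lemma ord3_add1 j : (j + 1 == j) = false. Proof. by case: j => -[|[|[|//]]]. Qed.
Lemma ord3_add2 j : (j + 2%:R == j) = false. Proof. by case: j => -[|[|[|//]]]. Qed.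
Lemma ord3_add12 j : (j + 1 == j + 2%:R) = false. Proof. by case: j => -[|[|[|//]]]. Qed.
Lemma ord3_11 j : j + 1 + 1 = j + 2%:R. Proof. by rewrite -addrA. Qed.
Lemma ord3_12 j : j + 1 + 2%:R = j.
Proof. by case: j => -[|[|[|//]]] ?; apply/val_inj. Qed.
Lemma ord3_21 j : j + 2%:R + 1 = j.
Proof. by case: j => -[|[|[|//]]] ?; apply/val_inj. Qed.
Lemma ord3_22 j : j + 2%:R + 2%:R = j + 1.
Proof. by case: j => -[|[|[|//]]] ?; apply/val_inj. Qed.

End Indices.

Section Simplices.
Variables (R : realType).

Lemma simplex_ge0 n (p : 'rV[R]_n) i : simplex n p -> 0 <= p ord0 i.
Proof. by case. Qed.

Lemma simplex_le1 n (p : 'rV[R]_n) i : simplex n p -> p ord0 i <= 1.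
Proof. by case=> p0 <-; rewrite (bigD1 i) //= lerDl sumr_ge0. Qed.

Lemma sum3 (F : 'I_3 -> R) j : \sum_i F i = F j + F (j + 1) + F (j + 2%:R).
Proof.
rewrite (bigD1 j) //= (bigD1 (j + 1)) /= ?ord3_add1 // (bigD1 (j + 2%:R)) /=.
  rewrite big1 ?addr0; first exact: addrA.
  move=> i /andP[/andP[h1 /negbTE h2] /negbTE h3].
  by move: h1; rewrite ord3_neq h2 h3.
by rewrite ord3_add2 eq_sym ord3_add12.
Qed.

Lemma simplex3_sum (p : 'rV[R]_3) j : simplex 3 p ->
  p ord0 j + p ord0 (j + 1) + p ord0 (j + 2%:R) = 1.
Proof. by case=> _ <-; rewrite (sum3 _ j). Qed.

Lemma continuous_sum_coord n : continuous (fun p : 'rV[R]_n => \sum_i p ord0 i).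
Proof.
elim: (index_enum _) => [|i s IH].
  rewrite (_ : (fun p => _) = fun=> 0); first exact: cst_continuous.
  by apply/funext => p; rewrite big_nil.
rewrite (_ : (fun p => _) = fun p : 'rV[R]_n => p ord0 i + \sum_(i <- s) p ord0 i).
  by move=> x; exact: (cvgD (@coord_continuous R 1 n ord0 i x) (IH x)).
by apply/funext => p; rewrite big_cons.
Qed.

Lemma simplex_closed n : closed (@simplex R n).
Proof.
have -> : @simplex R n = (\bigcap_i [set p | 0 <= p ord0 i]) `&` [set p | \sum_i p ord0 i = 1].
  by apply/seteqP; split=> [p [p0 p1]|p [p0 p1]]; split=> // i; [move=> _; exact: p0|exact: p0].
apply: closedI.
  apply: closed_bigI => i _.
  apply: (@closed_comp _ _ (fun p : 'rV[R]_n => p ord0 i) [set x | 0 <= x]).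
    by move=> *; exact: coord_continuous.
  exact: closed_ge.
apply: (@closed_comp _ _ (fun p : 'rV[R]_n => \sum_i p ord0 i) [set x | x = 1]).
  by move=> *; exact: continuous_sum_coord.
exact: closed_eq.
Qed.

Lemma simplex_compact n : compact (@simplex R n).
Proof.
apply: (@subclosed_compact _ _ [set v : 'rV[R]_n | forall i, `[0, 1]%classic (v ord0 i)]).
- exact: simplex_closed.
- exact: (@rV_compact R n (fun=> `[0, 1]%classic) (fun _ => @segment_compact R 0 1)).
- by move=> p sp i; rewrite /= in_itv /= simplex_ge0 // simplex_le1.
Qed.

Lemma simplex_convex n (p q : 'rV[R]_n) t : 0 <= t <= 1 ->
  simplex n p -> simplex n q -> simplex n ((1 - t) *: p + t *: q).
Proof.
move=> /andP[t0 t1] [p0 p1] [q0 q1]; split=> [i|].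
  by rewrite !mxE addr_ge0 // mulr_ge0 // subr_ge0.
under eq_bigr do rewrite !mxE.
by rewrite big_split /= -!mulr_sumr p1 q1; ring.
Qed.

Lemma star_shaped_connected n (D : set 'rV[R]_n) p0 : D p0 ->
  (forall p t, D p -> 0 <= t <= 1 -> D ((1 - t) *: p0 + t *: p)) -> connected D.
Proof.
move=> Dp0 DS; pose seg (p : 'rV[R]_n) := (fun t : R => (1 - t) *: p0 + t *: p) @` `[0, 1]%classic.
have -> : D = \bigcup_(p in D) seg p.
  apply/seteqP; split=> [p sp|_ [p sp] [t /= t01 <-]].
    by exists p => //; exists 1; rewrite /= ?in_itv /= ?ler01 ?lexx // subrr scale0r add0r scale1r.
  exact: DS.
apply: bigcup_connected.
  exists p0 => p _; exists 0; rewrite /= ?in_itv /= ?ler01 ?lexx //.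
  by rewrite subr0 scale0r addr0 scale1r.
move=> p sp; apply: connected_continuous_connected; first exact: segment_connected.
apply: continuous_subspaceT => t; apply: cvg_rV => i; rewrite !mxE.
under eq_cvg do rewrite !mxE.
apply: cvgD; (apply: cvgM; last exact: cvg_cst); last exact: cvg_id.
by apply: cvgB; [exact: cvg_cst|exact: cvg_id].
Qed.

Lemma connected_simplex n : connected (@simplex R n).
Proof.
have [[p0 sp0]|/forallNP E] := pselect (exists p : 'rV[R]_n, simplex n p); last first.
  suff -> : @simplex R n = set0 by exact: connected0.
  by apply/seteqP; split=> // p /E.
by apply: (star_shaped_connected sp0) => p t sp t01; exact: simplex_convex.
Qed.

Definition row3 j (a b c : R) : 'rV[R]_3 :=
  \row_i (if i == j then a else if i == j + 1 then b else c).

Lemma row3_0 j a b c : row3 j a b c ord0 j = a.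
Proof. by rewrite mxE eqxx. Qed.
Lemma row3_1 j a b c : row3 j a b c ord0 (j + 1) = b.
Proof. by rewrite mxE ord3_add1 eqxx. Qed.
Lemma row3_2 j a b c : row3 j a b c ord0 (j + 2%:R) = c.
Proof. by rewrite mxE ord3_add2 eq_sym ord3_add12. Qed.
Definition row3E := (row3_0, row3_1, row3_2).

Lemma row3P j (p q : 'rV[R]_3) : p ord0 j = q ord0 j -> p ord0 (j + 1) = q ord0 (j + 1) ->
  p ord0 (j + 2%:R) = q ord0 (j + 2%:R) -> p = q.
Proof. by move=> e0 e1 e2; apply/rowP => i; apply: (@ord3P (fun i => p ord0 i = q ord0 i) j). Qed.

Lemma simplex_row3 j a b c : 0 <= a -> 0 <= b -> 0 <= c -> a + b + c = 1 ->
  simplex 3 (row3 j a b c).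
Proof.
move=> a0 b0 c0 s; split; last by rewrite (sum3 _ j) !row3E.
by apply: (@ord3P _ j); rewrite row3E.
Qed.

End Simplices.

Section Words.
Variables (G : Type) (adj : 'I_3 -> G -> G).
Implicit Types (P Q : pred 'I_3) (g h : G).

Inductive reach P g : G -> Prop :=
| reach_refl : reach P g g
| reach_step i h : P i -> reach P g h -> reach P g (adj i h).

Lemma reach_trans P g h k : reach P g h -> reach P h k -> reach P g k.
Proof. by move=> gh; elim=> // i k' Pi _; exact: reach_step. Qed.

Lemma reach_sub P Q g h : (forall i, P i -> Q i) -> reach P g h -> reach Q g h.
Proof. by move=> PQ; elim=> [|i k Pi _]; [exact: reach_refl|apply: reach_step; exact: PQ]. Qed.

Lemma reach1 P g i : P i -> reach P g (adj i g).
Proof. by move=> Pi; apply: reach_step => //; exact: reach_refl. Qed.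

Hypothesis adjK : forall i, involutive (adj i).

Lemma reach_sym P g h : reach P g h -> reach P h g.
Proof.
elim=> [|i k Pi _ IH]; first exact: reach_refl.
by apply: reach_trans IH; rewrite -{2}(adjK i k); exact: reach1.
Qed.

End Words.

(** The quotient of G copies of the simplex: side [i] is where coordinate [i] vanishes, and a point
    is shared by exactly those triangles that are reached by crossing sides through it. Only half of
    the quotient topology is stated as openness of saturated sets; continuity of [tri] is the other
    half. *)
Record gluing (R : realType) (G : choiceType) (X : topologicalType)
  (adj : 'I_3 -> G -> G) (tri : G -> 'rV[R]_3 -> X) : Prop := Gluing {
  gluing_adjK : forall i, involutive (adj i);
  gluing_open : forall U : set X, (forall g, exists2 V : set 'rV[R]_3, open V &
    forall p, simplex 3 p -> (U (tri g p) <-> V p)) -> open U;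
  gluing_cont : forall g, {within simplex 3, continuous (tri g)};
  gluing_surj : forall x, exists g p, simplex 3 p /\ tri g p = x;
  gluing_eq : forall g h p q, simplex 3 p -> simplex 3 q ->
    (tri g p = tri h q <-> p = q /\ reach adj (fun i => p ord0 i == 0) g h) }.

Section GluingTheory.
Variables (R : realType) (G : choiceType) (X : topologicalType)
  (adj : 'I_3 -> G -> G) (tri : G -> 'rV[R]_3 -> X).
Hypothesis gl : gluing adj tri.
Implicit Types (P Q : pred 'I_3) (g h : G) (p q : 'rV[R]_3) (i j : 'I_3).

Let adjK := gluing_adjK gl.

Lemma tri_eqP g h p q : simplex 3 p -> simplex 3 q -> tri g p = tri h q ->
  p = q /\ reach adj (fun i => p ord0 i == 0) g h.
Proof. by move=> sp sq /(gluing_eq gl g h sp sq). Qed.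

Lemma tri_reach g h p : simplex 3 p -> reach adj (fun i => p ord0 i == 0) g h ->
  tri g p = tri h p.
Proof. by move=> sp gh; apply/(gluing_eq gl _ _ sp sp). Qed.

Lemma tri_adj i g p : simplex 3 p -> p ord0 i = 0 -> tri (adj i g) p = tri g p.
Proof. by move=> sp p0; apply/esym/tri_reach => //; apply: reach1; rewrite p0. Qed.

Lemma open_tri_near (U : set X) :
  (forall g p, simplex 3 p -> U (tri g p) ->
     \forall q \near p, simplex 3 q -> U (tri g q)) -> open U.
Proof.
move=> H; apply: (gluing_open gl) => g.
exists [set q | simplex 3 q -> U (tri g q)]°; first exact: open_interior.
by move=> p sp; split=> [Up|/nbhs_singleton]; [exact: H|exact].
Qed.

Lemma tri_near (U : set X) g p : open U -> simplex 3 p -> U (tri g p) ->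
  \forall q \near p, simplex 3 q -> U (tri g q).
Proof.
move=> oU sp Up; have := @gluing_cont _ _ _ _ _ gl g => /subspace_continuousP/(_ p sp).
by apply; exact: open_nbhs_nbhs.
Qed.

Section Descend.
Variables (Y : topologicalType) (phi : G -> 'rV[R]_3 -> Y).

(** Passage to the quotient by choosing a preimage of the point. The default value of [xget] is
    never attained, because preimages exist. *)
Definition descend x : Y :=
  let gp := xget (sval (cid (gluing_surj gl x)), 0)
    [set gp | simplex 3 gp.2 /\ tri gp.1 gp.2 = x] in phi gp.1 gp.2.

Hypothesis phi_adj : forall g p i, simplex 3 p -> p ord0 i = 0 ->
  phi (adj i g) p = phi g p.

Lemma descendE g p : simplex 3 p -> descend (tri g p) = phi g p.
Proof.
move=> sp; rewrite /descend; case: xgetP => [[h q] _ [/= sq]|]; last first.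
  by move/(_ (g, p)) => [].
move=> /(tri_eqP sq sp) [<-]; elim=> // i k q0 _ ->.
by rewrite phi_adj //; exact/eqP.
Qed.

End Descend.

Lemma continuous_at_tri (Y : topologicalType) (f : X -> Y) (D : set X) : open D ->
  (forall g p, simplex 3 p -> D (tri g p) ->
     forall V, nbhs (f (tri g p)) V -> \forall q \near p, simplex 3 q -> V (f (tri g q))) ->
  {in D, continuous f}.
Proof.
move=> oD H x; rewrite inE => Dx V /nbhs_interior fV.
have oW : open (D `&` f @^-1` V°).
  apply: open_tri_near => g p sp [Dp fp]; near=> q => sq; split.
    by move: sq; near: q; exact: tri_near.
  by move: sq; near: q; apply: H => //; apply: open_nbhs_nbhs; split => //; exact: open_interior.
have : nbhs x (D `&` f @^-1` V°) by apply: open_nbhs_nbhs; split => //; split=> //; exact: nbhs_singleton fV.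
by apply: filterS => y [_ /nbhs_singleton].
Unshelve. all: by end_near.
Qed.

(** The open star of the simplex spanned by the corners outside [P]: sides in [P] may be crossed,
    coordinates outside [P] stay positive. The set [N] restricts the coordinates further and is the
    same in all these triangles. *)
Definition ostar P g (N : set 'rV[R]_3) : set X :=
  [set x | exists h q, [/\ reach adj P g h, simplex 3 q, N q,
     forall k, ~~ P k -> 0 < q ord0 k & tri h q = x]].

Lemma ostarP P g N h q : simplex 3 q -> ostar P g N (tri h q) <->
  [/\ reach adj P g h, N q & forall k, ~~ P k -> 0 < q ord0 k].
Proof.
move=> sq; split=> [[h' [q' [gh sq' Nq' q'0 /(tri_eqP sq' sq) [E r]]]]|[gh Nq q0]]; last by exists h, q.
rewrite -E; split=> //; apply: reach_trans gh (reach_sub _ r) => i /eqP qi.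
by apply: contraT => /q'0; rewrite qi ltxx.
Qed.

Lemma near_coord p i V : nbhs (p ord0 i) V -> \forall q \near p, V ((q : 'rV[R]_3) ord0 i).
Proof. exact: (@coord_continuous R 1 3 ord0 i p V). Qed.

Lemma near_coord_gt0 p i : 0 < p ord0 i -> \forall q \near p, 0 < (q : 'rV[R]_3) ord0 i.
Proof.
by move=> p0; apply: (@near_coord _ _ [set x | 0 < x]); apply: open_nbhs_nbhs; split=> //; exact: open_gt.
Qed.

Lemma ostar_open P g N : open N -> open (ostar P g N).
Proof.
move=> oN; apply: open_tri_near => h p sp /(ostarP _ _ _ _ sp) [gh Np p0].
have H : \forall q \near p, forall k, ~~ P k -> 0 < (q : 'rV[R]_3) ord0 k.
  have H k : \forall q \near p, ~~ P k -> 0 < (q : 'rV[R]_3) ord0 k; last first.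
    apply: filterS3 (H 0) (H (0 + 1)) (H (0 + 2%:R)) => q h0 h1 h2.
    by apply: (@ord3P (fun k => ~~ P k -> 0 < q ord0 k) 0).
  case: (boolP (P k)) => Pk; first by near=> q => ?.
  by apply: filterS (near_coord_gt0 (p0 _ Pk)) => q.
have Nq : \forall q \near p, N q by exact: open_nbhs_nbhs.
by near=> q => sq; apply/ostarP => //; split=> //; near: q.
Unshelve. all: by end_near.
Qed.

Definition corner_pred j : pred 'I_3 := fun i => i != j.
Definition star j g : set X := ostar (corner_pred j) g setT.

Lemma starP j g h q : simplex 3 q ->
  star j g (tri h q) <-> reach adj (corner_pred j) g h /\ 0 < q ord0 j.
Proof.
move=> sq; rewrite /star ostarP //; split=> [[gh _ ->]|[gh qj]]; rewrite ?negbK ?eqxx //.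
by split=> // k; rewrite negbK => /eqP ->.
Qed.

Lemma star_open j g : open (star j g).
Proof. by apply: ostar_open; exact: openT. Qed.

(** The barycentric coordinate of corner [j] of the triangle [g], extended by zero off the star of
    that corner. *)
Definition hat j g : X -> R :=
  descend (fun h p => if `[< reach adj (corner_pred j) g h >] then p ord0 j else 0).

Lemma hatE j g h p : simplex 3 p ->
  hat j g (tri h p) = if `[< reach adj (corner_pred j) g h >] then p ord0 j else 0.
Proof.
move=> sp; apply: descendE => // {sp}h {}p i sp p0.
case: (eqVneq i j) p0 => [->|ij] p0; first by rewrite p0 !if_same.
congr (if _ then _ else _); apply: asbool_equiv_eq; split=> r; last exact: reach_step.
by rewrite -(adjK i h); exact: reach_step.
Qed.

Lemma hat_continuous j g : continuous (hat j g).
Proof.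
move=> x; apply: (@continuous_at_tri _ _ setT openT _ x (in_setT _)) => h p sp _ V.
rewrite hatE // => fV; case: ifP fV => r fV; last first.
  by near=> q => sq; rewrite hatE // r; exact: nbhs_singleton fV.
apply: filterS (near_coord fV) => q Vq sq.
by rewrite hatE // r.
Unshelve. all: by end_near.
Qed.

Lemma hat_gt0 j g x : 0 < hat j g x <-> star j g x.
Proof.
have [h [p [sp <-]]] := gluing_surj gl x; rewrite starP // hatE //.
case: ifPn => [/asboolP r|/asboolP r]; first by split=> // -[].
by rewrite ltxx; split=> // -[].
Qed.

Lemma star_cover x : exists j g, star j g x.
Proof.
have [g [p [sp <-]]] := gluing_surj gl x.
have [j pj] : exists j, 0 < p ord0 j.
  apply: contrapT => /forallNP np; have [p0 p1] := sp.
  move: p1; rewrite big1 => [/eqP|i _]; first by rewrite eq_sym oner_eq0.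
  by apply/eqP; rewrite eq_le p0 andbT leNgt; exact/negP/np.
by exists j, g; rewrite starP //; split=> //; exact: reach_refl.
Qed.

Definition face g : set X := tri g @` simplex 3.

Lemma face_compact g : compact (face g).
Proof. by apply: continuous_compact; [exact: (@gluing_cont _ _ _ _ _ gl g)|exact: simplex_compact]. Qed.

Lemma vertex_simplex (j : 'I_3) : simplex 3 (row3 j 1 0 0 : 'rV[R]_3).
Proof. by apply: simplex_row3; rewrite ?ler01 ?lexx // !addr0. Qed.

Inductive path_in (S : set G) g : G -> Prop :=
| path_in_refl : S g -> path_in S g g
| path_in_step i h : path_in S g h -> S (adj i h) -> path_in S g (adj i h).

(** Neighbouring cells overlap because [D] contains a point of every side. The set [D] is left
    general since both full triangles and truncated ones are needed. *)
Lemma connected_cells (D : set 'rV[R]_3) (S : set G) g : D `<=` simplex 3 -> connected D ->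
  (forall i, exists2 p, D p & p ord0 i = 0) ->
  S g -> (forall h, S h -> path_in S g h) ->
  connected (\bigcup_(h in S) (tri h @` D)).
Proof.
move=> sD cD D0 Sg H.
have cell_connected h : connected (tri h @` D).
  apply: connected_continuous_connected => //.
  exact: continuous_subspaceW sD (@gluing_cont _ _ _ _ _ gl h).
have key h : path_in S g h -> exists2 C, connected C &
    [/\ tri g @` D `<=` C, tri h @` D `<=` C & C `<=` \bigcup_(h in S) (tri h @` D)].
  elim=> [_|i k _ [C cC [gC hC CS]] Sk].
    by exists (tri g @` D) => //; split=> // x xg; exists g.
  exists (C `|` tri (adj i k) @` D).
    apply: connectedU => //; have [p Dp p0] := D0 i.
    exists (tri k p); split; first by apply: hC; exists p.
    by exists p => //; apply: tri_adj => //; exact: sD.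
  split; [by move=> x /gC; left|by move=> x; right|].
  by move=> x [/CS //|xk]; exists (adj i k).
have -> : \bigcup_(h in S) (tri h @` D) = \bigcup_(C in [set C | [/\ connected C,
    tri g @` D `<=` C & C `<=` \bigcup_(h in S) (tri h @` D)]]) C.
  apply/seteqP; split=> x.
    by move=> [h Sh xh]; have [C cC [gC hC CS]] := key _ (H _ Sh); exists C; [split|exact: hC].
  by move=> [C [_ _ CS] /CS].
apply: bigcup_connected; last by move=> C [].
by have [p Dp _] := D0 0; exists (tri g p) => C [_ gC _]; apply: gC; exists p.
Qed.

Lemma connected_faces (S : set G) g : S g -> (forall h, S h -> path_in S g h) ->
  connected (\bigcup_(h in S) face h).
Proof.
apply: connected_cells => //; first exact: connected_simplex.
by move=> i; exists (row3 (i + 1) 1 0 0); [exact: vertex_simplex|rewrite -{2}(ord3_12 i) row3_2].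
Qed.

End GluingTheory.

Lemma periodic_mod (T : Type) (f : nat -> T) n k :
  (forall k, f (k + n)%N = f k) -> f (k %% n)%N = f k.
Proof.
move=> H; rewrite [in RHS](divn_eq k n) addnC.
by elim: (k %/ n)%N => [|q ->]; rewrite ?mul0n ?addn0 // mulSnr addnA H.
Qed.

(** * Fans of rays in the plane *)

Section Fan.
Variables (R : realType) (M : nat).
Hypothesis M1 : (1 < M)%N.
Notation plane := 'rV[R]_2.
Implicit Types (x y : R) (v : plane) (k : nat).

(* 2 M rays around the origin, with rational coordinates: the first M of them
   point into the right half of the upper half plane, the others are their
   opposites. *)
Definition ray k : plane := (-1) ^+ (k %/ M) *: row2 1 (k %% M)%:R.

Lemma ray_small k : (k < M)%N -> ray k = row2 1 k%:R.
Proof. by move=> kM; rewrite /ray divn_small // modn_small // expr0 scale1r. Qed.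

Lemma rayD k : ray (k + M) = - ray k.
Proof.
rewrite /ray divnDr ?dvdnn // divnn (ltn_trans _ M1) // modnDr.
by rewrite exprD expr1 mulrN1 scaleNr.
Qed.

Lemma rayD2 k : ray (k + M.*2) = ray k.
Proof. by rewrite -addnn addnA !rayD opprK. Qed.

Lemma rayM : ray M = row2 (-1) 0.
Proof.
rewrite -[M]add0n rayD ray_small ?(ltn_trans _ M1) //.
by apply: row2P; rewrite mxE !row2E ?oppr0.
Qed.

Lemma det2NN (u v : plane) : det2 (- u) (- v) = det2 u v.
Proof. by rewrite /det2 !mxE; ring. Qed.

Lemma M1R : 0 < (M.-1)%:R :> R.
Proof. by rewrite ltr0n; case: M M1 => [|[]]. Qed.

Lemma det_ray k : 0 < det2 (ray k) (ray k.+1).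
Proof.
elim/ltn_ind: k => k IH; have [kM|Mk] := ltnP k.+1 M.
  rewrite !ray_small ?(ltnW kM) // /det2 !row2E -natr1; lra.
have [kM|Mk'] := ltnP k M.
  have Mk1 : k.+1 = M by apply/eqP; rewrite eqn_leq kM.
  rewrite Mk1 rayM ray_small // /det2 !row2E.
  have := M1R; rewrite -Mk1 /=; lra.
rewrite -(subnK Mk') -addSn !rayD det2NN; apply: IH.
by rewrite ltn_subrL (ltn_trans _ M1) // (leq_trans _ Mk') // (ltn_trans _ M1).
Qed.

Definition sect k x y : plane := x *: ray k + y *: ray k.+1.

Definition coord0 k v := det2 v (ray k.+1) / det2 (ray k) (ray k.+1).
Definition coord1 k v := det2 (ray k) v / det2 (ray k) (ray k.+1).

Lemma coord0E k x y : coord0 k (sect k x y) = x.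
Proof.
rewrite /coord0; apply: (canLR (mulfK _)); first by rewrite gt_eqF // det_ray.
by rewrite /sect /det2 !mxE; ring.
Qed.

Lemma coord1E k x y : coord1 k (sect k x y) = y.
Proof.
rewrite /coord1; apply: (canLR (mulfK _)); first by rewrite gt_eqF // det_ray.
by rewrite /sect /det2 !mxE; ring.
Qed.

Lemma sect_coord k v : sect k (coord0 k v) (coord1 k v) = v.
Proof.
have D0 : det2 (ray k) (ray k.+1) != 0 by rewrite gt_eqF // det_ray.
have E : det2 (ray k) (ray k.+1) *: v = det2 v (ray k.+1) *: ray k + det2 (ray k) v *: ray k.+1.
  by apply: row2P; rewrite [LHS]mxE [RHS]mxE [X in _ = X + _]mxE [X in _ = _ + X]mxE /det2; ring.
apply: (scalerI D0); rewrite E /sect scalerDr !scalerA /coord0 /coord1.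
by rewrite !(mulrC (det2 (ray k) (ray k.+1))) !divfK.
Qed.

Lemma sectD k x y : sect (k + M) x y = - sect k x y.
Proof. by rewrite /sect -addSn !rayD !scalerN opprD. Qed.

Lemma continuous_coord0 k : continuous (coord0 k).
Proof.
suff c (v : plane) : {for v, continuous (fun v => det2 v (ray k.+1) / det2 (ray k) (ray k.+1))} by exact: c.
apply: contM; last exact: cont_cst.
by apply: continuous_det2; [exact: cvg_id|exact: cst_continuous].
Qed.

Lemma continuous_coord1 k : continuous (coord1 k).
Proof.
suff c (v : plane) : {for v, continuous (fun v => det2 (ray k) v / det2 (ray k) (ray k.+1))} by exact: c.
apply: contM; last exact: cont_cst.
by apply: continuous_det2; [exact: cst_continuous|exact: cvg_id].
Qed.

Definition upper v := (0 < v ord0 i1) || (v ord0 i1 == 0) && (0 < v ord0 i0).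

(** Ray k < M has slope k, so the index of a direction in the upper half plane is the integer part
    of its slope. The last sector, M - 1, takes everything from slope M - 1 to the negative
    horizontal axis. *)
Definition base v : nat :=
  if v ord0 i1 < (M.-1)%:R * v ord0 i0 then Num.truncn (v ord0 i1 / v ord0 i0) else M.-1.

Definition sector v : nat := if upper v then base v else (base (- v) + M)%N.

Lemma upperN v : upper v -> ~~ upper (- v).
Proof.
rewrite /upper !mxE oppr_gt0 oppr_eq0 oppr_gt0 => /orP[v0|/andP[/eqP -> v0]].
  by rewrite negb_or -leNgt (ltW v0) gt_eqF.
by rewrite ltxx eqxx /= -leNgt ltW.
Qed.

Lemma base_sect k x y : (k < M)%N -> 0 < x -> 0 <= y ->
  upper (sect k x y) /\ base (sect k x y) = k.
Proof.
move=> kM x0 y0; have [kM1|Mk] := ltnP k.+1 M.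
  have [e0 e1] : (sect k x y) ord0 i0 = x + y /\ (sect k x y) ord0 i1 = k%:R * (x + y) + y.
    by rewrite /sect !ray_small // !vecE !row2E -natr1; split; ring.
  have xy : 0 < x + y by lra.
  split.
    rewrite /upper e0 e1 xy andbT.
    have : 0 <= k%:R * (x + y) + y by rewrite addr_ge0 // mulr_ge0 // ltW.
    by rewrite le_eqVlt eq_sym orbC.
  have kx : (k.+1)%:R <= (M.-1)%:R :> R by rewrite ler_nat -ltnS; case: (M) kM1.
  rewrite /base e0 e1 ifT; last first.
    apply: (@lt_le_trans _ _ (k.+1%:R * (x + y))); last by rewrite ler_pM2r.
    by rewrite -natr1; lra.
  apply: truncn_def; rewrite ler_pdivlMr // ltr_pdivrMr // -natr1.
  by apply/andP; split; lra.
have Mk1 : M = k.+1 by apply/eqP; rewrite eqn_leq kM Mk.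
have [e0 e1] : (sect k x y) ord0 i0 = x - y /\ (sect k x y) ord0 i1 = k%:R * x.
  by rewrite /sect ray_small // -Mk1 rayM !vecE !row2E; split; ring.
have k0 : 0 < k%:R :> R by have := M1R; rewrite Mk1.
split; first by rewrite /upper e1 mulr_gt0.
rewrite /base e0 e1 Mk1 /= ifF //; apply/negbTE; rewrite -leNgt ler_pM2l //; lra.
Qed.

Lemma sector_sect k x y : (k < M.*2)%N -> 0 < x -> 0 <= y -> sector (sect k x y) = k.
Proof.
move=> k2M x0 y0; rewrite /sector; have [kM|Mk] := ltnP k M.
  by have [-> ->] := base_sect kM x0 y0.
have [] : upper (sect (k - M) x y) /\ base (sect (k - M) x y) = (k - M)%N.
  by apply: base_sect => //; rewrite ltn_subLR // addnn.
have -> : sect (k - M) x y = - sect k x y by rewrite -{2}(subnK Mk) sectD opprK.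
by move=> /upperN; rewrite opprK => /negbTE -> ->; rewrite subnK.
Qed.

Lemma sector_cover v : exists2 k, (k < M.*2)%N & 0 <= coord0 k v /\ 0 <= coord1 k v.
Proof.
suff H k x y : (k < M.*2)%N -> 0 <= x -> 0 <= y -> v = sect k x y ->
    exists2 k, (k < M.*2)%N & 0 <= coord0 k v /\ 0 <= coord1 k v.
  have {}H (s : bool) (w : plane) : v = (-1) ^+ s *: w -> 0 <= w ord0 i1 ->
      exists2 k, (k < M.*2)%N & 0 <= coord0 k v /\ 0 <= coord1 k v.
    suff key : 0 <= w ord0 i1 -> exists k x y, [/\ (k < M)%N, 0 <= x, 0 <= y & w = sect k x y].
      move=> vw /key [k [x [y [kM x0 y0 wE]]]]; case: s vw => vw.
        apply: (H (k + M)%N x y) => //; first by rewrite -addnn ltn_add2r.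
        by rewrite sectD vw expr1 scaleN1r wE.
      apply: (H k x y) => //; first by rewrite -addnn ltn_addl.
      by rewrite vw expr0 scale1r.
    move=> w1; have [wl|wg] := ltP (w ord0 i1) ((M.-1)%:R * w ord0 i0).
      have w0 : 0 < w ord0 i0 by have := M1R; move=> h; rewrite -(pmulr_rgt0 _ h); lra.
      set k := Num.truncn (w ord0 i1 / w ord0 i0).
      have /truncn_itv/andP[] : 0 <= w ord0 i1 / w ord0 i0 by rewrite divr_ge0 // ltW.
      rewrite -/k ler_pdivlMr // ltr_pdivrMr // -natr1 => k1 k2.
      have kM : (k < M.-1)%N.
        by rewrite truncn_lt_nat ?divr_ge0 // ?ltW // ltr_pdivrMr.
      have k1M : (k.+1 < M)%N by rewrite -ltnS prednK // (ltn_trans _ M1) in kM.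
      exists k, ((k%:R + 1) * w ord0 i0 - w ord0 i1), (w ord0 i1 - k%:R * w ord0 i0).
      split; [exact: ltnW|lra|lra|].
      by apply: row2P; rewrite /sect !ray_small ?(ltnW k1M) // !vecE !row2E -?natr1; ring.
    have M10 := M1R; have MP : M.-1.+1 = M by rewrite prednK // (ltn_trans _ M1).
    exists M.-1, (w ord0 i1 / (M.-1)%:R), (w ord0 i1 / (M.-1)%:R - w ord0 i0).
    split; [by rewrite MP|by rewrite divr_ge0 // ltW|by rewrite subr_ge0 ler_pdivlMr // mulrC|].
    rewrite /sect ray_small ?MP // rayM; apply: row2P; rewrite !vecE !row2E; first ring.
    by rewrite mulr0 addr0 divfK // gt_eqF.
  have [v0|v0] := leP 0 (v ord0 i1).
    by apply: (H false v) => //; rewrite expr0 scale1r.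
  apply: (H true (- v)); first by rewrite expr1 scaleN1r opprK.
  by rewrite mxE oppr_ge0 ltW.
by move=> kM x0 y0 vE; exists k => //; rewrite vE coord0E coord1E.
Qed.

End Fan.

(** Combinatorics of an orientable regular map: [par] is the orientation of a triangle and changes
    across each side, and the rotation about any corner of kind [j] has all its orbits of length
    [m j], so that [2 * m j] triangles meet there. *)
Record triangle_group (G : choiceType) (adj : 'I_3 -> G -> G) (par : G -> bool)
  (m : 'I_3 -> nat) : Prop := TriangleGroup {
  par_adj : forall i g, par (adj i g) = ~~ par g;
  m_gt1 : forall j, (1 < m j)%N;
  cyc_adj : forall j l g,
    iter l (fun h => adj (j + 2%:R) (adj (j + 1) h)) g = g <-> (m j %| l)%N }.

(** * The triangles around a corner *)

Section Turning.
Variables (G : choiceType) (adj : 'I_3 -> G -> G) (par : G -> bool) (m : 'I_3 -> nat).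
Hypotheses (adjK : forall i, involutive (adj i)) (tg : triangle_group adj par m).
Variable j : 'I_3.
Implicit Types (g h : G) (k l : nat).

Let M := m j.
Let M1 : (1 < M)%N := m_gt1 tg j.

Definition turn_side k : 'I_3 := if odd k then j + 2%:R else j + 1.

(** Crossing the sides [j + 1] and [j + 2] alternately enumerates the triangles around corner [j],
    cyclically with period [2 * m j]. *)
Fixpoint turn k g := if k is k'.+1 then adj (turn_side k') (turn k' g) else g.

Lemma turnD k l g : turn (k + l.*2) g = turn k (turn l.*2 g).
Proof. by elim: k => //= k ->; rewrite /turn_side oddD odd_double addbF. Qed.

Lemma turn_iter l g : turn l.*2 g = iter l (fun h => adj (j + 2%:R) (adj (j + 1) h)) g.
Proof. by elim: l => //= l <-; rewrite /turn_side /= odd_double. Qed.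

Lemma turn_period k g : turn (k + M.*2) g = turn k g.
Proof. by rewrite turnD; congr turn; rewrite turn_iter; apply/(cyc_adj tg). Qed.

Lemma par_turn k g : par (turn k g) = par g (+) odd k.
Proof. by elim: k => [|k IH] /=; rewrite ?addbF // (par_adj tg) IH -addbN. Qed.

Lemma turn_inj k : injective (turn k).
Proof. by elim: k => // k IH g h /= /(can_inj (adjK _))/IH. Qed.

Lemma side_neq k : turn_side k != j.
Proof. by rewrite /turn_side; case: odd; rewrite ?ord3_add1 ?ord3_add2. Qed.

Lemma reach_turn k g : reach adj (corner_pred j) g (turn k g).
Proof. by elim: k => [|k IH] /=; [exact: reach_refl|apply: reach_step => //; exact: side_neq]. Qed.

Lemma turn_adj k g i : i != j -> exists l,
  (turn k g = turn l g /\ adj i (turn k g) = turn l.+1 g /\ i = turn_side l) \/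
  (turn k g = turn l.+1 g /\ adj i (turn k g) = turn l g /\ i = turn_side l).
Proof.
move=> ij.
have sS n : turn_side n.+1 = if odd n then j + 1 else j + 2%:R by rewrite /turn_side /=; case: odd.
have [->|ik] := eqVneq i (turn_side k); first by exists k; left.
have [l [kl il]] : exists l, turn k g = turn l.+1 g /\ i = turn_side l.
  (* The predecessor of [k] in cyclic order; a full turn is added since [k] may be 0. *)
  exists (k + M.*2).-1; rewrite prednK ?turn_period; last first.
    by rewrite addn_gt0 double_gt0 (ltn_trans _ M1) // orbT.
  split=> //; have E : odd (k + M.*2).-1 = ~~ odd k.
    have : (0 < k + M.*2)%N by rewrite addn_gt0 double_gt0 (ltn_trans _ M1) // orbT.
    move=> h; have := oddS (k + M.*2).-1; rewrite prednK // oddD odd_double addbF => ->.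
    by rewrite negbK.
  move: ij ik; rewrite ord3_neq /turn_side E; case: (odd k) => /= /orP[] /eqP -> //; by rewrite eqxx.
by exists l; right; rewrite kl /= il adjK.
Qed.

Lemma reachP_turn g h : reach adj (corner_pred j) g h -> exists2 k, (k < M.*2)%N & h = turn k g.
Proof.
move=> r; suff [k ->] : exists k, h = turn k g.
  exists (k %% M.*2)%N; first by rewrite ltn_mod double_gt0 (ltn_trans _ M1).
  by rewrite (periodic_mod (f := fun k => turn k g)) // => ?; exact: turn_period.
elim: r => [|i _ ij _ [k ->]]; first by exists 0%N.
by have [l [[_ [-> _]]|[_ [-> _]]]] := turn_adj k g ij; [exists l.+1|exists l].
Qed.

Lemma turn_eq k l g : turn k g = turn l g -> k = l %[mod M.*2].
Proof.
wlog kl : k l / (k <= l)%N.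
  by move=> H E; case/orP: (leq_total k l) => kl; [exact: H|apply/esym/H].
move=> E; have o : odd k = odd l.
  by have := congr1 par E; rewrite !par_turn => /addbI.
have lk : l = (k + (l - k)./2.*2)%N.
  by have := odd_double_half (l - k); rewrite oddB // o addbb add0n => ->; rewrite subnKC.
move: E; rewrite lk turnD => /turn_inj/esym; rewrite turn_iter => /(cyc_adj tg) /dvdnP[q ->].
by rewrite doubleMr addnC modnMDl.
Qed.

End Turning.

(** * Charts on the open stars of corners *)

Section StarCharts.
Variables (R : realType) (G : choiceType) (X : topologicalType)
  (adj : 'I_3 -> G -> G) (tri : G -> 'rV[R]_3 -> X) (par : G -> bool) (m : 'I_3 -> nat).
Hypotheses (gl : gluing adj tri) (tg : triangle_group adj par m).
Notation plane := 'rV[R]_2.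
Implicit Types (g h : G) (p q : 'rV[R]_3) (i j : 'I_3) (k l : nat).

Let adjK := gluing_adjK gl.

Section Chart.
Variables (j : 'I_3) (g : G).
Let M := m j.
Let M1 : (1 < M)%N := m_gt1 tg j.
Let sd := turn_side j.
Let co k : 'I_3 := if odd k then j + 1 else j + 2%:R.

Lemma side_S k : turn_side j k.+1 = co k.
Proof. by rewrite /co /turn_side /=; case: (odd k). Qed.

(** Division by the coordinate of corner [j] spreads the open star over the whole plane, with
    triangle [k] filling sector [k]. The coordinate that vanishes on the side towards triangle
    [k + 1] is the weight of ray [k], so that this side lands on ray [k + 1], common to both
    sectors. *)
Definition sect_pt k p : plane := sect M k (p ord0 (sd k) / p ord0 j) (p ord0 (co k) / p ord0 j).

Definition star_map h p : plane :=
  if `[< reach adj (corner_pred j) g h /\ 0 < p ord0 j >]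
  then sect_pt (xget 0%N [set k | turn adj j k g = h]) p else 0.

Lemma sect_pt_mod k l p : k = l %[mod M.*2] -> sect_pt k p = sect_pt l p.
Proof.
have H k' : sect_pt (k' %% M.*2)%N p = sect_pt k' p.
  apply: (periodic_mod (f := fun k => sect_pt k p)) => l'.
  by rewrite /sect_pt /sect -addSn !rayD2 // /sd /turn_side /co oddD odd_double addbF.
by move=> E; rewrite -H E H.
Qed.

Lemma star_mapE k p : 0 < p ord0 j -> star_map (turn adj j k g) p = sect_pt k p.
Proof.
move=> pj; rewrite /star_map asboolT; last by split=> //; exact: reach_turn.
apply: sect_pt_mod; apply: (turn_eq adjK tg (g := g)).
by apply: (@xgetI _ 0%N [set l | turn adj j l g = turn adj j k g] k).
Qed.

Lemma sect_ptS k p : p ord0 (sd k) = 0 -> sect_pt k.+1 p = sect_pt k p.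
Proof.
move=> p0; rewrite /sect_pt /sd side_S p0 mul0r /sect scale0r add0r.
have -> : co k.+1 = sd k by rewrite /co /sd /turn_side /=; case: (odd k).
by rewrite p0 mul0r scale0r addr0.
Qed.

Lemma star_map_adj h p i : simplex 3 p -> p ord0 i = 0 -> star_map (adj i h) p = star_map h p.
Proof.
move=> sp pi0; have [pj|pj] := ltP 0 (p ord0 j); last first.
  by rewrite /star_map !asboolF // => -[_]; rewrite ltNge pj.
have ij : i != j by apply: contraTneq pj => <-; rewrite pi0 ltxx.
have [r|nr] := pselect (reach adj (corner_pred j) g h); last first.
  rewrite /star_map !asboolF // => -[r' _]; apply: nr => //.
  by rewrite -(adjK i h); exact: reach_step.
have [k _ ->] := reachP_turn adjK tg r.
have [l [[-> [-> E]]|[-> [-> E]]]] := turn_adj adjK tg k g ij.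
  by rewrite !star_mapE // sect_ptS // /sd -E.
by rewrite !star_mapE // sect_ptS // /sd -E.
Qed.

Definition chart_to : X -> plane := descend gl star_map.

Lemma chart_toE k p : simplex 3 p -> 0 < p ord0 j ->
  chart_to (tri (turn adj j k g) p) = sect_pt k p.
Proof.
by move=> sp pj; rewrite /chart_to descendE ?star_mapE //; exact: star_map_adj.
Qed.

Definition bary k (v : plane) : 'rV[R]_3 :=
  let x := `|coord0 M k v| in let y := `|coord1 M k v| in let s := 1 + x + y in
  row3 j (1 / s) ((if odd k then y else x) / s) ((if odd k then x else y) / s).

Lemma bary_gt0 k (v : plane) : 0 < 1 + `|coord0 M k v| + `|coord1 M k v|.
Proof. by rewrite -addrA ltr_pwDl // addr_ge0. Qed.

Lemma baryE k v : let s := 1 + `|coord0 M k v| + `|coord1 M k v| in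
  [/\ (bary k v) ord0 j = 1 / s, (bary k v) ord0 (sd k) = `|coord0 M k v| / s &
      (bary k v) ord0 (co k) = `|coord1 M k v| / s].
Proof. by rewrite /bary /sd /turn_side /co; case: (odd k); rewrite !row3E. Qed.

Lemma bary_simplex k v : simplex 3 (bary k v).
Proof.
have s0 := bary_gt0 k v.
apply: simplex_row3; rewrite ?divr_ge0 ?(ltW s0) //; try by case: (odd k).
by case: (odd k); rewrite -!mulrDl 1?[X in X / _](_ : _ = 1 + `|coord0 M k v| + `|coord1 M k v|) ?divff ?gt_eqF //; ring.
Qed.

Lemma bary_pos k v : 0 < (bary k v) ord0 j.
Proof. by have [-> _ _] := baryE k v; rewrite divr_gt0 // bary_gt0. Qed.

Lemma sect_bary k v : 0 <= coord0 M k v -> 0 <= coord1 M k v -> sect_pt k (bary k v) = v.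
Proof.
move=> c0 c1; have s0 := bary_gt0 k v; rewrite /sect_pt; have [-> -> ->] := baryE k v.
have E (x s : R) : 0 < s -> x / s / (1 / s) = x by move=> sp; field; rewrite gt_eqF.
by rewrite !E // !ger0_norm // sect_coord.
Qed.

Lemma bary_sect k p : simplex 3 p -> 0 < p ord0 j -> bary k (sect_pt k p) = p.
Proof.
move=> sp pj; rewrite /bary /sect_pt !coord0E // !coord1E // !ger0_norm ?divr_ge0 ?(ltW pj) ?simplex_ge0 //.
have E : p ord0 (sd k) + p ord0 (co k) = p ord0 (j + 1) + p ord0 (j + 2%:R).
  by rewrite /sd /turn_side /co; case: (odd k) => //; rewrite addrC.
set s := 1 + _ + _; have -> : s = 1 / p ord0 j.
  by rewrite -(simplex3_sum j sp) -addrA -E /s; field; rewrite gt_eqF.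
by apply: (@row3P _ j); rewrite ?row3E /sd /turn_side /co; case: (odd k); field; rewrite gt_eqF.
Qed.

Lemma cvg_bary k : continuous (bary k).
Proof.
have cs (v : plane) : {for v, continuous (fun v => 1 + `|coord0 M k v| + `|coord1 M k v|)}.
  by apply: contD; [apply: contD; [exact: cont_cst|]|]; apply: cont_norm; [exact: continuous_coord0|exact: continuous_coord1].
have ci (v : plane) : {for v, continuous (fun v => (1 + `|coord0 M k v| + `|coord1 M k v|)^-1)}.
  by apply: contV; [rewrite gt_eqF // bary_gt0|exact: cs].
apply: continuous_rV => i v.
pose f (v : plane) := if i == j then 1 / (1 + `|coord0 M k v| + `|coord1 M k v|)
  else if i == j + 1 then (if odd k then `|coord1 M k v| else `|coord0 M k v|) / (1 + `|coord0 M k v| + `|coord1 M k v|)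
  else (if odd k then `|coord0 M k v| else `|coord1 M k v|) / (1 + `|coord0 M k v| + `|coord1 M k v|).
suff : {for v, continuous f}.
  by rewrite (_ : f = fun v => bary k v ord0 i) //; apply/funext => w; rewrite mxE.
have d (c : bool) : {for v, continuous (fun v : plane => (if c then `|coord1 M k v| else `|coord0 M k v|) / (1 + `|coord0 M k v| + `|coord1 M k v|))}.
  apply: contM; last exact: ci.
  by case: c; apply: cont_norm; [exact: continuous_coord1|exact: continuous_coord0].
rewrite /f; case: (i == j).
  suff : {for v, continuous (fun v : plane => 1 / (1 + `|coord0 M k v| + `|coord1 M k v|))} by [].
  by apply: contM; [exact: cont_cst|exact: ci].
by case: (i == j + 1); case: (odd k); first [exact: (d true)|exact: (d false)].
Qed.

Definition chart_from (v : plane) : X :=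
  let k := sector M v in tri (turn adj j k g) (bary k v).

Lemma chart_fromK k p : simplex 3 p -> 0 < p ord0 j ->
  chart_from (sect_pt k p) = tri (turn adj j k g) p.
Proof.
have pos l q : simplex 3 q -> 0 < q ord0 j -> 0 < q ord0 (sd l) ->
    chart_from (sect_pt l q) = tri (turn adj j l g) q.
  move=> sq qj ql.
  have H l' : (l' < M.*2)%N -> 0 < q ord0 (sd l') -> chart_from (sect_pt l' q) = tri (turn adj j l' g) q.
    move=> l'M ql'; rewrite /chart_from /sect_pt sector_sect ?divr_gt0 ?divr_ge0 ?simplex_ge0 ?ltW //.
    by rewrite -/(sect_pt l' q) bary_sect.
  have E : l %% M.*2 = l %[mod M.*2] by rewrite modn_mod.
  rewrite -(sect_pt_mod q E) H ?ltn_mod ?double_gt0 ?(ltn_trans _ M1) //.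
    congr (tri _ q); apply: (periodic_mod (f := fun l => turn adj j l g)) => ?.
    exact: (turn_period tg).
  have -> // : sd (l %% M.*2)%N = sd l.
  rewrite /sd /turn_side [in RHS](divn_eq l M.*2) oddD oddM odd_double andbF //.
(* Sectors contain their first ray only. A point on the second ray is therefore moved to triangle
   [k + 1]; if both coordinates vanish the point is the corner itself, which lies in all triangles
   of the star. *)
move=> sp pj; have := simplex_ge0 (sd k) sp; rewrite le_eqVlt => /orP[/eqP/esym p0|]; last exact: pos.
have := simplex_ge0 (co k) sp; rewrite le_eqVlt => /orP[/eqP/esym p1|p1]; last first.
  rewrite -sect_ptS // pos ?side_S //; first by rewrite /= tri_adj.
  by rewrite /sd side_S.
have zero l : sect_pt l p = 0.
  rewrite /sect_pt /sect.
  have -> : p ord0 (sd l) = 0 by move: p0 p1; rewrite /sd /co /turn_side; case: (odd k); case: (odd l).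
  have -> : p ord0 (co l) = 0 by move: p0 p1; rewrite /sd /co /turn_side; case: (odd k); case: (odd l).
  by rewrite !mul0r !scale0r addr0.
have b0 : bary (sector M (0 : plane)) 0 = p by rewrite -[RHS](@bary_sect (sector M (0 : plane)) p) // zero.
rewrite zero /chart_from b0.
have r : reach adj (fun i => p ord0 i == 0) (turn adj j (sector M (0 : plane)) g) (turn adj j k g).
  apply: (@reach_sub _ _ (corner_pred j)) => [i ij|]; last first.
    by apply: reach_trans (reach_turn adj j k g); apply: (reach_sym adjK); exact: reach_turn.
  apply/eqP; move: ij p0 p1; rewrite /corner_pred ord3_neq /sd /co /turn_side.
  by case: (odd k) => /= /orP[] /eqP ->.
exact: (tri_reach gl sp r).
Qed.

Lemma chart_from_star v : star adj tri j g (chart_from v).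
Proof.
rewrite (starP gl); last exact: bary_simplex.
split; [exact: reach_turn|exact: bary_pos].
Qed.

Lemma chart_toK x : star adj tri j g x -> chart_from (chart_to x) = x.
Proof.
have [h [p [sp <-]]] := gluing_surj gl x; rewrite (starP gl) // => -[r pj].
have [k _ ->] := reachP_turn adjK tg r.
by rewrite chart_toE // chart_fromK.
Qed.

Lemma chart_from_sector k v : 0 <= coord0 M k v -> 0 <= coord1 M k v ->
  chart_from v = tri (turn adj j k g) (bary k v).
Proof.
move=> c0 c1; rewrite -{1}(sect_bary c0 c1) chart_fromK //; first exact: bary_simplex.
exact: bary_pos.
Qed.

Lemma chart_to_from v : chart_to (chart_from v) = v.
Proof.
have [k _ [c0 c1]] := sector_cover M1 v.
rewrite (chart_from_sector c0 c1) chart_toE; [exact: sect_bary|exact: bary_simplex|exact: bary_pos].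
Qed.

Lemma chart_to_continuous : {in star adj tri j g, continuous chart_to}.
Proof.
apply: (continuous_at_tri gl); first exact: (star_open gl).
move=> h p sp; rewrite (starP gl) // => -[r pj] V.
have [k _ ->] := reachP_turn adjK tg r; rewrite chart_toE // => fV.
have c : {for p, continuous (sect_pt k)}.
  have pj0 : p ord0 j != 0 by rewrite gt_eqF.
  have d i : {for p, continuous (fun q : 'rV[R]_3 => q ord0 i / q ord0 j)}.
    by apply: contM; [|apply: contV => //]; exact: coord_continuous.
  by apply: continuousD; exact: continuousZr_tmp.
have pj' := near_coord_gt0 pj; have cV := c _ fV.
near=> q => sq; rewrite chart_toE //; last by near: q.
by near: q; exact: cV.
Unshelve. all: by end_near.
Qed.

Lemma chart_from_continuous : continuous chart_from.
Proof.
move=> v V fV.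
have H (k : 'I_(M.*2)) : \forall w \near v, 0 <= coord0 M k w -> 0 <= coord1 M k w -> V (chart_from w).
  have cc (c : plane -> R) : {for v, continuous c} -> ~ 0 <= c v -> \forall w \near v, ~ 0 <= c w.
    move=> cv /negP; rewrite -ltNge => c0.
    have : nbhs (c v) [set x | x < 0] by apply: open_nbhs_nbhs; split=> //; exact: open_lt.
    move=> h; have {}h : \forall w \near v, c w < 0 := cv _ h.
    by apply: filterS h => w hw; apply/negP; rewrite -ltNge.
  have [c0|c0] := pselect (0 <= coord0 M k v); last first.
    apply: filterS (cc _ _ c0) => [w n0 /n0 //|].
    exact: continuous_coord0.
  have [c1|c1] := pselect (0 <= coord1 M k v); last first.
    apply: filterS (cc _ _ c1) => [w n1 _ /n1 //|].
    exact: continuous_coord1.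
  have : {for v, continuous (fun w => tri (turn adj j k g) (bary k w))}.
    move=> U; rewrite -(chart_from_sector c0 c1) => /nbhs_interior fU.
    have h : \forall q \near bary k v, simplex 3 q -> U° (tri (turn adj j k g) q).
      apply: (tri_near gl (open_interior _) (bary_simplex k v)).
      by rewrite -chart_from_sector //; exact: nbhs_singleton fU.
    have {}h : \forall w \near v, simplex 3 (bary k w) -> U° (tri (turn adj j k g) (bary k w)) := @cvg_bary k v _ h.
    by apply: filterS h => w Hw; exact: nbhs_singleton (Hw (bary_simplex k w)).
  move=> /(_ V); rewrite -(chart_from_sector c0 c1) => /(_ fV).
  move=> {}fV; have h : \forall w \near v, V (tri (turn adj j k g) (bary k w)) := fV.
  by apply: filterS h => w Vw d0 d1; rewrite (chart_from_sector d0 d1).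
apply: filterS (filter_forall _ H) => w Hw.
have [k kM [d0 d1]] := sector_cover M1 w; exact: (Hw (Ordinal kM)).
Qed.

Definition star_chart : chart R X := Chart (star adj tri j g) chart_to chart_from.

Lemma star_chart_image : chart_to @` star adj tri j g = setT.
Proof.
apply/seteqP; split=> // v _; exists (chart_from v); first exact: chart_from_star.
exact: chart_to_from.
Qed.

Lemma is_chart_star : is_chart star_chart.
Proof.
split=> /=; rewrite ?star_chart_image.
- exact: (star_open gl).
- exact: openT.
- by apply: continuous_in_subspaceT; exact: chart_to_continuous.
- by apply: continuous_subspaceT; exact: chart_from_continuous.
- exact: chart_toK.
Qed.

(* In a triangle of the star the chart is projective in the barycentric
   coordinates, and the orientation is read off from the parity. *)
Lemma chart_affine h : reach adj (corner_pred j) g h ->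
  exists E1 E2 : plane, 0 < (if par g (+) par h then -1 else 1) * det2 E1 E2 /\
   forall q, simplex 3 q -> 0 < q ord0 j -> chart_to (tri h q) =
     (q ord0 (j + 1) / q ord0 j) *: E1 + (q ord0 (j + 2%:R) / q ord0 j) *: E2.
Proof.
move=> r; have [k _ ->] := reachP_turn adjK tg r.
have D := det_ray R M1 k.
case: (boolP (odd k)) => ok.
  exists (ray R M k.+1), (ray R M k); split.
    rewrite (par_turn tg) ok addbA addbb; move: D; rewrite /det2 /=; lra.
  by move=> q sq qj; rewrite chart_toE // /sect_pt /sect /sd /co /turn_side ok addrC.
exists (ray R M k), (ray R M k.+1); split.
  by rewrite (par_turn tg) (negbTE ok) addbF addbb mul1r.
by move=> q sq qj; rewrite chart_toE // /sect_pt /sect /sd /co /turn_side (negbTE ok).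
Qed.

End Chart.

End StarCharts.

(** The change between charts at two corners of a triangle is projective. It sends the lines
    parallel to [E1] (constant [y]) to lines through the origin, traversed towards the origin. Hence
    [E1] in the source and minus the image point in the target are corresponding reference
    directions, and the sign of the determinants decides on which side of them points fall. *)
Lemma projective_same_side (R : realType) (E1 El Fj Fl : 'rV[R]_2) (x y x' y' : R) :
  det2 E1 El * det2 Fj Fl < 0 -> 0 < x -> 0 < x' ->
  x *: E1 + y *: El != x' *: E1 + y' *: El ->
  same_side E1 ((x' *: E1 + y' *: El) - (x *: E1 + y *: El))
    (- (x^-1 *: Fj + (y / x) *: Fl))
    ((x'^-1 *: Fj + (y' / x') *: Fl) - (x^-1 *: Fj + (y / x) *: Fl)).
Proof.
move=> D0 x0 x'0 ne; have xn : x != 0 by rewrite gt_eqF.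
have x'n : x' != 0 by rewrite gt_eqF.
have [yy|yy] := eqVneq y' y; last first.
  left; set u := det2 E1 _; set v := det2 (- _) _.
  have -> : u * v = ((y' - y) ^+ 2 / (x * x')) * (- (det2 E1 El * det2 Fj Fl)).
    by rewrite /u /v /det2 !vecE; field; rewrite xn x'n.
  apply: mulr_gt0; [apply: divr_gt0; [|exact: mulr_gt0]|by rewrite oppr_gt0].
  by rewrite lt_neqAle sqr_ge0 eq_sym sqrf_eq0 subr_eq0 yy.
subst y'; right.
have xx : x' != x by apply: contra_neq ne => ->.
pose w := Fj + y *: Fl.
have nz (u v : 'rV[R]_2) : det2 u v != 0 -> 0 < dot2 u u.
  move=> h; rewrite lt_neqAle eq_sym addr_ge0 -?expr2 ?sqr_ge0 // andbT.
  apply: contra_neq h; rewrite /dot2 -!expr2 => /eqP; rewrite paddr_eq0 ?sqr_ge0 // !sqrf_eq0.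
  by rewrite /det2 => /andP[/eqP -> /eqP ->]; rewrite !mul0r subr0.
have /norP[e0 f0] : ~~ ((det2 E1 El == 0) || (det2 Fj Fl == 0)).
  by rewrite -mulf_eq0 lt_eqF.
split.
- by rewrite /det2 !vecE; ring.
- by rewrite /det2 !vecE; field; rewrite xn x'n.
set u := dot2 E1 _; set v := dot2 (- _) _.
have -> : u * v = ((x' - x) ^+ 2 / (x ^+ 2 * x')) * (dot2 E1 E1 * dot2 w w).
  by rewrite /u /v /w /dot2 !vecE; field; rewrite xn x'n.
have w0 : 0 < dot2 w w.
  by apply: (nz _ Fl); rewrite (_ : det2 w Fl = det2 Fj Fl) // /w /det2 !vecE; ring.
apply: mulr_gt0; [apply: divr_gt0|exact: mulr_gt0 (nz _ _ e0) w0]; last by apply: mulr_gt0 => //; rewrite exprn_gt0.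
by rewrite lt_neqAle sqr_ge0 eq_sym sqrf_eq0 subr_eq0 xx.
Qed.

(** * Surface axioms and the end of a glued space *)

Section Surface.
Variables (R : realType) (G : choiceType) (X : topologicalType)
  (adj : 'I_3 -> G -> G) (tri : G -> 'rV[R]_3 -> X) (par : G -> bool) (m : 'I_3 -> nat).
Hypotheses (gl : gluing adj tri) (tg : triangle_group adj par m).
Notation plane := 'rV[R]_2.
Implicit Types (g h : G) (p q : 'rV[R]_3) (i j : 'I_3).

Let adjK := gluing_adjK gl.
Let st := star adj tri.

Lemma star_disjoint j g g' x : st j g x -> st j g' x -> reach adj (corner_pred j) g g'.
Proof.
have [h [p [sp <-]]] := gluing_surj gl x; rewrite /st !(starP gl) // => -[r _] [r' _].
by apply: reach_trans r _; exact: (reach_sym adjK r').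
Qed.

(** The functions [hat] separate two points unless both have the same values for all of them; then
    the points lie in a common star and its chart separates them. *)
Lemma hausdorff_gluing : hausdorff_space X.
Proof.
rewrite open_hausdorff => x y xy.
have sep (Y : topologicalType) (f : X -> Y) (D : set X) : hausdorff_space Y -> open D ->
    {in D, continuous f} -> D x -> D y -> f x != f y ->
    exists2 AB, (x \in AB.1 /\ y \in AB.2) & [/\ open AB.1, open AB.2 & AB.1 `&` AB.2 == set0].
  rewrite open_hausdorff => hY oD /(continuous_inP _ oD) cf Dx Dy /hY[[A B] /= [fA fB] [oA oB AB]].
  exists (D `&` f @^-1` A, D `&` f @^-1` B) => /=.
    by move: fA fB; rewrite !inE.
  split; [exact: cf|exact: cf|]; apply/eqP/seteqP; split=> // z [[_ zA] [_ zB]].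
  by have : (A `&` B) (f z); [split|rewrite (eqP AB)].
have hP : hausdorff_space plane by exact: norm_hausdorff.
have [[[j g] hn]|] := pselect (exists jg : 'I_3 * G, hat gl jg.1 jg.2 x != hat gl jg.1 jg.2 y).
  apply: (sep R (hat gl j g) setT) => //; first [exact: openT|exact: (@Rhausdorff R)|by move=> z _; exact: hat_continuous].
move=> /forallNP H; have [j [g sx]] := star_cover gl x.
have sy : st j g y.
  apply/(hat_gt0 gl); have /negP := H (j, g); rewrite negbK => /eqP <-.
  exact/(hat_gt0 gl).
have ne : chart_to m gl j g x != chart_to m gl j g y.
  by apply: contra_neq xy => E; rewrite -(chart_toK gl tg sx) E (chart_toK gl tg sy).
exact: (sep _ _ _ hP (star_open gl j g) (@chart_to_continuous _ _ _ _ _ _ _ gl tg j g) sx sy ne).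
Qed.

Lemma nbhs_rat_box (v : plane) (V : set plane) : nbhs v V ->
  exists q : (rat * rat) * (rat * rat),
    let box := [set w : plane | (ratr q.1.1 < w ord0 i0 < ratr q.1.2) /\
                        (ratr q.2.1 < w ord0 i1 < ratr q.2.2)] in box v /\ box `<=` V.
Proof.
move=> [P vP PV].
have H (i : 'I_2) : exists q : rat * rat, ratr q.1 < v ord0 i < ratr q.2 /\
    forall x, ratr q.1 < x < ratr q.2 -> P ord0 i x.
  have /nbhs_ballP[e /= e0 eP] := vP ord0 i.
  have [a] := @rat_in_itvoo R (v ord0 i - e) (v ord0 i) ltac:(lra).
  have [b] := @rat_in_itvoo R (v ord0 i) (v ord0 i + e) ltac:(lra).
  rewrite !in_itv /= => /andP[b1 b2] /andP[a1 a2].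
  exists (a, b) => /=; split; first by rewrite a2 b1.
  move=> x /andP[ax xb]; apply: eP; rewrite -ball_normE /= ltr_norml; apply/andP; split; lra.
have [q0 [v0 P0]] := H i0; have [q1 [v1 P1]] := H i1.
exists (q0, q1) => /=; split; first by split.
move=> w [w0 w1]; apply: PV => a b; rewrite (ord1 a).
case: b => -[|[|//]] lt2.
  have -> : Ordinal lt2 = i0 by exact: val_inj.
  exact: P0.
have -> : Ordinal lt2 = i1 by exact: val_inj.
exact: P1.
Qed.

Lemma second_countable_gluing : countable [set: G] -> @second_countable X.
Proof.
move=> cG.
pose box (q : (rat * rat) * (rat * rat)) : set plane := [set w : plane | (ratr q.1.1 < w ord0 i0 < ratr q.1.2) /\
                        (ratr q.2.1 < w ord0 i1 < ratr q.2.2)].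
pose U g (jq : 'I_3 * ((rat * rat) * (rat * rat))) := st jq.1 g `&` chart_to m gl jq.1 g @^-1` box jq.2.
have obox c : open (box c).
  rewrite openE => w [/andP[a1 a2] /andP[b1 b2]].
  have h (i : 'I_2) := @coord_continuous R 1 2 ord0 i w.
  have A1 := near_gt (h i0) a1; have A2 := near_lt (h i0) a2.
  have B1 := near_gt (h i1) b1; have B2 := near_lt (h i1) b2.
  apply: filterS (filterI (filterI A1 A2) (filterI B1 B2)) => z [[/= z1 z2] [z3 z4]].
  by split; apply/andP.
exists (\bigcup_g range (U g)).
  by apply: bigcup_countable => // g _; exact: sub_countable (card_image_le _ _) _.
split.
  move=> _ [g _ [[j q] _ <-]].
  have := @chart_to_continuous _ _ _ _ _ _ _ gl tg j g.
  by move=> /(continuous_inP _ (star_open gl j g)); apply; exact: obox.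
move=> x V; have [j [g sx]] := star_cover gl x => xV.
have [] := @nbhs_rat_box (chart_to m gl j g x) (chart_from adj tri m j g @^-1` V).
  by apply: (chart_from_continuous gl tg); rewrite (chart_toK gl tg sx).
move=> q [qx qV]; exists (U g (j, q)).
  by split; [exists g => //; exists (j, q)|split].
by move=> y [/= sy /qV /=]; rewrite (chart_toK gl tg sy).
Qed.

(** Selects one positively oriented base triangle per corner. Base triangles of opposite parity
    would give mirror-image charts, and with a single base triangle two different charts of the same
    kind have disjoint domains, so that only corners of different kinds need comparison. *)
Definition canon j g := par g /\
  xget g [set h | par h /\ reach adj (corner_pred j) g h] = g.

Lemma canon_uniq j g g' : canon j g -> canon j g' -> reach adj (corner_pred j) g g' -> g = g'.
Proof.
move=> [pg E] [pg' E'] r; rewrite -[LHS]E -[RHS]E'.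
have -> : [set h | par h /\ reach adj (corner_pred j) g h] =
    [set h | par h /\ reach adj (corner_pred j) g' h].
  apply/seteqP; split=> h [ph rh]; (split=> //).
    exact: reach_trans (reach_sym adjK r) rh.
  exact: reach_trans r rh.
rewrite /xget; case: pselect => // -[]; exists g'; apply/asboolP; split=> //; exact: reach_refl.
Qed.

Lemma canon_cover x : exists j g, canon j g /\ st j g x.
Proof.
have [j [g sx]] := star_cover gl x.
have [g1 [p1 r1]] : exists g1, par g1 /\ reach adj (corner_pred j) g g1.
  case: (boolP (par g)) => pg; first by exists g; split=> //; exact: reach_refl.
  exists (adj (j + 1) g); rewrite (par_adj tg) pg; split=> //.
  by apply: reach1; rewrite /corner_pred ord3_add1.
set S := [set h | par h /\ reach adj (corner_pred j) g h].
have [p2 r2] : S (xget g S) by apply: xgetI; split; [exact: p1|exact: r1].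
exists j, (xget g S); split.
  split=> //; rewrite (_ : mkset _ = S).
    rewrite /xget; case: pselect => // -[]; exists g1; apply/asboolP; split=> //.
  apply/seteqP; split=> h [ph rh]; (split=> //); first exact: reach_trans r2 rh.
  exact: reach_trans (reach_sym adjK r2) rh.
have [h [p [sp E]]] := gluing_surj gl x; move: sx; rewrite /st -E !(starP gl) // => -[rh ->].
by split=> //; apply: reach_trans rh; exact: reach_sym.
Qed.

Definition star_atlas : set (chart R X) :=
  [set c | exists j g, canon j g /\ c = star_chart m gl j g].

Lemma star_atlasP : is_atlas star_atlas.
Proof.
split=> [_ [j [g [_ ->]]]|]; first exact: (is_chart_star gl tg).
apply/seteqP; split=> // x _; have [j [g [cg sx]]] := canon_cover x.
by exists (star_chart m gl j g) => //; exists j, g.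
Qed.

Lemma star_chart_overlap j g j' g' x : par g -> par g' -> j != j' -> st j g x -> st j' g' x ->
  exists d1 d2 : plane, \forall w \near (0 : plane), w != 0 ->
    same_side d1 w d2 (chart_to m gl j' g' (chart_from adj tri m j g (chart_to m gl j g x + w)) - chart_to m gl j' g' x).
Proof.
have [h [p [sp <-]]] := gluing_surj gl x.
rewrite /st !(starP gl) // => pg pg' jj' [r pj] [r' pj'].
set a := chart_to m gl j g (tri h p).
have [l [lj lj' lP]] : exists l, [/\ l != j, l != j' & forall i, i != j -> i != j' -> i = l].
  have := jj'; rewrite eq_sym ord3_neq => /orP[] /eqP ->.
    exists (j + 2%:R); rewrite ord3_add2 eq_sym ord3_add12; split=> // i; rewrite ord3_neq.
    by move=> /orP[] /eqP ->; rewrite ?eqxx.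
  exists (j + 1); rewrite ord3_add1 ord3_add12; split=> // i; rewrite ord3_neq.
  by move=> /orP[] /eqP ->; rewrite ?eqxx.
(* The midpoint of the segment joining the two corners. Its image in the first chart is the vector
   [E1] of every triangle containing this segment, so the reference direction does not depend on the
   triangle in which a nearby point lies. *)
pose e : 'rV[R]_3 := \row_i (if i == l then 0 else 2^-1).
have se : simplex 3 e.
  split=> [i|]; first by rewrite mxE; case: ifP => // _; rewrite invr_ge0 ler0n.
  rewrite (sum3 _ l) !mxE eqxx ord3_add1 ord3_add2 add0r; lra.
have ej : e ord0 j = 2^-1 by rewrite mxE eq_sym (negbTE lj).
have ej' : e ord0 j' = 2^-1 by rewrite mxE eq_sym (negbTE lj').
have el : e ord0 l = 0 by rewrite mxE eqxx.
exists (chart_to m gl j g (tri h e)), (- chart_to m gl j' g' (tri h p)).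
(* Points near the given one lie in triangles that also contain it; each comparison thus takes place
   inside a single triangle [h2]. *)
pose P := fun i => p ord0 i == 0.
have oU := ostar_open gl P h openT.
have Ux : ostar adj tri P h setT (tri h p).
  rewrite (ostarP gl) //; split=> //; first exact: reach_refl.
  by move=> k Pk; rewrite lt_neqAle eq_sym Pk simplex_ge0.
have aE : chart_from adj tri m j g a = tri h p by rewrite (chart_toK gl tg) // (starP gl).
have nU : \forall v \near a, ostar adj tri P h setT (chart_from adj tri m j g v).
  apply: (chart_from_continuous gl tg); rewrite aE; exact: open_nbhs_nbhs.
have nU' : \forall w \near (0 : plane), ostar adj tri P h setT (chart_from adj tri m j g (a + w)).
  have c := @continuous_addl R a 0; rewrite /continuous_at addr0 in c.
  exact: (c _ nU).
apply: filterS nU' => w [h2 [q [r2 sq _ q0 qE]]] w0.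
have hp : tri h p = tri h2 p by exact: (tri_reach gl sp).
have he : tri h e = tri h2 e.
  apply: (tri_reach gl se); apply: reach_sub r2 => i /eqP pi0.
  rewrite (lP i) ?el ?eqxx //; first by apply: contraTneq pj => <-; rewrite pi0 ltxx.
  by apply: contraTneq pj' => <-; rewrite pi0 ltxx.
have sub k (rk : p ord0 k != 0) : reach adj (corner_pred k) h h2.
  by apply: reach_sub r2 => i /eqP pi0; apply: contraNneq rk => <-; rewrite pi0.
have rj : reach adj (corner_pred j) g h2 by apply: reach_trans r (sub _ _); rewrite gt_eqF.
have rj' : reach adj (corner_pred j') g' h2 by apply: reach_trans r' (sub _ _); rewrite gt_eqF.
have qj : 0 < q ord0 j by apply: q0; rewrite /P gt_eqF.
have qj' : 0 < q ord0 j' by apply: q0; rewrite /P gt_eqF.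
have aw : a + w = chart_to m gl j g (tri h2 q) by rewrite qE (chart_to_from gl tg).
have -> : w = chart_to m gl j g (tri h2 q) - a by rewrite -aw addrC addKr.
have ne : a != chart_to m gl j g (tri h2 q).
  by rewrite -aw eq_sym -subr_eq0 addrC addKr.
rewrite -/a [a + _]addrC subrK (chart_toK gl tg); last by rewrite (starP gl).
rewrite /a hp he in ne *.
have [E1 [E2 [detE affE]]] := chart_affine gl tg rj.
have [F1 [F2 [detF affF]]] := chart_affine gl tg rj'.
rewrite pg pg' /= in detE detF; set s : R := if _ then _ else _ in detE detF.
have detEF : 0 < det2 E1 E2 * det2 F1 F2.
  have : 0 < (s * det2 E1 E2) * (s * det2 F1 F2) by rewrite mulr_gt0.
  by rewrite mulrACA /s; case: ifP; rewrite ?mulrNN mulr1 mul1r.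
have lin (u v : plane) (c : R) : (c / c) *: u + (0 / c) *: v = (c / c) *: u by rewrite mul0r scale0r addr0.
have xE (z : 'rV[R]_3) : (z ord0 j' / z ord0 j)^-1 = z ord0 j / z ord0 j' by rewrite invf_div.
have yE (z : 'rV[R]_3) : 0 < z ord0 j -> 0 < z ord0 j' ->
    (z ord0 l / z ord0 j) / (z ord0 j' / z ord0 j) = z ord0 l / z ord0 j'.
  by move=> z1 z2; field; rewrite !gt_eqF.
have ejn : 2^-1 != 0 :> R by rewrite invr_eq0 pnatr_eq0.
have epos : 0 < 2^-1 :> R by rewrite invr_gt0 ltr0n.
have := jj'; rewrite eq_sym ord3_neq => /orP[] /eqP jE.
  have lE : l = j + 2%:R by apply/esym/lP; rewrite ?ord3_add2 // jE eq_sym ord3_add12.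
  have jE2 : j = j' + 2%:R by rewrite jE ord3_12.
  have lE2 : l = j' + 1 by rewrite jE ord3_11.
  rewrite !affE // ?ej // !affF // -jE -lE -jE2 -lE2 ej' el divff // mul0r scale0r addr0 scale1r in ne *.
  rewrite ![_ *: F1 + _]addrC -(xE p) -(xE q) -(yE p) // -(yE q) //.
  apply: projective_same_side; rewrite ?divr_gt0 //.
  have -> : det2 F2 F1 = - det2 F1 F2 by rewrite /det2; ring.
  by rewrite mulrN oppr_lt0.
have lE : l = j + 1 by apply/esym/lP; rewrite ?ord3_add1 // jE ord3_add12.
have jE2 : j = j' + 1 by rewrite jE ord3_21.
have lE2 : l = j' + 2%:R by rewrite jE ord3_22.
rewrite !affE // ?ej // !affF // -jE -lE -jE2 -lE2 ej' el divff // mul0r scale0r add0r scale1r in ne *.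
rewrite ![_ *: E1 + _]addrC -(xE p) -(xE q) -(yE p) // -(yE q) // in ne *.
apply: projective_same_side; rewrite ?divr_gt0 //.
have -> : det2 E2 E1 = - det2 E1 E2 by rewrite /det2; ring.
by rewrite mulNr oppr_lt0.
Qed.

Lemma star_atlas_oriented : oriented_atlas star_atlas.
Proof.
split=> [|_ _ [j [g [cg ->]]] [j' [g' [cg' ->]]] /=]; first exact: star_atlasP.
have UE : chart_to m gl j g @` (st j g `&` st j' g') = chart_from adj tri m j g @^-1` st j' g'.
  apply/seteqP; split=> [_ [x [sx sx'] <-]|v /= sv]; first by rewrite /= (chart_toK gl tg sx).
  exists (chart_from adj tri m j g v); last exact: (chart_to_from gl tg).
  by split=> //; exact: (chart_from_star m gl).
have fc : continuous (chart_from adj tri m j g) by exact: (chart_from_continuous gl tg).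
rewrite UE; apply: same_side_orientation.
- by apply: open_comp => [v _|]; [exact: fc|exact: (star_open gl)].
- move=> v; rewrite inE /= => sv; apply: continuous_comp; first exact: fc.
  exact: (@chart_to_continuous _ _ _ _ _ _ _ gl tg j' g' _ (mem_set sv)).
move=> v /= sv; have [E|jj'] := eqVneq j j'; last first.
  have := star_chart_overlap cg.1 cg'.1 jj' (chart_from_star m gl j g v) sv.
  by rewrite (chart_to_from gl tg).
subst j'; have gg : g = g'.
  by apply: (canon_uniq cg cg'); exact: star_disjoint (chart_from_star m gl j g v) sv.
subst g'; exists (row2 1 0), (row2 1 0); near=> w => w0.
rewrite /= !(chart_to_from gl tg) addrC addKr /same_side /det2 /dot2 !row2E !mul1r !mul0r subr0 addr0.
have [w1|w1] := eqVneq (w ord0 i1) 0; last first.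
  by left; rewrite -expr2 lt_neqAle eq_sym sqrf_eq0 w1 sqr_ge0.
right; split=> //; rewrite -expr2 lt_neqAle eq_sym sqrf_eq0 sqr_ge0 andbT.
by apply: contra_neq w0 => w0; apply: row2P; rewrite ?w0 ?w1 mxE.
Unshelve. all: by end_near.
Qed.

Hypothesis connG : forall g h, reach adj predT g h.

Lemma connected_gluing : connected [set: X].
Proof.
have [g0|G0] := pselect (exists g : G, True); last first.
  suff -> : [set: X] = set0 by exact: connected0.
  apply/seteqP; split=> // x _; have [g _] := gluing_surj gl x.
  by case: G0; exists g.
case: g0 => g _; rewrite (_ : setT = \bigcup_(h in setT) face tri h).
  apply: (connected_faces gl) => //.
  move=> h _; elim: (connG g h) => [|i k _ _ IH]; first exact: path_in_refl.
  exact: path_in_step.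
apply/seteqP; split=> // x _; have [h [p [sp <-]]] := gluing_surj gl x.
by exists h => //; exists p.
Qed.

Lemma surface_gluing : countable [set: G] -> surface R X.
Proof.
move=> cG; split; first exact: connected_gluing.
  split; [exact: hausdorff_gluing|exact: second_countable_gluing|].
  by exists star_atlas; exact: star_atlasP.
by exists star_atlas; exact: star_atlas_oriented.
Qed.

(** The star of a corner is an open set met by only the [2 * m j] triangles around it. Compactness
    is used in its near-covering form with the filter of finite sets ordered by inclusion, so no
    finite subcover has to be named. *)
Lemma compact_faces K : compact K ->
  exists2 Om : set G, finite_set Om & forall h, face tri h `&` K !=set0 -> Om h.
Proof.
move=> /compact_near_coveringP cK.
pose F := filter_from [set Om : set G | finite_set Om] (fun Om => [set Om' | Om `<=` Om']).
have FF : Filter F.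
  apply: filter_from_filter; first by exists set0; exact: finite_set0.
  move=> A B fA fB; exists (A `|` B); first by rewrite /= finite_setU.
  by move=> C AB; split=> z zA; apply: AB; [left|right].
have [|Om fOm H] := cK _ F (fun Om x => forall h, face tri h x -> Om h) FF.
  move=> x _; have [j [g sx]] := star_cover gl x.
  exists (st j g, [set Om | [set turn adj j k g | k in `I_(m j).*2] `<=` Om]).
    split; first by apply: open_nbhs_nbhs; split=> //; exact: (star_open gl).
    by exists [set turn adj j k g | k in `I_(m j).*2] => //; apply: finite_image; exact: finite_II.
  move=> [y Om] [/= sy sOm] h [p sp E]; apply: sOm; move: sy.
  rewrite -E /st (starP gl) // => -[r _].
  by have [k km ->] := reachP_turn adjK tg r; exists k.
by exists Om => // h [x [xh Kx]]; apply: (H Om _ x Kx h xh).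
Qed.

Hypothesis infG : ~ finite_set [set: G].
Hypothesis one_endG : forall Om : set G, finite_set Om -> exists2 Y, finite_set Y &
  forall x y, ~ Y x -> ~ Y y -> path_in adj (~` Om) x y.

Lemma unbounded_component (K : {K : set X | compact K}) :
  exists C, is_component (~` sval K) C /\
    exists2 Y, finite_set Y & forall h, ~ Y h -> face tri h `<=` C.
Proof.
have [Om fOm KOm] := compact_faces (svalP K).
have [Y fY HY] := one_endG fOm.
have [g gY] : exists g, ~ Y g.
  by apply: contrapT => /forallNP H; apply: infG; apply: sub_finite_set fY => h _; exact: contrapT (H h).
have faceN h : ~ Om h -> face tri h `<=` ~` sval K.
  by move=> nh x xh Kx; apply: nh; apply: KOm; exists x.
have in_S S a b : path_in adj S a b -> S b by case.
have gc : (~` sval K) (tri g (row3 0 1 0 0)).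
  apply: (faceN g); first exact: in_S (HY _ _ gY gY).
  by exists (row3 0 1 0 0) => //; exact: vertex_simplex.
exists (connected_component (~` sval K) (tri g (row3 0 1 0 0))); split.
  by exists (tri g (row3 0 1 0 0)).
exists Y => // h hY.
pose S := [set k | path_in adj (~` Om) g k].
have cS : connected (\bigcup_(k in S) face tri k).
  apply: (connected_faces gl (g := g)); first exact: HY.
  move=> k; elim=> [gOm|i k' r IH nO]; first by apply: path_in_refl; exact: path_in_refl.
  by apply: path_in_step => //; exact: path_in_step.
apply: subset_trans (@connected_component_max _ (~` sval K) (\bigcup_(k in S) face tri k) (tri g (row3 0 1 0 0)) _ _ cS).
- by move=> x xh; exists h => //; exact: HY.
- exists g; first exact: HY.
  by exists (row3 0 1 0 0) => //; exact: vertex_simplex.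
- by move=> x [k /in_S kO xk]; exact: (faceN k).
Qed.

Lemma one_end_gluing : exists! E, is_end (X := X) E.
Proof.
pose E K := sval (cid (unbounded_component K)).
have EP K : is_component (~` sval K) (E K) := (svalP (cid (unbounded_component K))).1.
have EY K : exists2 Y, finite_set Y & forall h, ~ Y h -> face tri h `<=` E K := (svalP (cid (unbounded_component K))).2.
have comp_eq (A C C' : set X) z : is_component A C -> is_component A C' -> C z -> C' z -> C = C'.
  move=> [x Ax ->] [y Ay ->] zx zy.
  by rewrite (same_connected_component zx) (same_connected_component zy).
have ptf g : face tri g (tri g (row3 0 1 0 0)) by exists (row3 0 1 0 0) => //; exact: vertex_simplex.
exists E; split.
  split=> // K L KL.
  have [YK fYK HK] := EY K; have [YL fYL HL] := EY L.
  have [g gY] : exists g, ~ (YK `|` YL) g.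
    apply: contrapT => /forallNP H; apply: infG; apply: (@sub_finite_set _ _ (YK `|` YL)).
      by move=> h _; exact: contrapT (H h).
    by rewrite finite_setU.
  have zK : E K (tri g (row3 0 1 0 0)) by apply: HK (ptf g) => h; apply: gY; left.
  have zL : E L (tri g (row3 0 1 0 0)) by apply: HL (ptf g) => h; apply: gY; right.
  have [x Kx Ex] := EP K; have [y Ly Ey] := EP L.
  rewrite Ex in zK *; rewrite (same_connected_component zK).
  apply: connected_component_max => //; last by rewrite Ey; exact: component_connected.
  by rewrite Ey => z /connected_component_sub nz Kz; exact: nz (KL _ Kz).
move=> E' [E'P E'm]; apply/funext => K.
have [Y fY HY] := EY K.
(* Enlarging [K] by the finitely many triangles that may leave [E K] forces any point outside the
   enlarged set into [E K]. *)
have cL : compact (sval K `|` \bigcup_(h in Y) face tri h).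
  apply: compactU; first exact: svalP.
  rewrite -(bigsetU_fset_set _ fY) //; apply: bigsetU_compact => h _; exact: (face_compact gl).
pose L : {K : set X | compact K} := exist _ _ cL.
have [z Lz E'L] := E'P L.
have z' : E' L z by rewrite E'L; exact: connected_component_refl.
apply: (comp_eq _ _ _ z (EP K) (E'P K)); last by apply: (E'm K L) => // x; left.
have [h [p [sp zE]]] := gluing_surj gl z.
apply: (HY h); last by exists p.
by move=> Yh; apply: Lz; right; exists h => //; exists p.
Qed.

End Surface.

(** * Regions of hexagons and their Euler characteristic *)

Lemma within_comp (U V W : topologicalType) (A : set V) (B : set U) (f : V -> U) (g : U -> W) :
  (forall x, A x -> B (f x)) -> {within A, continuous f} -> {within B, continuous g} ->
  {within A, continuous (fun x => g (f x))}.
Proof.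
move=> AB /subspace_continuousP cf /subspace_continuousP cg; apply/subspace_continuousP => x Ax D Dn.
have h : \forall y \near f x, B y -> D (g y) := cg (f x) (AB x Ax) D Dn.
have {}h : \forall z \near x, A z -> B (f z) -> D (g (f z)) := cf x Ax _ h.
by apply: filterS h => z H Az; apply: H => //; exact: AB.
Qed.

(** * Closed curves traced by the orbits of a permutation *)

Section OrbitCurves.
Variables (R : realType) (X : topologicalType) (T : finType) (nx : {perm T})
  (V : {set T}) (sigma : T -> R -> X).
Hypotheses (V_nx : forall t, t \in V -> nx t \in V)
  (sigma_cont : forall t, t \in V -> {within `[0, 1], continuous (sigma t)})
  (sigma_inj : forall t u r s, t \in V -> u \in V -> 0 <= r < 1 -> 0 <= s < 1 ->
     sigma t r = sigma u s -> t = u /\ r = s)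
  (sigma_nx : forall t, t \in V -> sigma t 1 = sigma (nx t) 0).

Let arc t : set X := sigma t @` `[0, 1].

Definition orbit_curve (B : {set T}) : set X := \bigcup_(t in [set` B]) arc t.

Section OneOrbit.
Variables (t0 : T) (Vt0 : t0 \in V).
Let n := #|porbit nx t0|.
Let nth k := iter k nx t0.

Let n0 : (0 < n)%N. Proof. by apply/card_gt0P; exists t0; exact: porbit_id. Qed.
Let n0R : 0 < n%:R :> R. Proof. by rewrite ltr0n. Qed.

Let Vnth k : nth k \in V. Proof. by elim: k => //= k; exact: V_nx. Qed.

Let nth_n : nth n = t0. Proof. exact: iter_porbit. Qed.

Let nth_orbit k : nth k \in porbit nx t0.
Proof. by rewrite /nth -permX mem_porbit. Qed.

Let nth_ex u : u \in porbit nx t0 -> exists2 k, (k < n)%N & u = nth k.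
Proof.
rewrite porbit_traject => /trajectP[k kn ->]; by exists k.
Qed.

Let nth_inj k l : (k < n)%N -> (l < n)%N -> nth k = nth l -> k = l.
Proof.
move=> kn ln; have := uniq_traject_porbit nx t0; rewrite -/n => U.
have E a : (a < n)%N -> nth a = seq.nth t0 (traject nx t0 n) a by move=> an; rewrite nth_traject.
by rewrite (E _ kn) (E _ ln) => /eqP; rewrite nth_uniq ?size_traject // => /eqP.
Qed.

(** The arcs of an orbit of length [n] run one after the other, each in time 1/n. At [s = 1] the
    index is [n], which is again the initial arc at its start. *)
Let gam (s : R) : X := let k := Num.truncn (n%:R * s) in sigma (nth k) (n%:R * s - k%:R).

Let gamE k s : k%:R <= n%:R * s <= k%:R + 1 -> gam s = sigma (nth k) (n%:R * s - k%:R).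
Proof.
move=> /andP[ks sk]; rewrite /gam; have [sk'|sk'] := ltP (n%:R * s) (k%:R + 1).
  by rewrite (@truncn_def _ _ k) // ks -natr1.
have -> : n%:R * s = k.+1%:R by rewrite -natr1; apply/eqP; rewrite eq_le sk sk'.
by rewrite natrK subrr /= -sigma_nx // -natr1 addrAC subrr add0r.
Qed.

Lemma simple_closed_orbit_curve : simple_closed_curve R (orbit_curve (porbit nx t0)).
Proof.
have g01 s : 0 <= s < 1 -> exists k, [/\ (k < n)%N, 0 <= n%:R * s - k%:R < 1 & gam s = sigma (nth k) (n%:R * s - k%:R)].
  move=> /andP[s0 s1]; exists (Num.truncn (n%:R * s)).
  have /truncn_itv/andP[h1 h2] : 0 <= n%:R * s by rewrite mulr_ge0.
  split=> //; last by apply/andP; split; [lra|rewrite -natr1 in h2; lra].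
  rewrite truncn_lt_nat ?mulr_ge0 //; by rewrite -[ltRHS]mulr1 ltr_pM2l.
have gam1 : gam 1 = gam 0.
  by rewrite /gam mulr1 mulr0 natrK truncn0 !subrr nth_n.
exists gam; split=> //.
- have pc k : (k < n)%N -> {within `[k%:R / n%:R, k.+1%:R / n%:R], continuous gam}.
    move=> kn; have E : {in `[k%:R / n%:R, k.+1%:R / n%:R]%classic, (fun s => sigma (nth k) (n%:R * s - k%:R)) =1 gam}.
      move=> s; rewrite inE /= in_itv /= ler_pdivrMr // ler_pdivlMr // -natr1 => /andP[h1 h2].
      by rewrite (@gamE k) // mulrC h1 h2.
    apply: (subspace_eq_continuous E).
    have H1 (s : R) : `[k%:R / n%:R, k.+1%:R / n%:R]%classic s -> `[0, 1]%classic (n%:R * s - k%:R).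
      rewrite /= !in_itv /= ler_pdivrMr // ler_pdivlMr // -natr1 => /andP[h1 h2].
      by apply/andP; split; lra.
    have H2 : {within `[k%:R / n%:R, k.+1%:R / n%:R], continuous (fun s : R => n%:R * s - k%:R)}.
      apply: continuous_subspaceT => s; apply: contB; last exact: cont_cst.
      by apply: contM; [exact: cont_cst|exact: cvg_id].
    exact (within_comp H1 H2 (sigma_cont (Vnth k))).
  have H k : (k <= n)%N -> {within `[0, k%:R / n%:R], continuous gam}.
    elim: k => [_|k IH kn].
      rewrite mul0r (_ : `[0, 0]%classic = [set 0]); first exact: continuous_subspace1.
      by rewrite set_itv1.
    have -> : `[0, k.+1%:R / n%:R]%classic = `[0, k%:R / n%:R] `|` `[k%:R / n%:R, k.+1%:R / n%:R]%classic :> set R.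
      have h1 : 0 <= k%:R / n%:R :> R by rewrite divr_ge0.
      have h2 : k%:R / n%:R <= k.+1%:R / n%:R :> R by rewrite ler_pM2r ?invr_gt0 // ler_nat.
      apply/seteqP; split=> x /=; rewrite !in_itv /=.
        by case: (leP x (k%:R / n%:R)) => xk /andP[x0 x1]; [left|right]; rewrite ?x0 ?xk ?x1 ?(ltW xk).
      by case=> /andP[x0 x1]; apply/andP; split=> //; lra.
    by apply: withinU_continuous; [exact: itv_closed|exact: itv_closed|exact: IH (ltnW kn)|exact: pc].
  by have := H n (leqnn _); rewrite divff // gt_eqF.
- move=> r s; rewrite !in_itv /= => r01 s01.
  have [k [kn k01 ->]] := g01 _ r01; have [l [ln l01 ->]] := g01 _ s01.
  move=> /(sigma_inj (Vnth _) (Vnth _) k01 l01) [/(nth_inj kn ln) <-] /addIr/mulfI -> //.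
  by rewrite gt_eqF.
apply/seteqP; split=> [x [t /= tB [s /=]]|_ [s /= s01 <-]].
  have [k kn ->] := nth_ex tB; rewrite in_itv /= => /andP[s0 s1] <-.
  exists ((k%:R + s) / n%:R).
    rewrite /= in_itv /= divr_ge0 ?addr_ge0 //= ler_pdivrMr // mul1r.
    by have : k.+1%:R <= n%:R :> R by [rewrite ler_nat]; rewrite -natr1; lra.
  have E : n%:R * ((k%:R + s) / n%:R) = k%:R + s by rewrite mulrC divfK // gt_eqF.
  by rewrite (@gamE k) E ?lerDl ?lerD2l ?s0 ?s1 // addrC addKr.
have [s1|s1] := ltP s 1.
  have [|k [kn k01 ->]] := g01 s; first by move: s01; rewrite in_itv /= => /andP[-> _].
  exists (nth k); first exact: nth_orbit.
  by exists (n%:R * s - k%:R) => //; rewrite /= in_itv /=; case/andP: k01 => -> /ltW ->.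
have -> : s = 1 by move: s01; rewrite in_itv /= => /andP[_ h]; apply/eqP; rewrite eq_le h s1.
rewrite gam1; exists t0; first exact: porbit_id.
exists 0; first by rewrite /= in_itv /= lexx ler01.
by rewrite /gam mulr0 truncn0 subrr.
Qed.

End OneOrbit.

Let orbits := [set porbit nx t | t in V]%SET.

Lemma orbit_curves : exists c : 'I_#|orbits| -> set X,
  [/\ forall i, simple_closed_curve R (c i), trivIset setT c &
      \bigcup_(t in [set` V]) arc t = \bigcup_i c i].
Proof.
exists (fun i => orbit_curve (enum_val i)); split.
- move=> i; have /imsetP[t tV ->] := enum_valP i.
  exact: simple_closed_orbit_curve.
- apply/trivIsetP => i j _ _ ij; apply/seteqP; split=> // x [].
  have half t : t \in V -> forall s, s \in `[0, 1] -> exists u r, [/\ u \in V, u \in porbit nx t, 0 <= r < 1 & sigma t s = sigma u r].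
    move=> tV s; rewrite in_itv /= => /andP[s0 s1]; have [s1'|s1'] := ltP s 1.
      by exists t, s; rewrite s0 s1' tV porbit_id.
    have -> : s = 1 by apply/eqP; rewrite eq_le s1 s1'.
    by exists (nx t), 0; rewrite ltr01 lexx sigma_nx // V_nx // -{1}(expg1 nx) mem_porbit.
  have /imsetP[t tV ti] := enum_valP i; have /imsetP[u uV uj] := enum_valP j.
  have inV v w : v \in V -> w \in porbit nx v -> w \in V.
    by move=> vV /porbitP[k ->]; rewrite permX; elim: k => //= k; exact: V_nx.
  move=> [t' /=]; rewrite ti => t't [s s01 <-] [u' /=]; rewrite uj => u'u [r r01].
  have [t2 [s2 [V2 o2 s2' ->]]] := half _ (inV _ _ tV t't) _ s01.
  have [u2 [r2 [W2 p2 r2' ->]]] := half _ (inV _ _ uV u'u) _ r01.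
  move=> /(sigma_inj W2 V2 r2' s2') [E _].
  move/eqP: ij; apply; apply: enum_val_inj; rewrite ti uj.
  move: t't u'u o2 p2; rewrite -!eq_porbit_mem => /eqP <- /eqP <- /eqP <- /eqP <-.
  by rewrite E.
apply/seteqP; split=> x.
  move=> [t /= tV xt]; have oV : porbit nx t \in orbits by exact: imset_f.
  exists (enum_rank_in oV (porbit nx t)) => //; rewrite enum_rankK_in //.
  by exists t => //; exact: porbit_id.
move=> [i _ [t /= ti xt]]; exists t => //=.
have /imsetP[u uV ui] := enum_valP i; move: ti; rewrite ui => /porbitP[k ->].
by rewrite permX; elim: k => //= k; exact: V_nx.
Qed.

(** Each orbit carries weight at least 1, and the orbits partition [V]. *)
Lemma card_orbits (w : T -> R) : (forall t, t \in V -> 0 <= w t) ->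
  (forall t, t \in V -> 1 <= \sum_(u in porbit nx t) w u) ->
  #|orbits|%:R <= \sum_(t in V) w t.
Proof.
move=> w0 w1.
have cov : forall u, u \in V -> forall t, u \in porbit nx t -> t \in V.
  move=> u uV t; rewrite porbit_sym => /porbitP[k ->].
  by rewrite permX; elim: k => //= k; exact: V_nx.
rewrite (partition_big (porbit nx) (mem orbits)) /=; last by move=> t tV; exact: imset_f.
rewrite -[leLHS]mulr_natr mul1r -sum1_card natr_sum; apply: ler_sum => B /imsetP[t tV ->].
apply: le_trans (w1 t tV) _; rewrite le_eqVlt; apply/orP; left; apply/eqP.
apply: eq_bigl => u; rewrite -eq_porbit_mem andbC; case: eqP => //= E.
by rewrite (cov t tV) // E porbit_id.
Qed.

End OrbitCurves.

(** * Unions of truncated triangles and their boundary *)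

Section Hexagons.
Variables (R : realType) (G : choiceType) (X : topologicalType)
  (adj : 'I_3 -> G -> G) (tri : G -> 'rV[R]_3 -> X) (par : G -> bool) (m : 'I_3 -> nat).
Hypotheses (gl : gluing adj tri) (tg : triangle_group adj par m).
Implicit Types (g h : G) (p q : 'rV[R]_3) (i j k : 'I_3).

Let adjK := gluing_adjK gl.

Lemma row3_shift1 j (a b c : R) : row3 (j + 1) a b c = row3 j c a b.
Proof.
by apply: (@row3P _ (j + 1)); rewrite !row3E ?ord3_11 ?ord3_12 ?row3E.
Qed.

Lemma row3_shift2 j (a b c : R) : row3 (j + 2%:R) a b c = row3 j b c a.
Proof.
by apply: (@row3P _ (j + 2%:R)); rewrite !row3E ?ord3_21 ?ord3_22 ?row3E.
Qed.

Lemma row3_inj j (a b c a' b' c' : R) : row3 j a b c = row3 j a' b' c' ->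
  [/\ a = a', b = b' & c = c'].
Proof.
move=> E; split.
- by have := congr1 (fun v : 'rV[R]_3 => v ord0 j) E; rewrite !row3E.
- by have := congr1 (fun v : 'rV[R]_3 => v ord0 (j + 1)) E; rewrite !row3E.
- by have := congr1 (fun v : 'rV[R]_3 => v ord0 (j + 2%:R)) E; rewrite !row3E.
Qed.

Lemma reach_none (P : pred 'I_3) g h : (forall k, ~~ P k) -> reach adj P g h -> h = g.
Proof. by move=> P0; elim=> // i k Pi; have := P0 i; rewrite Pi. Qed.

Lemma reach_one (P : pred 'I_3) i g h : (forall k, P k -> k = i) -> reach adj P g h ->
  h = g \/ h = adj i g.
Proof.
by move=> P1; elim=> [|k h' /P1 -> _ [->|->]]; [left|right|left; rewrite adjK].
Qed.

(** A neighbourhood of a point is entered along the segment to any other point of the same triangle.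
    Applied towards the centre or a corner, this exhibits nearby points inside or outside the
    region. *)
Lemma near_segment (U : set X) g p r : nbhs (tri g p) U -> simplex 3 p -> simplex 3 r ->
  exists2 e, 0 < e < 1 & U (tri g ((1 - e) *: p + e *: r)).
Proof.
move=> /nbhs_interior Up sp sr.
have H : \forall q \near p, simplex 3 q -> U° (tri g q).
  by apply: (tri_near gl (open_interior U) sp); exact: nbhs_singleton Up.
pose f (e : R) : 'rV[R]_3 := (1 - e) *: p + e *: r.
have fc : {for 0, continuous f}.
  rewrite /f; apply: continuousD; apply: continuousZr_tmp; last exact: cvg_id.
  by apply: contB; [exact: cont_cst|exact: cvg_id].
have f0 : f 0 = p by rewrite /f subr0 scale1r scale0r addr0.
have H2 : nbhs (f 0) [set q | simplex 3 q -> U° (tri g q)] by rewrite f0.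
have {}H : \forall e \near (0 : R), simplex 3 (f e) -> U° (tri g (f e)) := fc _ H2.
have [d /= d0 dP] := (nbhs_ballP _ _).1 H.
have e1 : 0 < Num.min (d / 2) 2^-1 by rewrite lt_min divr_gt0 //= invr_gt0.
exists (Num.min (d / 2) 2^-1).
  by rewrite e1 gt_min [X in _ || X](_ : _ = true) ?orbT //; apply/idP; lra.
apply: nbhs_singleton; apply: dP.
  rewrite -ball_normE /= sub0r normrN gtr0_norm // gt_min; apply/orP; left; lra.
apply: simplex_convex => //; rewrite (ltW e1) ge_min; apply/orP; right; lra.
Qed.

(** A union of full triangles may touch itself at a corner, where its boundary is not a curve.
    Truncation at 2/3 removes every corner, at the price of one hole for each corner surrounded by
    the region. *)
Definition hexagon : set 'rV[R]_3 := [set p | simplex 3 p /\ forall i, p ord0 i <= 2 / 3].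

Definition ctr : 'rV[R]_3 := \row_(i < 3) 3^-1.

Lemma simplex_ctr : simplex 3 ctr.
Proof. by split=> [i|]; rewrite ?(sum3 _ 0) !mxE; lra. Qed.

Lemma hexagon_ctr : hexagon ctr.
Proof. by split=> [|i]; [exact: simplex_ctr|rewrite mxE; lra]. Qed.

Lemma hexagon_convex p q t : 0 <= t <= 1 -> hexagon p -> hexagon q ->
  hexagon ((1 - t) *: p + t *: q).
Proof.
move=> t01 [sp hp] [sq hq]; split; first exact: simplex_convex.
by move=> i; rewrite !vecE; have := hp i; have := hq i; nra.
Qed.

Lemma hexagon_connected : connected hexagon.
Proof.
apply: (star_shaped_connected hexagon_ctr) => p t hp t01.
exact: hexagon_convex t01 hexagon_ctr hp.
Qed.

Lemma hexagon_compact : compact hexagon.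
Proof.
have -> : hexagon = @simplex R 3 `&` \bigcap_i [set p | p ord0 i <= 2 / 3].
  by apply/seteqP; split=> [p [sp hp]|p [sp hp]]; split=> // i; [move=> _; exact: hp|exact: hp].
apply: compact_closedI; first exact: simplex_compact.
apply: closed_bigI => i _.
apply: (@closed_comp _ _ (fun p : 'rV[R]_3 => p ord0 i) [set x | x <= 2 / 3]).
  by move=> *; exact: coord_continuous.
exact: closed_le.
Qed.

Variable Om : {fset G}.

Definition region : set X := \bigcup_(g in [set` Om]) (tri g @` hexagon).

Lemma regionP g p : simplex 3 p -> region (tri g p) <->
  hexagon p /\ exists2 h, h \in Om & reach adj (fun k => p ord0 k == 0) g h.
Proof.
move=> sp; split=> [[h /= hO [q [sq hq]]]|[hp [h hO r]]].
  move=> /esym/(tri_eqP gl sp sq) [pq r]; rewrite pq; split=> //.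
  by exists h => //; rewrite -pq.
by exists h => //; exists p => //; apply/esym/(tri_reach gl sp).
Qed.

Lemma region_compact : compact region.
Proof.
rewrite /region -(bigsetU_fset_set _ (finite_fset Om)) //; apply: bigsetU_compact => g _.
apply: continuous_compact; last exact: hexagon_compact.
by apply: continuous_subspaceW (@gluing_cont _ _ _ _ _ gl g) => p [].
Qed.

Lemma region_connected g : g \in Om -> (forall h, h \in Om -> path_in adj [set` Om] g h) ->
  connected region.
Proof.
move=> gO H; apply: (connected_cells gl (g := g)) => //; last first.
- move=> i; exists (row3 i 0 2^-1 2^-1); last by rewrite row3_0.
  have s : simplex 3 (row3 i 0 2^-1 2^-1 : 'rV[R]_3) by apply: simplex_row3; lra.
  by split=> //; apply: (@ord3P _ i); rewrite !row3E; lra.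
- exact: hexagon_connected.
by move=> p [].
Qed.

(** With all coordinates below 2/3 at most one coordinate vanishes, so the point lies in at most two
    triangles, both of which belong to [Om]. *)
Lemma region_interior g p : g \in Om -> simplex 3 p -> (forall i, p ord0 i < 2 / 3) ->
  (forall i, p ord0 i = 0 -> adj i g \in Om) -> region° (tri g p).
Proof.
move=> gO sp hp p0; pose P := fun k => p ord0 k == 0.
pose N1 k := [set q : 'rV[R]_3 | q ord0 k < 2 / 3].
pose N := N1 0 `&` N1 (0 + 1) `&` N1 (0 + 2%:R).
have NP q : N q <-> forall k, q ord0 k < 2 / 3.
  split=> [[[n0 n1] n2]|n]; last by split; [split|]; exact: n.
  exact: (@ord3P (fun k => q ord0 k < 2 / 3) 0).
have oN1 k : open (N1 k).
  apply: (@open_comp _ _ (fun q : 'rV[R]_3 => q ord0 k) [set x | x < 2 / 3]); last exact: open_lt.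
  by move=> *; exact: coord_continuous.
have oN : open N by do !apply: openI.
have oU := ostar_open gl P g oN.
suff UA : ostar adj tri P g N `<=` region.
  apply: (filterS UA); apply: open_nbhs_nbhs; split=> //.
  rewrite (ostarP gl) //; split; [exact: reach_refl|exact/NP|].
  by move=> k Pk; rewrite lt_neqAle eq_sym Pk simplex_ge0.
move=> _ [h [q [r sq Nq _ <-]]]; exists h; last first.
  by exists q => //; split=> // k; apply/ltW; move: k; exact/NP.
have [[i pi0]|/forallNP np] := pselect (exists i, P i); last by rewrite /= (reach_none _ r) // => k; apply/negP/np.
have [|->|->] := @reach_one P i g h _ r => //=; last by apply: p0; exact/eqP.
move=> k /eqP Pk; apply/eqP; move/eqP: pi0 => pi0; have s := simplex3_sum i sp.
have h1 := hp (i + 1); have h2 := hp (i + 2%:R).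
by apply: contraT; rewrite ord3_neq => /orP[] /eqP ki; move: Pk; rewrite ki; lra.
Qed.

Lemma closure_region_interior : hausdorff_space X -> closure (region°) = region.
Proof.
move=> hX; apply/seteqP; split.
  apply: subset_trans (closure_subset (@interior_subset _ region)) _.
  by rewrite -(closure_id region).1 //; exact: compact_closed hX region_compact.
move=> _ [g /= gO [p [sp hp] <-]] V /(near_segment) /(_ sp simplex_ctr) [e /andP[e0 e1] Ve].
exists (tri g ((1 - e) *: p + e *: ctr)); split=> //.
have c i : ((1 - e) *: p + e *: ctr) ord0 i = (1 - e) * p ord0 i + e / 3 by rewrite !vecE mxE.
apply: region_interior => // [||i].
- by apply: simplex_convex => //; [rewrite ltW ?ltW|exact: simplex_ctr].
- by move=> i; rewrite c; have := hp i; nra.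
- by rewrite c; have := simplex_ge0 i sp => p0 E; exfalso; nra.
Qed.

Definition tok : finType := (Om * 'I_3 * bool)%type.

Definition nbr i (g : Om) : Om := insubd g (adj i (val g)).

Lemma nbrE i (g : Om) : adj i (val g) \in Om -> val (nbr i g) = adj i (val g).
Proof. by move=> gO; rewrite /nbr val_insubd gO. Qed.

(* A token is either the segment p_j = 2/3 cutting off the corner j of the
   triangle g (flag true), or the middle third of the side j of g (flag false).
   The tokens are traversed with the region on a fixed side. *)
Definition nxt (t : tok) : tok := let: (g, j, b) := t in
  if b then let i := j + (if par (val g) then 2%:R else 1) in
    if adj i (val g) \in Om then (nbr i g, j, true) else (g, i, false)
  else if adj j (val g) \in Om then t
    else (g, j + (if par (val g) then 2%:R else 1), true).

Definition prv (t : tok) : tok := let: (g, j, b) := t in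
  if b then let i := j + (if par (val g) then 1 else 2%:R) in
    if adj i (val g) \in Om then (nbr i g, j, true) else (g, i, false)
  else if adj j (val g) \in Om then t
    else (g, j + (if par (val g) then 1 else 2%:R), true).

Lemma nxtK : cancel nxt prv.
Proof.
move=> [[g j] [|]]; rewrite /nxt.
  set i := j + _; have ji : i + (if par (val g) then 1 else 2%:R) = j.
    by rewrite /i; case: ifP; rewrite ?ord3_21 ?ord3_12.
  case: ifPn => iO; rewrite /prv ?(negbTE iO) ?ji //.
  rewrite nbrE // (par_adj tg) if_neg -/i adjK fsvalP.
  by congr (_, _, _); apply: val_inj; rewrite nbrE nbrE // adjK // fsvalP.
case: ifPn => jO; rewrite /prv ?jO //.
have -> : j + (if par (val g) then 2%:R else 1) + (if par (val g) then 1 else 2%:R) = j.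
  by case: ifP; rewrite ?ord3_21 ?ord3_12.
by rewrite (negbTE jO).
Qed.

Definition nx : {perm tok} := perm (can_inj nxtK).

(** Sides between two triangles of the region are fixed points of [nxt], which makes it a
    permutation of all tokens; the other tokens are the pieces of the boundary. *)
Definition valid : {set tok} := [set t : tok | t.2 || (adj t.1.2 (val t.1.1) \notin Om)]%SET.

Lemma valid_nx t : t \in valid -> nx t \in valid.
Proof.
rewrite permE !inE; case: t => -[g j] [|] //= => [_|jO]; last by rewrite (negbTE jO).
by case: ifPn.
Qed.

(** Parity reverses the parametrization, so that mirror-image triangles are traversed coherently and
    each valid token ends where the next one starts. *)
Definition seg (t : tok) (s : R) : 'rV[R]_3 := let: (g, j, b) := t in
  let u := if par (val g) then s else 1 - s in
  if b then row3 j (2 / 3) (u / 3) ((1 - u) / 3)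
  else row3 j 0 ((2 - u) / 3) ((1 + u) / 3).

Definition sigma t s := tri (val t.1.1) (seg t s).

Lemma seg_hexagon t s : 0 <= s <= 1 -> hexagon (seg t s).
Proof.
case: t => -[g j] b /= /andP[s0 s1]; set u := if par (fsval g) then s else 1 - s.
have /andP[u0 u1] : 0 <= u <= 1 by rewrite /u; case: ifP => _; apply/andP; split; lra.
by case: b; split; try (apply: simplex_row3; lra); apply: (@ord3P _ j); rewrite row3E; lra.
Qed.

Lemma sigma_cont t : {within `[0, 1], continuous (sigma t)}.
Proof.
have H1 (s : R) : `[0, 1]%classic s -> simplex 3 (seg t s).
  by rewrite /= in_itv /= => h; have [] := @seg_hexagon t s h.
suff H2 : {within `[0, 1], continuous (seg t)}.
  exact (within_comp H1 H2 (@gluing_cont _ _ _ _ _ gl _)).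
apply: continuous_subspaceT; case: t {H1} => -[g j] b; apply: continuous_rV => i s.
have cu : {for s, continuous (fun s : R => if par (val g) then s else 1 - s)}.
  by case: (par (val g)); [exact: cvg_id|apply: contB; [exact: cont_cst|exact: cvg_id]].
set u := fun s : R => _ in cu.
have c1 (a d : R) : {for s, continuous (fun s => (a + d * u s) / 3)}.
  apply: contM; last exact: cont_cst.
  by apply: contD; [exact: cont_cst|apply: contM => //; exact: cont_cst].
have E (a c e f k : R) : {for s, continuous (fun s => row3 j a ((c + e * u s) / 3) ((f + k * u s) / 3) ord0 i)}.
  rewrite (_ : (fun s => _) = fun s => if i == j then a else if i == j + 1 then (c + e * u s) / 3 else (f + k * u s) / 3).
    by case: (i == j); [exact: cont_cst|case: (i == j + 1)].
  by apply/funext => x; rewrite mxE.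
suff [a [c [e [f [k Ek]]]]] : exists a c e f k : R, (fun s => seg (g, j, b) s ord0 i) =
    fun s => row3 j a ((c + e * u s) / 3) ((f + k * u s) / 3) ord0 i.
  suff : {for s, continuous (fun s => seg (g, j, b) s ord0 i)} by [].
  by rewrite Ek; exact: E.
case: b.
  exists (2 / 3), 0, 1, 1, (-1); apply/funext => x.
  by rewrite /seg /u add0r mul1r mulN1r.
exists 0, 2, (-1), 1, 1; apply/funext => x.
by rewrite /seg /u mul1r mulN1r.
Qed.

Lemma sigma_nx t : t \in valid -> sigma t 1 = sigma (nx t) 0.
Proof.
rewrite permE inE; case: t => -[g j] b V; have z := subrr (1 : R).
have E0 : (2 - 1) / 3 = 1 / 3 :> R by lra.
have E1 : (1 + 1) / 3 = 2 / 3 :> R by lra.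
have S (x y : R) : x = 0 /\ y = 1 / 3 \/ x = 1 / 3 /\ y = 0 -> simplex 3 (row3 j (2 / 3) x y).
  by move=> H; apply: simplex_row3; lra.
case: b V => /= V; last first.
  rewrite /sigma (negbTE V) /=; case: (par (fsval g)); cbv beta iota.
    by rewrite row3_shift2 mul0r !subr0 E0 E1.
  by rewrite row3_shift1 ?subr0 ?z ?subr0 ?mul0r ?addr0.
case: ifPn => iO; rewrite /sigma /= ?nbrE //; last first.
  case: (par (fsval g)); cbv beta iota; first by rewrite row3_shift2 z !subr0 mul0r addr0.
  by rewrite row3_shift1 z !subr0 mul0r E0 E1.
rewrite (par_adj tg) if_neg; move: iO; case: (par (fsval g)); cbv beta iota => iO.
  by rewrite z subr0 subrr mul0r tri_adj ?row3_2 //; apply: S; right.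
by rewrite z subr0 mul0r tri_adj ?row3_1 //; apply: S; left.
Qed.

Lemma cut_side_disjoint (g h : Om) j k s r : 0 <= s < 1 -> 0 <= r < 1 -> (h, k, false) \in valid ->
  sigma (g, j, true) s <> sigma (h, k, false) r.
Proof.
move=> /andP[s0 s1] /andP[r0 r1]; rewrite inE /= => V.
have [|sp _] := @seg_hexagon (g, j, true) s; first by rewrite s0 ltW.
have [|sq _] := @seg_hexagon (h, k, false) r; first by rewrite r0 ltW.
rewrite /sigma /= in sp sq *; move=> /(tri_eqP gl sp sq) {sp sq} [].
set u := if _ then s else _; set v := if _ then r else _ => E.
have main i : i = k -> (forall l, row3 j (2 / 3) (u / 3) ((1 - u) / 3) ord0 l == 0 -> l = i) ->
    u = v -> False -> False by [].
(* At a common point both segments are at parameter 0, which forces opposite parities. The triangles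
   then differ, hence are neighbours across side [k], against the validity of the side token. *)
have main2 : par (val g) != par (val h) ->
    (forall l, row3 j (2 / 3) (u / 3) ((1 - u) / 3) ord0 l == 0 -> l = k) ->
    reach adj (fun l => row3 j (2 / 3) (u / 3) ((1 - u) / 3) ord0 l == 0) (val g) (val h) -> False.
  move=> pgh Z /(reach_one Z) [hg|hg]; first by move: pgh; rewrite hg eqxx.
  by move: V; rewrite hg adjK fsvalP.
have : [|| k == j, k == j + 1 | k == j + 2%:R].
  by have := ord3_neq k j; case: (k == j) => //= ->.
case/or3P => /eqP kj; rewrite kj ?row3_shift1 ?row3_shift2 in E.
- by have [h1 _ _] := row3_inj E; exfalso; lra.
- have [h1 h2 h3] := row3_inj E; apply: main2.
    by move: h1 h2 h3; rewrite /u /v; do 2!case: ifP => //; lra.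
  by apply: (@ord3P _ j); rewrite !row3E kj //; move/eqP=> ?; exfalso; lra.
have [h1 h2 h3] := row3_inj E; apply: main2.
  by move: h1 h2 h3; rewrite /u /v; do 2!case: ifP => //; lra.
by apply: (@ord3P _ j); rewrite !row3E kj //; move/eqP=> ?; exfalso; lra.
Qed.

Lemma sigma_inj t t' r s : t \in valid -> t' \in valid -> 0 <= r < 1 -> 0 <= s < 1 ->
  sigma t r = sigma t' s -> t = t' /\ r = s.
Proof.
move: t t' => [[g j] b] [[h k] c] V W r01 s01.
case: b c V W => -[|] V W; last first.
- have [|sp _] := @seg_hexagon (g, j, false) r; first by case/andP: r01 => -> /ltW ->.
  have [|sq _] := @seg_hexagon (h, k, false) s; first by case/andP: s01 => -> /ltW ->.
  move: r01 s01 => /andP[r0 r1] /andP[s0 s1].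
  rewrite /sigma /= in sp sq *; move=> /(tri_eqP gl sp sq) {sp sq} [].
  set u := if _ then r else _; set v := if _ then s else _ => E.
  have /andP[u0 u1] : 0 <= u <= 1 by rewrite /u; case: ifP => _; apply/andP; split; lra.
  have /andP[v0 v1] : 0 <= v <= 1 by rewrite /v; case: ifP => _; apply/andP; split; lra.
  have kj : k = j.
    apply/eqP; apply: contraT; rewrite ord3_neq => /orP[] /eqP kj; rewrite kj ?row3_shift1 ?row3_shift2 in E;
    by have [h1 h2 h3] := row3_inj E; exfalso; lra.
  rewrite {}kj in W E *; have [_ h2 _] := row3_inj E.
  have Z l : row3 j 0 ((2 - u) / 3) ((1 + u) / 3) ord0 l == 0 -> l = j.
    by move: l; apply: (@ord3P _ j) => //; rewrite row3E => /eqP ?; exfalso; lra.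
  move=> /(reach_one Z) [/val_inj hg|hg]; last by move: V; rewrite inE /= -hg fsvalP.
  by subst h; split=> //; move: h2; rewrite /u /v; case: ifP => _; lra.
- by move=> /esym/(cut_side_disjoint s01 r01 V).
- by move=> /(cut_side_disjoint r01 s01 W).
have [|sp _] := @seg_hexagon (g, j, true) r; first by case/andP: r01 => -> /ltW ->.
have [|sq _] := @seg_hexagon (h, k, true) s; first by case/andP: s01 => -> /ltW ->.
move: r01 s01 => /andP[r0 r1] /andP[s0 s1].
rewrite /sigma /= in sp sq *; move=> /(tri_eqP gl sp sq) {sp sq} [].
set u := if _ then r else _; set v := if _ then s else _ => E.
have /andP[u0 u1] : 0 <= u <= 1 by rewrite /u; case: ifP => _; apply/andP; split; lra.
have /andP[v0 v1] : 0 <= v <= 1 by rewrite /v; case: ifP => _; apply/andP; split; lra.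
have kj : k = j.
  apply/eqP; apply: contraT; rewrite ord3_neq => /orP[] /eqP kj; rewrite kj ?row3_shift1 ?row3_shift2 in E;
  by have [h1 h2 h3] := row3_inj E; exfalso; lra.
rewrite {}kj in W E *; have [_ h2 _] := row3_inj E => rr.
have [i Z] : exists i, forall l, row3 j (2 / 3) (u / 3) ((1 - u) / 3) ord0 l == 0 -> l = i.
  have [u0'|u0'] := eqVneq u 0; [exists (j + 1)|exists (j + 2%:R)];
  by apply: (@ord3P _ j) => //; rewrite row3E => /eqP ?; exfalso; move/eqP: u0'; lra.
(* For opposite parities [u = v] gives [r = 1 - s]. Both parameters are below 1, so both are
   positive, the point has no vanishing coordinate and lies in one triangle only. *)
have pgh : par (fsval g) = par (fsval h).
  apply/eqP; apply: contraT => pn.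
  have hg : val h = val g.
    apply: (@reach_none _ _ _ _ rr); apply: (@ord3P _ j); rewrite row3E;
    move: pn h2; rewrite /u /v; case: (par (val g)); case: (par (val h)) => //= _ h2; apply/eqP; lra.
  by move: pn; rewrite hg eqxx.
have [/val_inj hg|hg] := reach_one Z rr; last first.
  by move: pgh; rewrite hg (par_adj tg); case: (par _).
by subst h; split=> //; move: h2; rewrite /u /v; case: ifP => _; lra.
Qed.

Lemma region_boundary : region `\` region° = \bigcup_(t in [set` valid]) (sigma t @` `[0, 1]).
Proof.
apply/seteqP; split=> [x [[g /= gO [p [sp hp] <-]] nI]|_ [[[g j] b] /= V [s s01 <-]]]; last first.
  have s01' : 0 <= s <= 1 by move: s01; rewrite /= in_itv.
  have [sp hp] := @seg_hexagon (g, j, b) s s01'.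
  split; first by exists (val g); [exact: fsvalP|exists (seg (g, j, b) s)].
  move=> I; case: b V sp hp I => V sp hp I.
    have [e /andP[e0 e1]] := near_segment I sp (vertex_simplex R j).
    set q := _ + _ => Rq; have sq : simplex 3 q.
      by apply: simplex_convex => //; [rewrite !ltW|exact: vertex_simplex].
    have [[_ hq] _] := (regionP _ sq).1 Rq.
    by have := hq j; rewrite /q !vecE /seg !row3_0; lra.
  move: V; rewrite inE /= => V.
  have p0 : seg (g, j, false) s ord0 j = 0 by rewrite /seg row3_0.
  move: I; rewrite /sigma /= -(tri_adj gl (val g) sp p0) => I.
  have [e /andP[e0 e1]] := near_segment I sp simplex_ctr.
  set q := _ + _ => Rq; have sq : simplex 3 q.
    by apply: simplex_convex => //; [rewrite !ltW|exact: simplex_ctr].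
  have [_ [h hO r]] := (regionP _ sq).1 Rq.
  move: V; rewrite -(reach_none _ r) ?hO // => k.
  rewrite /q !vecE [ctr _ _]mxE gt_eqF //; have := simplex_ge0 k sp; nra.
have [[j pj]|/forallNP nj] := pselect (exists j, p ord0 j = 2 / 3).
  exists (FSetSub gO, j, true); first by rewrite /= inE.
  have S := simplex3_sum j sp; have p1 := simplex_ge0 (j + 1) sp; have p2 := simplex_ge0 (j + 2%:R) sp.
  exists (if par g then 3 * p ord0 (j + 1) else 1 - 3 * p ord0 (j + 1)).
    by case: ifP => _; rewrite /= in_itv /=; apply/andP; split; lra.
  rewrite /sigma /=; congr (tri _ _); apply: (@row3P _ j); rewrite row3E //=; case: (par g) => /=; lra.
have [[j [pj jO]]|/forallNP nz] := pselect (exists j, p ord0 j = 0 /\ adj j g \notin Om).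
  exists (FSetSub gO, j, false); first by rewrite /= inE.
  have S := simplex3_sum j sp; have p1 := hp (j + 1); have p2 := hp (j + 2%:R).
  exists (if par g then 2 - 3 * p ord0 (j + 1) else 3 * p ord0 (j + 1) - 1).
    by case: ifP => _; rewrite /= in_itv /=; apply/andP; split; lra.
  rewrite /sigma /=; congr (tri _ _); apply: (@row3P _ j); rewrite row3E //=; case: (par g) => /=; lra.
case: nI; apply: region_interior => // i.
  by rewrite lt_neqAle hp andbT; apply/eqP/nj.
by move=> pi0; apply: contraT => iO; case: (nz i).
Qed.

Lemma region_subsurface g : hausdorff_space X -> g \in Om ->
  (forall h, h \in Om -> path_in adj [set` Om] g h) ->
  is_subsurface R region #|[set porbit nx t | t in valid]%SET|.
Proof.
move=> hX gO H; split.
- by exists (tri g ctr), g => //; exists ctr => //; exact: hexagon_ctr.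
- exact: region_connected H.
- exact: closure_region_interior.
have [c [c1 c2 c3]] := orbit_curves valid_nx (fun t _ => @sigma_cont t) sigma_inj sigma_nx.
by exists c; split=> //; rewrite region_boundary.
Qed.

End Hexagons.

Lemma compact_inverse_continuous (X Y : topologicalType) (A : set X) (f : X -> Y) (g : Y -> X) :
  hausdorff_space Y -> compact A -> {within A, continuous f} ->
  (forall x, A x -> g (f x) = x) -> {within f @` A, continuous g}.
Proof.
move=> hY cA cf gK; apply/continuous_closedP => C cC; apply/closed_subspaceP.
exists (f @` (A `&` C)).
  apply: compact_closed => //; apply: continuous_compact.
    by apply: continuous_subspaceW cf => x [].
  exact: compact_closedI.
apply/seteqP; split=> y [].
  move=> [x [Ax Cx] E] _; have gy : C (g y) by rewrite -E gK.
  by split=> //; exists x.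
move=> /= Cg [x Ax E]; have Cx : C x by rewrite -(gK x Ax) E.
by split; exists x.
Qed.

(** * Barycentric coordinates on a hexagon divided into six triangles *)

Section HexagonCoordinates.
Variable R : realType.
Implicit Types (p : 'rV[R]_3) (i j : 'I_3).

Definition clip (x y z : R) : R := 3 * Num.min (Num.min (Num.max x 0) (Num.max y 0)) z.

Lemma clip_l x y z : 0 <= x -> x <= y -> x <= z -> clip x y z = 3 * x.
Proof.
move=> x0 xy xz; rewrite /clip (max_l x0) (max_l (le_trans x0 xy)).
by rewrite (min_l xy) (min_l xz).
Qed.

Lemma clip_r x y z : 0 <= y -> y <= x -> y <= z -> clip x y z = 3 * y.
Proof.
move=> x0 xy xz; rewrite /clip (max_l x0) (max_l (le_trans x0 xy)).
by rewrite (min_r xy) (min_l xz).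
Qed.

Lemma clip0 x y z : 0 <= z -> x <= 0 \/ y <= 0 -> clip x y z = 0.
Proof.
move=> z0 [h|h]; rewrite /clip (max_r h); first rewrite (@min_l _ _ 0); rewrite ?le_max ?lexx ?orbT //.
  by rewrite min_l ?mulr0.
by rewrite (@min_r _ _ _ 0) ?le_max ?lexx ?orbT // min_l ?mulr0.
Qed.

Lemma clip00 x y : clip x y 0 = 0.
Proof. by rewrite /clip min_r ?mulr0 // le_min !le_max !lexx !orbT. Qed.

Lemma clip_ge0 x y z : 0 <= z -> 0 <= clip x y z.
Proof. by move=> z0; rewrite mulr_ge0 // !le_min !le_max !lexx !orbT. Qed.

Lemma cont_clip (T : topologicalType) (x : T) (f g h : T -> R) : {for x, continuous f} ->
  {for x, continuous g} -> {for x, continuous h} -> {for x, continuous (fun t => clip (f t) (g t) (h t))}.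
Proof.
move=> cf cg ch; apply: contM; first exact: cont_cst.
by apply: cont_min => //; apply: cont_min; apply: cont_max => //; exact: cont_cst.
Qed.

(** The piecewise linear function that is 1 at the centre and 0 on the six sides of the hexagon: the
    minimum of their normalized distances, truncated at 0 outside. *)
Definition cen p : R := Num.max 0 (Num.min
  (Num.min (Num.min (3 * p ord0 0) (2 - 3 * p ord0 0))
           (Num.min (3 * p ord0 (0 + 1)) (2 - 3 * p ord0 (0 + 1))))
  (Num.min (3 * p ord0 (0 + 2%:R)) (2 - 3 * p ord0 (0 + 2%:R)))).

Lemma cenE p w i : 0 <= w -> (forall k, w <= 3 * p ord0 k /\ w <= 2 - 3 * p ord0 k) ->
  w = 3 * p ord0 i \/ w = 2 - 3 * p ord0 i -> cen p = w.
Proof.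
move=> w0 wk wi; apply/eqP; rewrite eq_le /cen ge_max w0 /= le_max; apply/andP; split; last first.
  by apply/orP; right; rewrite !le_min; have [-> ->] := wk 0; have [-> ->] := wk (0 + 1); have [-> ->] := wk (0 + 2%:R).
by rewrite !ge_min; move: i wi; apply: (@ord3P _ 0) => -[] <-; rewrite lexx ?orbT.
Qed.

Lemma cen0 p i : p ord0 i = 0 -> cen p = 0.
Proof.
move=> pi0; apply/eqP; rewrite eq_le /cen ge_max lexx /= le_max lexx andbT !ge_min.
by move: i pi0; apply: (@ord3P _ 0) => ->; rewrite mulr0 lexx ?orbT.
Qed.

Notation vtx := (option ('I_3 * 'I_3)).

Definition proper (v : vtx) := if v is Some (i, j) then i != j else true.

(** The piecewise linear function equal to 1 at one vertex of the subdivision and 0 at the others.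
    [None] is the centre, and [Some (i, j)] the vertex on side [i] next to corner [j]. The third
    index is [- i - j], since the labels sum to 0 in Z/3. Its coordinate in the minimum makes the
    function vanish on the two sides other than [i] in the whole simplex, also beyond the hexagon,
    as is needed to define it on the glued space. *)
Definition lam (v : vtx) p : R := if v is Some (i, j)
  then if i == j then 0 else clip (p ord0 j - 3^-1) (3^-1 - p ord0 i) (p ord0 (- i - j))
  else cen p.

Arguments lam : simpl never.

Definition pt (v : vtx) : 'rV[R]_3 := if v is Some (i, j)
  then \row_k (if k == i then 0 else if k == j then 2 / 3 else 1 / 3) else ctr R.

Lemma third1 j : - (j + 1) - j = j + 2%:R.
Proof. by case: j => -[|[|[|//]]] ?; apply/val_inj. Qed.
Lemma third2 j : - (j + 2%:R) - j = j + 1.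
Proof. by case: j => -[|[|[|//]]] ?; apply/val_inj. Qed.
Lemma third3 j : - j - (j + 1) = j + 2%:R.
Proof. by case: j => -[|[|[|//]]] ?; apply/val_inj. Qed.
Lemma third4 j : - j - (j + 2%:R) = j + 1.
Proof. by case: j => -[|[|[|//]]] ?; apply/val_inj. Qed.
Lemma third5 j : - (j + 1) - (j + 2%:R) = j.
Proof. by case: j => -[|[|[|//]]] ?; apply/val_inj. Qed.
Lemma third6 j : - (j + 2%:R) - (j + 1) = j.
Proof. by case: j => -[|[|[|//]]] ?; apply/val_inj. Qed.

Lemma vtxP (P : vtx -> Prop) j : P None ->
  P (Some (j + 1, j)) -> P (Some (j + 2%:R, j)) ->
  P (Some (j, j + 1)) -> P (Some (j, j + 2%:R)) ->
  P (Some (j + 1, j + 2%:R)) -> P (Some (j + 2%:R, j + 1)) -> forall v, proper v -> P v.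
Proof.
move=> P0 P1 P2 P3 P4 P5 P6 [[a b]|] //=.
by move: b; apply: (@ord3P _ j); move: a; apply: (@ord3P _ j); rewrite ?eqxx.
Qed.

(** Each of the six triangles consists of the centre and one side of the hexagon: the cut at corner
    [j] (flag true) or the middle third of side [j] (flag false). *)
Definition sector_vtx (t : bool * 'I_3) : vtx * vtx := if t.1
  then (Some (t.2 + 1, t.2), Some (t.2 + 2%:R, t.2))
  else (Some (t.2, t.2 + 1), Some (t.2, t.2 + 2%:R)).

Lemma cut_lam p j : hexagon p -> 3^-1 <= p ord0 j -> p ord0 (j + 1) <= 3^-1 ->
  p ord0 (j + 2%:R) <= 3^-1 ->
  [/\ lam None p = 2 - 3 * p ord0 j, lam (Some (j + 1, j)) p = 1 - 3 * p ord0 (j + 1),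
      lam (Some (j + 2%:R, j)) p = 1 - 3 * p ord0 (j + 2%:R) &
      forall v, v \notin [:: None; Some (j + 1, j); Some (j + 2%:R, j)] -> lam v p = 0].
Proof.
move=> [sp hp] h0 h1 h2; have S := simplex3_sum j sp.
have p0 := simplex_ge0 j sp; have p1 := simplex_ge0 (j + 1) sp.
have p2 := simplex_ge0 (j + 2%:R) sp; have h := hp j.
have n1 := ord3_add1 j; have n2 := ord3_add2 j; have n12 := ord3_add12 j.
split.
- rewrite /lam; apply: (@cenE _ _ j); [lra| |by right].
  by apply: (@ord3P _ j); lra.
- by rewrite /lam n1 third1 clip_r; lra.
- by rewrite /lam n2 third2 clip_r; lra.
move=> v; case E: (proper v); last first.
  by case: v E => [[a b]|] //= /negbFE/eqP ->; rewrite /lam eqxx.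
move: v E; apply: (@vtxP _ j); rewrite ?inE ?eqxx ?orbT // => _;
  rewrite /lam ?n1 ?n2 ?n12 1?[j == _]eq_sym ?n1 ?n2 1?[j + 2%:R == _]eq_sym ?n12.
- by rewrite third3 clip0 //; left; lra.
- by rewrite third4 clip0 //; left; lra.
- by rewrite third5 clip0 //; left; lra.
- by rewrite third6 clip0 //; left; lra.
Qed.

Lemma side_lam p j : hexagon p -> p ord0 j <= 3^-1 -> 3^-1 <= p ord0 (j + 1) ->
  3^-1 <= p ord0 (j + 2%:R) ->
  [/\ lam None p = 3 * p ord0 j, lam (Some (j, j + 1)) p = 3 * p ord0 (j + 1) - 1,
      lam (Some (j, j + 2%:R)) p = 3 * p ord0 (j + 2%:R) - 1 &
      forall v, v \notin [:: None; Some (j, j + 1); Some (j, j + 2%:R)] -> lam v p = 0].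
Proof.
move=> [sp hp] h0 h1 h2; have S := simplex3_sum j sp.
have p0 := simplex_ge0 j sp; have p1 := simplex_ge0 (j + 1) sp.
have p2 := simplex_ge0 (j + 2%:R) sp; have h := hp (j + 1); have h' := hp (j + 2%:R).
have n1 := ord3_add1 j; have n2 := ord3_add2 j; have n12 := ord3_add12 j.
have m1 : (j == j + 1) = false by rewrite eq_sym.
have m2 : (j == j + 2%:R) = false by rewrite eq_sym.
have m12 : (j + 2%:R == j + 1) = false by rewrite eq_sym.
split.
- rewrite /lam; apply: (@cenE _ _ j); [lra| |by left].
  by apply: (@ord3P _ j); lra.
- by rewrite /lam m1 third3 clip_l; lra.
- by rewrite /lam m2 third4 clip_l; lra.
move=> v; case E: (proper v); last first.
  by case: v E => [[a b]|] //= /negbFE/eqP ->; rewrite /lam eqxx.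
move: v E; apply: (@vtxP _ j); rewrite ?inE ?eqxx ?orbT // => _; rewrite /lam ?n1 ?n2 ?n12 ?m1 ?m2 ?m12.
- by rewrite third1 clip0 //; right; lra.
- by rewrite third2 clip0 //; right; lra.
- by rewrite third5 clip0 //; right; lra.
- by rewrite third6 clip0 //; right; lra.
Qed.

Lemma lam_ge0 v p : simplex 3 p -> 0 <= lam v p.
Proof.
move=> sp; case: v => [[i j]|]; last by rewrite /lam /cen le_max lexx.
by rewrite /lam; case: ifP => // _; rewrite clip_ge0 // simplex_ge0.
Qed.

Definition tri_vtx (t : bool * 'I_3) : seq vtx := [:: None; (sector_vtx t).1; (sector_vtx t).2].

Lemma ptE1 i j : pt (Some (i, j)) ord0 i = 0.
Proof. by rewrite mxE eqxx. Qed.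
Lemma sector_comb t (a b c : R) : let p := a *: pt None + b *: pt (sector_vtx t).1 + c *: pt (sector_vtx t).2 in
  [/\ p ord0 t.2 = if t.1 then a / 3 + 2 / 3 * (b + c) else a / 3,
      p ord0 (t.2 + 1) = if t.1 then (a + c) / 3 else (a + c) / 3 + b * (2 / 3) &
      p ord0 (t.2 + 2%:R) = if t.1 then (a + b) / 3 else (a + b) / 3 + c * (2 / 3)].
Proof.
have n1 := ord3_add1 t.2; have n2 := ord3_add2 t.2; have n12 := ord3_add12 t.2.
have m1 : (t.2 == t.2 + 1) = false by rewrite eq_sym.
have m2 : (t.2 == t.2 + 2%:R) = false by rewrite eq_sym.
have m12 : (t.2 + 2%:R == t.2 + 1) = false by rewrite eq_sym.
rewrite /=; case: t n1 n2 n12 m1 m2 m12 => -[] j /= n1 n2 n12 m1 m2 m12;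
  rewrite !vecE !mxE ?eqxx ?n1 ?n2 ?n12 ?m1 ?m2 ?m12; split; lra.
Qed.

Lemma lam_comb t (a b c : R) : 0 <= a -> 0 <= b -> 0 <= c -> a + b + c = 1 ->
  let p := a *: pt None + b *: pt (sector_vtx t).1 + c *: pt (sector_vtx t).2 in
  [/\ hexagon p, lam None p = a, lam (sector_vtx t).1 p = b, lam (sector_vtx t).2 p = c &
      forall v, v \notin tri_vtx t -> lam v p = 0].
Proof.
move=> a0 b0 c0 s p; have [p0 p1 p2] := sector_comb t a b c; rewrite -/p in p0 p1 p2.
clearbody p; case: t p0 p1 p2 => -[] j /= p0 p1 p2.
  have hp : hexagon p.
    split; last by apply: (@ord3P _ j); rewrite ?p0 ?p1 ?p2; lra.
    by split; [apply: (@ord3P _ j); rewrite ?p0 ?p1 ?p2; lra|rewrite (sum3 _ j) p0 p1 p2; lra].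
  by have [|||-> -> -> H] := @cut_lam p j hp; rewrite ?p0 ?p1 ?p2; try (by lra); split=> //; lra.
have hp : hexagon p.
  split; last by apply: (@ord3P _ j); rewrite ?p0 ?p1 ?p2; lra.
  by split; [apply: (@ord3P _ j); rewrite ?p0 ?p1 ?p2; lra|rewrite (sum3 _ j) p0 p1 p2; lra].
by have [|||-> -> -> H] := @side_lam p j hp; rewrite ?p0 ?p1 ?p2; try (by lra); split=> //; lra.
Qed.

Lemma lam_decomp p : hexagon p -> exists t,
  [/\ forall v, v \notin tri_vtx t -> lam v p = 0,
      lam None p + lam (sector_vtx t).1 p + lam (sector_vtx t).2 p = 1 &
      p = lam None p *: pt None + lam (sector_vtx t).1 p *: pt (sector_vtx t).1 +
          lam (sector_vtx t).2 p *: pt (sector_vtx t).2].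
Proof.
move=> hp; have [sp _] := hp.
have cut j : 3^-1 <= p ord0 j -> p ord0 (j + 1) <= 3^-1 -> p ord0 (j + 2%:R) <= 3^-1 -> exists t,
  [/\ forall v, v \notin tri_vtx t -> lam v p = 0,
      lam None p + lam (sector_vtx t).1 p + lam (sector_vtx t).2 p = 1 &
      p = lam None p *: pt None + lam (sector_vtx t).1 p *: pt (sector_vtx t).1 +
          lam (sector_vtx t).2 p *: pt (sector_vtx t).2].
  move=> h0 h1 h2; have S := simplex3_sum j sp; exists (true, j).
  have [/= -> -> -> H] := cut_lam hp h0 h1 h2; split=> //; first by lra.
  have [/= q0 q1 q2] := sector_comb (true, j) (2 - 3 * p ord0 j) (1 - 3 * p ord0 (j + 1)) (1 - 3 * p ord0 (j + 2%:R)).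
  by apply: (@row3P _ j); rewrite ?q0 ?q1 ?q2; lra.
have side j : p ord0 j <= 3^-1 -> 3^-1 <= p ord0 (j + 1) -> 3^-1 <= p ord0 (j + 2%:R) -> exists t,
  [/\ forall v, v \notin tri_vtx t -> lam v p = 0,
      lam None p + lam (sector_vtx t).1 p + lam (sector_vtx t).2 p = 1 &
      p = lam None p *: pt None + lam (sector_vtx t).1 p *: pt (sector_vtx t).1 +
          lam (sector_vtx t).2 p *: pt (sector_vtx t).2].
  move=> h0 h1 h2; have S := simplex3_sum j sp; exists (false, j).
  have [/= -> -> -> H] := side_lam hp h0 h1 h2; split=> //; first by lra.
  have [/= q0 q1 q2] := sector_comb (false, j) (3 * p ord0 j) (3 * p ord0 (j + 1) - 1) (3 * p ord0 (j + 2%:R) - 1).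
  by apply: (@row3P _ j); rewrite ?q0 ?q1 ?q2; lra.
have S := simplex3_sum 0 sp.
(* The lines on which a coordinate is 1/3 pass through the centre and cut the hexagon into the six
   triangles. One coordinate above 1/3 means a cut, two mean a side. *)
have [h0|h0] := leP (p ord0 0) 3^-1; have [h1|h1] := leP (p ord0 (0 + 1)) 3^-1;
  have [h2|h2] := leP (p ord0 (0 + 2%:R)) 3^-1.
- by apply: (cut 0) => //; lra.
- by apply: (cut (0 + 2%:R)); rewrite ?ord3_21 ?ord3_22 // ltW.
- by apply: (cut (0 + 1)); rewrite ?ord3_11 ?ord3_12 // ltW.
- by apply: (side 0) => //; apply: ltW.
- by apply: (cut 0) => //; apply: ltW.
- by apply: (side (0 + 1)); rewrite ?ord3_11 ?ord3_12 //; apply: ltW.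
- by apply: (side (0 + 2%:R)); rewrite ?ord3_21 ?ord3_22 //; apply: ltW.
by exfalso; lra.
Qed.

Lemma sum_tri_vtx (V : zmodType) (F : vtx -> V) t : (forall v, v \notin tri_vtx t -> F v = 0) ->
  \sum_v F v = F None + F (sector_vtx t).1 + F (sector_vtx t).2.
Proof.
move=> H; have n1 := ord3_add1 t.2; have n2 := ord3_add2 t.2; have n12 := ord3_add12 t.2.
rewrite (bigD1 None) //= (bigD1 (sector_vtx t).1) /=; last by rewrite /sector_vtx; case: t.1.
rewrite (bigD1 (sector_vtx t).2) /=; last first.
  rewrite /sector_vtx; case: t.1 => /=; rewrite eqE /= xpair_eqE ?eqxx ?andbT /=.
    by rewrite eq_sym n12.
  by rewrite eq_sym n12.
rewrite big1 ?addr0 ?addrA // => v /andP[/andP[/= v0 v1] v2].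
by apply: H; rewrite !inE !negb_or v0 v1.
Qed.

Lemma lam_inj p q : hexagon p -> hexagon q -> (forall v, lam v p = lam v q) -> p = q.
Proof.
have rec r : hexagon r -> r = \sum_v lam v r *: pt v.
  move=> hr; have [t [H _ E]] := lam_decomp hr.
  by rewrite {1}E (sum_tri_vtx (F := fun v => lam v r *: pt v) (t := t)) // => v /H ->; rewrite scale0r.
move=> /rec Ep /rec Eq E; rewrite Ep Eq.
by apply: eq_bigr => v _; rewrite E.
Qed.

Lemma lam_continuous v : continuous (lam v).
Proof.
have c i : continuous (fun p : 'rV[R]_3 => p ord0 i) by exact: coord_continuous.
have ca (a b : R) i (p : 'rV[R]_3) : {for p, continuous (fun p : 'rV[R]_3 => a + b * p ord0 i)}.
  by apply: contD; [exact: cont_cst|apply: contM; [exact: cont_cst|exact: c]].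
case: v => [[i j]|] p.
  case ij: (i == j); first by rewrite (_ : lam _ = fun=> 0); [exact: cst_continuous|apply/funext => q; rewrite /lam ij].
  suff : {for p, continuous (fun p : 'rV[R]_3 => clip (p ord0 j - 3^-1) (3^-1 - p ord0 i) (p ord0 (- i - j)))}.
    by rewrite /lam ij.
  apply: cont_clip; last exact: c.
    by apply: contB; [exact: c|exact: cont_cst].
  by apply: contB; [exact: cont_cst|exact: c].
have c3 i : {for p, continuous (fun p : 'rV[R]_3 => 3 * p ord0 i)}.
  by apply: contM; [exact: cont_cst|exact: c].
have c2 i : {for p, continuous (fun p : 'rV[R]_3 => 2 - 3 * p ord0 i)}.
  by apply: contB; [exact: cont_cst|exact: c3].
suff : {for p, continuous (@cen)} by [].
rewrite /cen; apply: cont_max; first exact: cont_cst.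
by do !apply: cont_min; first [exact: c3|exact: c2].
Qed.

End HexagonCoordinates.
Arguments lam : simpl never.

(** * A simplicial complex homeomorphic to the region *)

Section RegionComplex.
Variables (R : realType) (G : choiceType) (X : topologicalType)
  (adj : 'I_3 -> G -> G) (tri : G -> 'rV[R]_3 -> X) (par : G -> bool) (m : 'I_3 -> nat).
Hypotheses (gl : gluing adj tri) (tg : triangle_group adj par m).
Variable Om : {fset G}.
Implicit Types (g h : Om) (p q : 'rV[R]_3) (i j k : 'I_3).
Notation vtx := (option ('I_3 * 'I_3)).
Implicit Types v : vtx.

Let adjK := gluing_adjK gl.

Lemma adj_neq i k (g : G) : i != k -> adj i g != adj k g.
Proof.
have H j (a : G) : adj (j + 1) a != adj (j + 2%:R) a.
  apply/eqP => E; have := (cyc_adj tg j 1 a).1 => /=; rewrite E adjK => /(_ erefl).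
  by rewrite dvdn1 => /eqP E1; have := m_gt1 tg j; rewrite E1.
have H' j (a : G) : adj j a != adj (j + 1) a.
  by have := H (j + 2%:R) a; rewrite ord3_21 ord3_22.
rewrite ord3_neq => /orP[] /eqP ->; first by rewrite eq_sym H'.
by have := H' (k + 2%:R) g; rewrite ord3_21.
Qed.

(** Names a side by one of its triangles in the region: the one with [par] true if both belong to
    it. The vertices on a shared side thereby receive one name. *)
Definition srep i g : Om := if (adj i (val g) \in Om) && ~~ par (val g) then nbr adj i g else g.

Lemma srepE i g : srep i g = g \/ val (srep i g) = adj i (val g).
Proof. by rewrite /srep; case: ifPn => [/andP[gO _]|_]; [right; rewrite nbrE|left]. Qed.

Lemma srep_adj i g h : val h = adj i (val g) -> srep i h = srep i g.
Proof.
move=> hg; rewrite /srep hg adjK (par_adj tg) negbK fsvalP /=.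
have -> : adj i (val g) \in Om by rewrite -hg fsvalP.
rewrite /=; case: (par (val g)) => //=; apply: val_inj; last by rewrite hg nbrE // -hg fsvalP.
by rewrite nbrE hg adjK // fsvalP.
Qed.

Lemma srep_idem i g : srep i (srep i g) = srep i g.
Proof. by have [E|/srep_adj //] := srepE i g; rewrite !E. Qed.

Lemma srep_eq i g h : srep i g = srep i h <-> h = g \/ val h = adj i (val g).
Proof.
split=> [|[->|/srep_adj ->]] // E.
have [Eg|Eg] := srepE i g; have [Eh|Eh] := srepE i h.
- by left; rewrite -Eh -E Eg.
- by right; rewrite -Eg E Eh adjK.
- by right; rewrite -Eg E Eh.
by left; apply: val_inj; apply: (can_inj (adjK i)); rewrite -Eh -E Eg.
Qed.

Definition VT : finType := (Om * vtx)%type.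

Definition vid g v : VT := if v is Some (i, j) then (srep i g, v) else (g, v).

Lemma vid2 g v : (vid g v).2 = v. Proof. by case: v => [[i j]|]. Qed.

Lemma vid_inj g h v w : vid g v = vid h w -> v = w.
Proof. by move=> /(congr1 snd); rewrite !vid2. Qed.

Definition phi (w : VT) (h : G) p : R :=
  let: (g, v) := w in
  if v is Some (i, j) then
    if (srep i g == g) && ((h == val g) || (h == adj i (val g))) then lam v p else 0
  else if h == val g then lam v p else 0.

Lemma lam0 i j l p : simplex 3 p -> l != i -> p ord0 l = 0 -> lam (Some (i, j)) p = 0.
Proof.
move=> sp li pl; rewrite /lam; case: ifPn => // ij.
have [lj|lj] := eqVneq l j.
  by rewrite clip0 ?simplex_ge0 // -lj pl; left; lra.
suff -> : - i - j = l by rewrite pl clip00.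
by move: i j l li lj ij {pl}; do 3![case=> -[|[|[|//]]] ?] => // _ _ _; apply/val_inj.
Qed.

(** Crossing side [i] exchanges the two triangles on which a vertex of that side is supported; on
    any other side its function vanishes. *)
Lemma phi_adj w (h : G) p l : simplex 3 p -> p ord0 l = 0 -> phi w (adj l h) p = phi w h p.
Proof.
move=> sp pl; case: w => g [[i j]|] /=; last by rewrite /lam (cen0 pl) !if_same.
have [li|li] := eqVneq l i; last by rewrite (lam0 _ sp li pl) !if_same.
rewrite {}li; case: (srep i g == g) => //=; congr (if _ then _ else _).
by rewrite -(inj_eq (can_inj (adjK i)) h) (can2_eq (adjK i) (adjK i)) orbC; congr (_ || _); rewrite -(inj_eq (can_inj (adjK i))) adjK.
Qed.

(** The list of all vertex functions; restricted to the region it is the homeomorphism onto the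
    realization. *)
Definition Lam (x : X) : 'rV[R]_#|VT| := \row_a descend gl (phi (enum_val a)) x.

Lemma LamE g p w : simplex 3 p -> Lam (tri (val g) p) ord0 (enum_rank w) =
  if w == vid g w.2 then lam w.2 p else 0.
Proof.
move=> sp; rewrite mxE enum_rankK descendE //; last first.
  by move=> h q l sq ql; exact: phi_adj.
case: w => h [[i j]|] /=; last by rewrite xpair_eqE eqxx andbT eq_sym.
rewrite xpair_eqE eqxx andbT; congr (if _ then _ else _).
apply/andP/eqP => [[/eqP E /orP[] /eqP gh]|->].
- by rewrite (val_inj gh : g = h).
- by rewrite -E; apply/esym/srep_adj.
split; first by rewrite srep_idem.
by have [->|->] := srepE i g; rewrite ?eqxx // adjK eqxx orbT.
Qed.

Lemma Lam_vid g p v : simplex 3 p -> Lam (tri (val g) p) ord0 (enum_rank (vid g v)) = lam v p.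
Proof. by move=> sp; rewrite LamE // vid2 eqxx. Qed.

Lemma Lam_neq0 g p a : simplex 3 p -> Lam (tri (val g) p) ord0 a != 0 ->
  exists v, enum_val a = vid g v /\ lam v p != 0.
Proof.
move=> sp; rewrite -{1}(enum_valK a) LamE //; case: ifP => [/eqP E ne|_]; last by rewrite eqxx.
by exists (enum_val a).2; split.
Qed.

Lemma Lam_continuous : continuous Lam.
Proof.
apply: continuous_rV => a; rewrite (_ : (fun x => _) = descend gl (phi (enum_val a))); last first.
  by apply/funext => x; rewrite mxE.
set w := enum_val a => x.
have adjw (g : G) p i : simplex 3 p -> p ord0 i = 0 -> phi w (adj i g) p = phi w g p by exact: phi_adj.
apply: (@continuous_at_tri _ _ _ _ _ gl _ _ setT openT _ x (in_setT _)) => h p sp _ V.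
rewrite descendE // => fV.
have c : {for p, continuous (phi w h)}.
  have H (c : bool) v : {for p, continuous (fun p => if c then lam v p else 0)}.
    by case: c; [exact: lam_continuous|exact: cont_cst].
  by rewrite /phi; case: w {adjw fV} => g [[i j]|]; exact: H.
have H : \forall q \near p, V (phi w h q) := c _ fV.
by apply: filterS H => q Vq sq; rewrite descendE.
Qed.

(** A vertex with nonzero coordinate in two different triangles lies on a side that they share, and
    this side is unique. All vertices carrying the point then lie on it, so the point does too, and
    there the two triangles are glued. *)
Lemma Lam_inj g h p q : hexagon p -> hexagon q -> Lam (tri (val g) p) = Lam (tri (val h) q) ->
  tri (val g) p = tri (val h) q.
Proof.
move=> hp hq E; have [sp _] := hp; have [sq _] := hq.
have Ea w : Lam (tri (val g) p) ord0 (enum_rank w) = Lam (tri (val h) q) ord0 (enum_rank w) by rewrite E.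
have [gh|gh] := eqVneq g h.
  subst h; congr (tri _ _); apply: lam_inj => // v.
  by rewrite -(Lam_vid g v sp) Ea Lam_vid.
have key (g1 g2 : Om) r s v : simplex 3 r -> simplex 3 s -> g1 != g2 ->
    (forall w, Lam (tri (val g1) r) ord0 (enum_rank w) = Lam (tri (val g2) s) ord0 (enum_rank w)) ->
    lam v r != 0 -> exists i j, v = Some (i, j) /\ val g2 = adj i (val g1).
  move=> sr ss g12 E12 vr.
  have := vr; rewrite -(Lam_vid g1 v sr) E12 => /(Lam_neq0 ss) [v' []].
  rewrite enum_rankK => /[dup] /vid_inj <- {v'} E' _.
  case: v vr E' => [[i j]|] _ /=; last by case=> E'; move: g12; rewrite E' eqxx.
  by case=> /srep_eq [E'|->]; [move: g12; rewrite E' eqxx|exists i, j].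
have [t [H S1 _]] := lam_decomp hp.
have [v0 v0p] : exists v, lam v p != 0.
  apply: contrapT => /forallNP nz; move: S1.
  have z v : lam v p = 0 by apply/eqP/negPn/negP/nz.
  by rewrite !z !addr0 => /eqP; rewrite eq_sym oner_eq0.
have [i [j0 [_ hg]]] := key _ _ _ _ _ sp sq gh Ea v0p.
have suppp v : lam v p != 0 -> exists j, v = Some (i, j).
  move=> /(key _ _ _ _ _ sp sq gh Ea) [i' [j [-> hg']]].
  have [->|ii] := eqVneq i i'; first by exists j.
  by have := adj_neq (val g) ii; rewrite -hg -hg' eqxx.
have suppq v : lam v q != 0 -> exists j, v = Some (i, j).
  have Ea' w : Lam (tri (val h) q) ord0 (enum_rank w) = Lam (tri (val g) p) ord0 (enum_rank w) by rewrite E.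
  have hgn : h != g by rewrite eq_sym.
  move=> /(key _ _ _ _ _ sq sp hgn Ea') [i' [j [-> hg']]].
  have [->|ii] := eqVneq i i'; first by exists j.
  by have := adj_neq (val h) ii; rewrite -hg' {1}hg adjK eqxx.
have pq : p = q.
  apply: lam_inj => // v; have [vp|vp] := eqVneq (lam v p) 0.
    have [->|/[dup] vq /suppq [j vE]] := eqVneq (lam v q) 0; first exact: vp.
    exfalso; move/negP: vq; apply; apply/eqP; rewrite -[RHS]vp -(Lam_vid h v sq) -Ea -(Lam_vid g v sp).
    by congr (Lam _ _ (enum_rank _)); rewrite vE /= (srep_adj hg).
  have [j vE] := suppp _ vp.
  rewrite -(Lam_vid g v sp) Ea -(Lam_vid h v sq); congr (Lam _ _ (enum_rank _)).
  by rewrite vE /= (srep_adj hg).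
rewrite -pq hg tri_adj //.
have [t' [_ _ ->]] := lam_decomp hp.
have T v : (lam v p *: pt R v) ord0 i = 0.
  rewrite vecE; have [->|/suppp [j ->]] := eqVneq (lam v p) 0; first by rewrite mul0r.
  by rewrite ptE1 mulr0.
by rewrite !vaddE !T !addr0.
Qed.

Definition tset g t : {set 'I_#|VT|} :=
  [set enum_rank (vid g None); enum_rank (vid g (sector_vtx t).1); enum_rank (vid g (sector_vtx t).2)]%SET.

Definition complexK : {set {set 'I_#|VT|}} :=
  [set s : {set 'I_#|VT|} | (s != finset.set0) && [exists gt : Om * (bool * 'I_3), s \subset tset gt.1 gt.2]]%SET.

Lemma complexK_is_complex : is_complex complexK.
Proof.
split; first by rewrite inE eqxx.
move=> s t; rewrite !inE => /andP[_ /existsP[gt sg]] ts ->.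
by apply/existsP; exists gt; exact: fintype.subset_trans ts sg.
Qed.

Lemma vid_tset g t v : (enum_rank (vid g v) \in tset g t) = (v \in tri_vtx t).
Proof.
have E w : (enum_rank (vid g v) == enum_rank (vid g w)) = (v == w).
  rewrite (inj_eq enum_rank_inj); apply/eqP/eqP => [/vid_inj|->] //.
by rewrite !finset.in_setU !finset.in_set1 !E !inE -orbA.
Qed.

Lemma sum_tset g t (F : 'I_#|VT| -> R) : (forall a, a \notin tset g t -> F a = 0) ->
  \sum_a F a = F (enum_rank (vid g None)) + F (enum_rank (vid g (sector_vtx t).1)) +
               F (enum_rank (vid g (sector_vtx t).2)).
Proof.
move=> H; have -> : \sum_a F a = \sum_v F (enum_rank (vid g v)).
  rewrite (bigID [pred a | a \in [set enum_rank (vid g v) | v : vtx]%SET]) /= addrC big1 ?add0r.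
    rewrite (eq_bigl (fun a => a \in [set enum_rank (vid g v) | v : vtx]%SET)); last by [].
    rewrite big_imset /=; last by move=> v w _ _ /enum_rank_inj/vid_inj.
    exact: eq_bigl.
  move=> a /negP na; apply: H; apply/negP; rewrite !finset.in_setU !finset.in_set1 => ha.
  by apply: na; case/orP: ha => [/orP[]|] /eqP ->; exact: imset_f.
rewrite (sum_tri_vtx (t := t)) // => v vt; apply: H; by rewrite vid_tset.
Qed.

Lemma Lam_image : Lam @` region tri Om = realization complexK.
Proof.
apply/seteqP; split=> [_ [_ [g0 /= gO [p hp <-]] <-]|q [sq]].
  pose g : Om := FSetSub gO; rewrite -[g0]/(val g).
  have [sp _] := hp; have [t [H S1 _]] := lam_decomp hp.
  have N a : a \notin tset g t -> Lam (tri (val g) p) ord0 a = 0.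
    apply: contraNeq => /(Lam_neq0 sp) [v [E vp]]; rewrite -(enum_valK a) E vid_tset.
    by apply: contraNT vp => /H ->.
  have S : \sum_a Lam (tri (val g) p) ord0 a = 1.
    by rewrite (sum_tset N) !(Lam_vid _ _ sp).
  split; first split=> // a.
    rewrite -(enum_valK a) LamE //; case: ifP => // _; exact: lam_ge0.
  rewrite inE; apply/andP; split; last first.
    apply/existsP; exists (g, t); apply/fintype.subsetP => a; rewrite inE.
    by apply: contraNT => /N ->; exact: eqxx.
  apply/set0Pn; apply: contrapT => nz; move: S; rewrite big1 => [/eqP|a _].
    by rewrite eq_sym oner_eq0.
  by apply/eqP/negPn/negP => ne; apply: nz; exists a; rewrite inE.
rewrite inE => /andP[_ /existsP[[g t] /= /fintype.subsetP sub]].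
have N a : a \notin tset g t -> q ord0 a = 0.
  by apply: contraNeq => ne; apply: sub; rewrite inE.
have [q0 q1] := sq; rewrite (sum_tset N) in q1.
have [hp l0 l1 l2 H] := lam_comb t (q0 _) (q0 _) (q0 _) q1; set p := _ + _ in hp l0 l1 l2 H.
have [sp _] := hp.
exists (tri (val g) p); first by exists (val g); [exact: fsvalP|exists p].
apply/rowP => a; have [aT|/[dup] aT /N ->] := boolP (a \in tset g t).
  move: aT; rewrite !finset.in_setU !finset.in_set1 => /orP[/orP[]|] /eqP ->; by rewrite (Lam_vid _ _ sp).
apply/eqP; apply: contraNT aT => /(Lam_neq0 sp) [v [E vp]].
by rewrite -(enum_valK a) E vid_tset; apply: contraNT vp => /H ->.
Qed.

Lemma region_euler_char : hausdorff_space X -> region tri Om !=set0 ->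
  has_euler_char R (region tri Om) (complex_euler_char complexK).
Proof.
move=> hX [x0 Ax0]; exists #|VT|, complexK; split=> //; first exact: complexK_is_complex.
pose f (y : 'rV[R]_#|VT|) := xget x0 [set x | region tri Om x /\ Lam x = y].
have fK x : region tri Om x -> f (Lam x) = x.
  move=> Ax; have [] : region tri Om (f (Lam x)) /\ Lam (f (Lam x)) = Lam x by exact: (@xgetI _ x0 [set x' | region tri Om x' /\ Lam x' = Lam x] x (conj Ax erefl)).
  move: Ax => [g0 /= gO [p hp <-]] [h0 /= hO [q hq <-]].
  exact: (@Lam_inj (FSetSub hO) (FSetSub gO)).
have fA y : realization complexK y -> region tri Om (f y) /\ Lam (f y) = y.
  by rewrite -Lam_image => -[x Ax <-]; rewrite fK.
exists f, Lam; split.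
- rewrite -Lam_image; apply: compact_inverse_continuous => //.
  + exact: (region_compact gl).
  + by apply: continuous_subspaceT; exact: Lam_continuous.
- by apply: continuous_subspaceT; exact: Lam_continuous.
- by move=> _ [y /fA [fy _] <-].
- by rewrite Lam_image.
by split=> [y /fA []|x]; [|exact: fK].
Qed.

End RegionComplex.

Lemma set2_eq (T : finType) (x y x' y' : T) : [set x; y]%SET = [set x'; y']%SET ->
  (x = x' /\ y = y') \/ (x = y' /\ y = x').
Proof.
move=> E.
have : x \in [set x'; y']%SET by rewrite -E finset.in_set2 eqxx.
have : y \in [set x'; y']%SET by rewrite -E finset.in_set2 eqxx orbT.
have : x' \in [set x; y]%SET by rewrite E finset.in_set2 eqxx.
have : y' \in [set x; y]%SET by rewrite E finset.in_set2 eqxx orbT.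
rewrite !finset.in_set2.
by move=> /orP[] /eqP h1 /orP[] /eqP h2 /orP[] /eqP h3 /orP[] /eqP h4; subst; auto.
Qed.

(** * Counting simplices and boundary curves *)

Section RegionCounts.
Variables (R : realType) (G : choiceType) (X : topologicalType)
  (adj : 'I_3 -> G -> G) (tri : G -> 'rV[R]_3 -> X) (par : G -> bool) (m : 'I_3 -> nat).
Hypotheses (gl : gluing adj tri) (tg : triangle_group adj par m).
Let adjK := gluing_adjK gl.
Variable Om : {fset G}.
Implicit Types (g h : Om) (i j k : 'I_3).
Notation vtx := (option ('I_3 * 'I_3)).
Implicit Types v : vtx.

Let pairs : finType := (Om * 'I_3)%type.

Definition boundary_sides : {set pairs} := [set x : pairs | adj x.2 (val x.1) \notin Om]%SET.

Let bd := #|boundary_sides|.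
Let rp := @srep _ adj par Om.
Let vid := @vid _ adj par Om.
Let vt := VT Om.
Let K := @complexK _ adj par Om.

Let sides : {set pairs} := [set x : pairs | rp x.2 x.1 == x.1]%SET.

(** Inner sides are represented by their triangle of parity true. Crossing them injects these into
    the inner sides seen from parity false, so they make up at most half of the 3n - b inner
    incidences, for n triangles and b boundary sides. *)
Lemma card_sides : (2 * #|sides| <= 3 * #|{: Om}| + bd)%N.
Proof.
pose I := ~: boundary_sides.
pose Ip := [set x in I | par (val x.1)]%SET; pose In := [set x in I | ~~ par (val x.1)]%SET.
have c1 : (#|sides| <= bd + #|Ip|)%N.
  apply: leq_trans (leq_card_setU boundary_sides Ip).1; apply: subset_leq_card.
  apply/fintype.subsetP => x; rewrite !inE /rp /srep; case: ifPn; last first.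
    by rewrite negb_and negbK => /orP[->|->] // _; case: (_ \in Om).
  move=> /andP[xO px] /eqP E; have := nbrE xO; rewrite E => /(congr1 par).
  by rewrite (par_adj tg) => h; move: px; rewrite -h; case: (par _) h.
have c2 : (#|Ip| <= #|In|)%N.
  pose f (x : pairs) : pairs := (nbr adj x.2 x.1, x.2).
  have fE x : x \in Ip -> val (f x).1 = adj x.2 (val x.1).
    by rewrite !inE negbK => /andP[xO _]; rewrite nbrE.
  rewrite -(card_in_imset (f := f)).
    apply: subset_leq_card; apply/fintype.subsetP => _ /imsetP[x /[dup] xI /fE E ->].
    rewrite !inE E adjK fsvalP (par_adj tg) negbK.
    by move: xI; rewrite !inE => /andP[_ ->].
  move=> x y /fE Ex /fE Ey E; move: (congr1 val (congr1 fst E)) (congr1 snd E).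
  rewrite Ex Ey /=; case: x y {E Ex Ey} => [x i] [y j] /= E ij.
  by move: E; rewrite ij => /(can_inj (adjK j))/val_inj ->.
have c3 : (bd + (#|Ip| + #|In|) = 3 * #|{: Om}|)%N.
  have -> : (3 * #|{: Om}| = #|{: pairs}|)%N by rewrite card_prod card_ord mulnC.
  rewrite -(cardsC boundary_sides); congr (_ + _)%N.
  rewrite -(cardsID [set x : pairs | par (val x.1)]%SET I); congr (_ + _)%N; apply: eq_card => x.
    by rewrite !inE.
  by rewrite !inE andbC.
lia.
Qed.

Let ek (w : vt) : 'I_#|vt| := enum_rank w.

Lemma tset_vid (s : {set 'I_#|vt|}) : s \in K -> exists g t, s \subset tset adj par g t.
Proof. by rewrite inE => /andP[_ /existsP[[g t] sub]]; exists g, t. Qed.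

Lemma in_tset g t a : a \in tset adj par g t -> exists2 v, proper v & enum_val a = vid g v.
Proof.
rewrite !finset.in_setU !finset.in_set1 => /orP[/orP[]|] /eqP ->; rewrite enum_rankK.
- by exists None.
- by exists (sector_vtx t).1 => //; case: t => -[] j; rewrite /= ?ord3_add1 // eq_sym ord3_add1.
by exists (sector_vtx t).2 => //; case: t => -[] j; rewrite /= ?ord3_add2 // eq_sym ord3_add2.
Qed.

Lemma card_tset g t : (#|tset adj par g t| <= 3)%N.
Proof.
apply: leq_trans (leq_card_setU _ _).1 _; rewrite cards1 addn1 ltnS.
by rewrite cards2; case: (_ != _).
Qed.

Lemma card_K1 : (#|[set s in K | #|s| == 1%N]%SET| <= #|{: Om}| + 2 * #|sides|)%N.
Proof.
pose f1 (g : Om) : {set 'I_#|vt|} := [set ek (g, None)]%SET.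
pose D2 := [set x : pairs * bool | x.1 \in sides]%SET.
pose f2 (x : pairs * bool) : {set 'I_#|vt|} :=
  [set ek (x.1.1, Some (x.1.2, x.1.2 + (if x.2 then 1 else 2%:R)))]%SET.
have sub : [set s in K | #|s| == 1%N]%SET \subset (f1 @: [set: Om]%SET) :|: (f2 @: D2).
  apply/fintype.subsetP => s; rewrite inE => /andP[/tset_vid [g [t /fintype.subsetP st]]] /cards1P[a sa].
  have := st a; rewrite sa finset.in_set1 eqxx => /(_ isT) /in_tset [[[i j]|] pv E].
    rewrite inE; apply/orP; right; apply/imsetP; move: pv => /=; rewrite eq_sym ord3_neq => ij.
    exists ((rp i g, i), j == i + 1).
      by rewrite !inE /= /rp (srep_idem gl tg).
    rewrite /f2 /= /ek -[in LHS](enum_valK a) E /=; congr [set _]%SET; congr enum_rank; congr (_, Some (_, _)).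
    by case/orP: ij => /eqP ->; rewrite ?eqxx // eq_sym ord3_add12.
  rewrite inE; apply/orP; left; apply/imsetP; exists g => //.
  by rewrite /f1 /ek -[in LHS](enum_valK a) E.
apply: leq_trans (subset_leq_card sub) _; apply: leq_trans (leq_card_setU _ _).1 _.
apply: leq_add; first by apply: leq_trans (leq_imset_card _ _) _; rewrite cardsT.
apply: leq_trans (leq_imset_card _ _) _.
have -> : D2 = finset.setX sides [set: bool]%SET by apply/setP => -[x b]; rewrite !inE andbT.
by rewrite cardsX cardsT card_bool mulnC.
Qed.

Lemma card_K3 : (#|[set s in K | #|s| == 3%N]%SET| <= 6 * #|{: Om}|)%N.
Proof.
pose f (x : Om * (bool * 'I_3)) := tset adj par x.1 x.2.
have sub : [set s in K | #|s| == 3%N]%SET \subset f @: [set: Om * (bool * 'I_3)]%SET.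
  apply/fintype.subsetP => s; rewrite inE => /andP[/tset_vid [g [t st]]] /eqP s3.
  apply/imsetP; exists (g, t) => //; have := finset.eqEcard s (f (g, t)); by rewrite st s3 card_tset andTb => /eqP.
apply: leq_trans (subset_leq_card sub) _; apply: leq_trans (leq_imset_card _ _) _.
by rewrite cardsT !card_prod card_bool card_ord mulnC.
Qed.

Lemma card_K2 : (9 * #|{: Om}| + #|sides| <= #|[set s in K | #|s| == 2%N]%SET|)%N.
Proof.
(* The six spokes and the three cuts of each hexagon, and one middle third for each represented
   side. *)
pose D : finType := ((pairs * bool) + pairs + pairs)%type.
pose dom : {set D} := [set d : D | if d is inr x then x \in sides else true]%SET.
pose ends (d : D) : vt * vt := match d with
  | inl (inl (g, j, b)) => (vid g None, vid g (Some (j, j + (if b then 1 else 2%:R))))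
  | inl (inr (g, j)) => (vid g (Some (j + 1, j)), vid g (Some (j + 2%:R, j)))
  | inr (g, i) => (vid g (Some (i, i + 1)), vid g (Some (i, i + 2%:R))) end.
pose f d : {set 'I_#|vt|} := [set ek (ends d).1; ek (ends d).2]%SET.
have n1 := ord3_add1; have n2 := ord3_add2; have n12 := ord3_add12.
have m1 j : (j == j + 1) = false by rewrite eq_sym.
have m2 j : (j == j + 2%:R) = false by rewrite eq_sym.
have J (a b c d' : 'I_3) : Some (a, b) = Some (c, d') -> a = c /\ b = d' by case.
have finj : {in dom &, injective f}.
  (* Two different triangles cannot share both sides, because the rotation about corner [j] has
     order above 1. *)
  have S g h j : rp (j + 1) g = rp (j + 1) h -> rp (j + 2%:R) g = rp (j + 2%:R) h -> g = h.
    move=> /(srep_eq gl tg) [-> //|h1] /(srep_eq gl tg) [-> //|h2].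
    have := @adj_neq _ _ _ _ _ _ _ gl tg (j + 1) (j + 2%:R) (val g).
    by rewrite n12 -h1 -h2 eqxx => /(_ isT).
  move=> d d'; rewrite !inE => dd dd' /set2_eq [] [] /enum_rank_inj E1 /enum_rank_inj E2.
    case: d d' dd dd' E1 E2 => [[[[g j] b]|[g j]]|[g j]] [[[[g' j'] b']|[g' j']]|[g' j']] //= dd dd' E1 E2.
    - have [jj] := J _ _ _ _ (congr1 snd E2); subst j'.
      move: E1 => [->]; case: b b' {E2} => -[] // /addrI /eqP; by rewrite ?[2%:R == _]eq_sym.
    - have [_ jj] := J _ _ _ _ (congr1 snd E1); subst j'.
      by move: E1 E2 => [E1] [E2]; rewrite (S _ _ _ E1 E2).
    - have [e1 e2] := J _ _ _ _ (congr1 snd E1); have [e3 _] := J _ _ _ _ (congr1 snd E2).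
      by have := n12 j; rewrite e1 e3 eqxx.
    - have [e1 e2] := J _ _ _ _ (congr1 snd E1); have [e3 _] := J _ _ _ _ (congr1 snd E2).
      by have := n12 j'; rewrite -e1 -e3 eqxx.
    - have [jj _] := J _ _ _ _ (congr1 snd E1); subst j'.
      move: dd dd' E1; rewrite !inE /= => /eqP sg /eqP sg' [].
      by rewrite -/rp sg sg' => ->.
  case: d d' dd dd' E1 E2 => [[[[g j] b]|[g j]]|[g j]] [[[[g' j'] b']|[g' j']]|[g' j']] //= dd dd' E1 E2.
  - have [e1 e2] := J _ _ _ _ (congr1 snd E1).
    by have := n12 j; rewrite e1 e2 eqxx.
  - have [e1 e2] := J _ _ _ _ (congr1 snd E1); have [e3 e4] := J _ _ _ _ (congr1 snd E2).
    by have := n12 j; rewrite e1 e3 eqxx.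
  - have [e1 e2] := J _ _ _ _ (congr1 snd E1); have [e3 e4] := J _ _ _ _ (congr1 snd E2).
    by have := n12 j'; rewrite -e1 -e3 eqxx.
  have [e1 e2] := J _ _ _ _ (congr1 snd E1).
  by have := n12 j; rewrite e2 e1 eqxx.
have cdom : (#|dom| = 9 * #|{: Om}| + #|sides|)%N.
  have -> : dom = (inl @: [set: pairs * bool + pairs]%SET) :|: (inr @: sides).
    apply/setP => -[x|x]; rewrite !inE.
      by rewrite imset_f.
    apply/idP/orP => [xs|[/imsetP[] //|/imsetP[y ys [->]]]] //.
      by right; apply/imsetP; exists x; rewrite ?inE.
    by move: ys; rewrite inE.
  rewrite cardsU !card_imset; try by [move=> x y []].
  have -> : (inl @: [set: pairs * bool + pairs]%SET) :&: (inr @: sides) = finset.set0 :> {set D}.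
    by apply/setP => -[x|x]; rewrite !inE; apply/negP => /andP[] /imsetP[y] // _ _ /imsetP[].
  rewrite cards0 subn0 cardsT card_sum !card_prod card_bool card_ord; set a := #|_|; set b := #|_|; lia.
rewrite -cdom -(card_in_imset finj); apply: subset_leq_card.
apply/fintype.subsetP => _ /imsetP[d dd ->]; rewrite inE; apply/andP; split; last first.
  rewrite cards2 (inj_eq enum_rank_inj); apply/eqP; congr (_.+1).
  case: d {dd} => [[[[g j] b]|[g j]]|[g j]] /=; rewrite ?xpair_eqE ?andbF //.
  - by have -> : (Some (j + 1, j) == Some (j + 2%:R, j)) = false by [apply/eqP => /J[] /eqP; rewrite n12]; rewrite andbF.
  by have -> : (Some (j, j + 1) == Some (j, j + 2%:R)) = false by [apply/eqP => /J[] _ /eqP; rewrite n12]; rewrite andbF.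
rewrite inE; apply/andP; split; first by apply/set0Pn; exists (ek (ends d).1); rewrite finset.in_set2 eqxx.
apply/existsP.
have E g t v w : v \in tri_vtx t -> w \in tri_vtx t ->
    [set ek (vid g v); ek (vid g w)]%SET \subset tset adj par g t.
  move=> vt' wt'; apply/fintype.subsetP => a; rewrite finset.in_set2.
  by move=> /orP[] /eqP ->; rewrite vid_tset.
case: d {dd} => [[[[g j] b]|[g j]]|[g j]].
- by exists (g, (false, j)); apply: E; rewrite ?inE //=; case: b; rewrite eqxx ?orbT.
- by exists (g, (true, j)); apply: E; rewrite ?inE //= eqxx ?orbT.
by exists (g, (false, j)); apply: E; rewrite ?inE //= eqxx ?orbT.
Qed.

(** For n hexagons and s sides there are at most n + 2s vertices, at least 9n + s edges and at most
    6n triangles. Only these inequalities are used, each in the direction that bounds the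
    alternating sum from above. *)
Lemma euler_char_le : complex_euler_char K <= #|sides|%:Z - (2 * #|{: Om}|)%:Z.
Proof.
have -> : complex_euler_char K = \sum_(s in K) ((#|s| == 1%N)%:Z - (#|s| == 2%N)%:Z + (#|s| == 3%N)%:Z).
  apply: eq_bigr => s sK; have [g [t st]] := tset_vid sK.
  have := leq_trans (subset_leq_card st) (card_tset g t).
  have : (0 < #|s|)%N by rewrite card_gt0; move: sK; rewrite inE => /andP[].
  by case: #|s| => [|[|[|[|]]]].
have cnt (P : pred {set 'I_#|vt|}) : \sum_(s in K) (P s)%:Z = #|[set s in K | P s]%SET|%:Z.
  rewrite -sum1_card (eq_bigl (fun s => (s \in K) && P s)); last by move=> s; rewrite inE.
  rewrite big_mkcondr /= -[RHS]natz natr_sum; apply: eq_bigr => s _; by case: (P s).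
rewrite big_split /= sumrB !cnt.
have := card_K1; have := card_K2; have := card_K3.
set a1 := #|_|; set a2 := #|_|; set a3 := #|_|; set a4 := #|_|; set a5 := #|_|; lia.
Qed.

(** A boundary curve either contains a boundary side, of weight 1, or is the small circle around a
    corner, whose [2 * m j] cuts share the weight 1. *)
Let w (t : tok Om) : R := if t.2 then ((m t.1.2).*2)%:R^-1 else 1.

Lemma w_ge0 t : 0 <= w t.
Proof. by rewrite /w; case: ifP => _; rewrite ?invr_ge0 ?ler0n. Qed.

Let nx := nx gl tg Om.

Lemma orbit_weight t : t \in valid adj Om -> 1 <= \sum_(u in porbit nx t) w u.
Proof.
move=> Vt; have [[u uo su]|ns] := pselect (exists2 u, u \in porbit nx t & ~~ u.2).
  rewrite (bigD1 u) //= {1}/w (negbTE su) lerDl; apply: sumr_ge0 => u' _; exact: w_ge0.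
have cut u : u \in porbit nx t -> u.2.
  by move=> uo; apply: contrapT => /negP nu; apply: ns; exists u.
have orb u : u \in porbit nx t -> nx u \in porbit nx t.
  by move=> /porbitP[k ->]; rewrite -permM -expgSr mem_porbit.
have step (g : Om) j : (g, j, true) \in porbit nx t ->
    exists2 h : Om, nx (g, j, true) = (h, j, true) & val h = adj (j + (if par (val g) then 2%:R else 1)) (val g).
  move=> /orb/cut; rewrite permE /=; case: ifPn => // iO _.
  by exists (nbr adj (j + (if par (val g) then 2%:R else 1)) g) => //; rewrite nbrE.
(* A start of parity false makes the orbit follow [turn], whose first crossing is of side
   [j + 1]. *)
have [g1 [j [go1 p1]]] : exists g1 j, (g1, j, true) \in porbit nx t /\ ~~ par (val g1).
  case: t Vt ns cut orb step => -[g j] b Vt ns cut orb step.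
  have /= bT : b = true := cut _ (porbit_id nx (g, j, b)); subst b.
  have o := porbit_id nx (g, j, true).
  case: (boolP (par (val g))) => pg; last by exists g, j.
  have [h E hE] := step _ _ o; exists h, j; rewrite -E; split; first exact: orb.
  by rewrite hE (par_adj tg) pg.
have it (k : nat) : exists2 h : Om, iter k nx (g1, j, true) = (h, j, true) & val h = turn adj j k (val g1).
  elim: k => [|k [h E hE]]; first by exists g1.
  have ho : (h, j, true) \in porbit nx t.
    by rewrite -E -permX; move: go1 => /porbitP[l ->]; rewrite -permM -expgD mem_porbit.
  have [h' E' hE'] := step _ _ ho; exists h'; first by rewrite /= E E'.
  rewrite hE' hE /= /turn_side (par_turn tg) (negbTE p1) /=; case: (odd k) => //.
pose B := [set iter (k : 'I_(m j).*2) nx (g1, j, true) | k in 'I_(m j).*2]%SET.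
have BS : B \subset porbit nx t.
  apply/fintype.subsetP => _ /imsetP[k _ ->]; rewrite -permX.
  by move: go1 => /porbitP[l ->]; rewrite -permM -expgD mem_porbit.
have m0 : (0 < (m j).*2)%N by rewrite double_gt0 (ltn_trans _ (m_gt1 tg j)).
have cB : #|B| = (m j).*2.
  rewrite card_imset ?card_ord // => k l E; apply: val_inj.
  have [h Eh hE] := it k; have [h' Eh' hE'] := it l.
  have : turn adj j k (val g1) = turn adj j l (val g1).
    by rewrite -hE -hE'; move: E; rewrite Eh Eh' => -[->].
  by move=> /(turn_eq adjK tg); rewrite !modn_small.
rewrite (bigID (mem B)) /= -[leLHS]addr0; apply: lerD; last by apply: sumr_ge0 => u _; exact: w_ge0.
rewrite (eq_bigl (mem B)); last first.
  by move=> u /=; rewrite andb_idl // => uB; exact: (fintype.subsetP BS).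
rewrite (eq_bigr (fun=> ((m j).*2)%:R^-1)); last first.
  by move=> _ /imsetP[k _ ->]; have [h -> _] := it k.
by rewrite sumr_const cB -[leRHS]mulr_natr mulVf // pnatr_eq0 -lt0n.
Qed.

Lemma card_boundary_curves : #|[set porbit nx t | t in valid adj Om]%SET|%:R <=
  #|{: Om}|%:R * (2^-1 * \sum_j (m j)%:R^-1) + bd%:R :> R.
Proof.
apply: le_trans (card_orbits (w := w) _ _ _) _.
- by move=> t; exact: valid_nx.
- by move=> t _; exact: w_ge0.
- exact: orbit_weight.
rewrite big_mkcond /= (eq_bigr (fun u : pairs * bool => if (u.1, u.2) \in valid adj Om then w (u.1, u.2) else 0)); last by case.
rewrite -(pair_bigA _ (fun x b => if (x, b) \in valid adj Om then w (x, b) else 0)) /=.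
rewrite (eq_bigr (fun x : pairs => ((m x.2).*2)%:R^-1 + (x \in boundary_sides)%:R)); last first.
  move=> [g j] _; rewrite big_bool !inE /= /w /=; case: (_ \notin _) => //.
rewrite big_split /= lerD //; last first.
  rewrite -natr_sum ler_nat /bd -sum1_card [leqRHS]big_mkcond /=; apply: leq_sum => x _; by case: ifP.
rewrite -(pair_bigA _ (fun g j => ((m j).*2)%:R^-1)) /= sumr_const mulr_natl -mulr_natl.
rewrite le_eqVlt; apply/orP; left; apply/eqP; rewrite -[LHS]mulr_natl; congr (_ * _); rewrite mulr_sumr.
by apply: eq_bigr => j _; rewrite -mul2n natrM invfM.
Qed.

End RegionCounts.

(** * Genus from small relative boundary *)

Section InfiniteGenus.
Variables (R : realType) (G : choiceType) (X : topologicalType)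
  (adj : 'I_3 -> G -> G) (tri : G -> 'rV[R]_3 -> X) (par : G -> bool) (m : 'I_3 -> nat).
Hypotheses (gl : gluing adj tri) (tg : triangle_group adj par m).
Hypothesis hyperbolic : \sum_j (m j)%:R^-1 < 1 :> R.
Hypothesis folner : forall n : nat, exists (Om : {fset G}) g,
  [/\ g \in Om, forall h, h \in Om -> path_in adj [set` Om] g h,
      (n * #|boundary_sides adj Om| <= #|{: Om}|)%N & (n <= #|{: Om}|)%N].

Lemma infinite_genus_gluing : infinite_genus R X.
Proof.
move=> n; pose d := 1 - \sum_j (m j)%:R^-1 : R.
have d0 : 0 < d by rewrite subr_gt0.
(* For n triangles and b boundary sides the counts give chi + q <= 3b/2 - n d/2. The first bound on
   [M] makes 6b <= n d, so this is at most -n d/4; the second makes that at most minus twice the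
   required genus. *)
pose M := maxn (Num.truncn (6 / d)).+1 (Num.truncn (8 * n%:R / d)).+1.
have M6 : 6 <= M%:R * d.
  rewrite -ler_pdivrMr //; apply/ltW/(lt_le_trans (truncnS_gt _)); rewrite ler_nat; exact: leq_maxl.
have M8 : 8 * n%:R <= M%:R * d.
  rewrite -ler_pdivrMr //; apply/ltW/(lt_le_trans (truncnS_gt _)); rewrite ler_nat; exact: leq_maxr.
have [Om [g [gO cO fO nO]]] := folner M.
have hX := hausdorff_gluing gl tg.
set q := #|[set porbit (nx gl tg Om) t | t in valid adj Om]%SET|.
pose chi := complex_euler_char (@complexK _ adj par Om).
have A0 : region tri Om !=set0 by exists (tri g (ctr R)), g => //; exists (ctr R) => //; exact: hexagon_ctr.
exists (region tri Om), (1 - (chi + q%:Z)%:~R / 2); split.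
  exists q, chi; split=> //.
  - exact: region_subsurface gO cO.
  - exact: (region_compact gl).
  - exact: (region_euler_char gl tg hX A0).
have e1 := euler_char_le gl tg Om.
have e2 := card_sides gl tg Om.
have e3 : q%:R <= _ := card_boundary_curves gl tg Om.
set N := #|[set x | _]%SET| in e1 e2; set b := #|_| in e2 e3 fO; set O := #|{: Om}| in e1 e2 e3 fO nO.
have e1' : chi%:~R <= N%:R - 2 * O%:R :> R.
  by have := e1; rewrite -(ler_int R) rmorphB /= !pmulrn => h; apply: le_trans h _; rewrite -natrM.
have e2' : 2 * N%:R <= 3 * O%:R + b%:R :> R by rewrite -!natrM -natrD ler_nat.
have fO' : M%:R * b%:R <= O%:R :> R by rewrite -natrM ler_nat.
have nO' : M%:R <= O%:R :> R by rewrite ler_nat.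
have b0 : 0 <= b%:R :> R by [].
have H : chi%:~R + q%:R <= 2 - 2 * n%:R :> R.
  have S : \sum_j (m j)%:R^-1 = 1 - d by rewrite /d; ring.
  rewrite S in e3.
  have h1 : 6 * b%:R <= O%:R * d by nra.
  have h2 : 8 * n%:R <= O%:R * d by nra.
  nra.
have {}H : chi + q%:Z <= 2 - 2 * n%:Z.
  by rewrite -(ler_int R) rmorphD rmorphB rmorphM /= !pmulrn.
have {}H : (chi + q%:Z)%:~R <= 2 - 2 * n%:R :> rat.
  by move: H; rewrite -(ler_int rat) rmorphB rmorphM /= !pmulrn.
lra.
Qed.

End InfiniteGenus.

(** * The monodromy group of a periodic system of flags *)

Section FiniteSetLemmas.
Local Open Scope nat_scope.

Lemma eventually_notin (T : Type) (D : set T) (s : nat -> T) : finite_set D -> injective s ->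
  exists n, forall i, n <= i -> ~ D (s i).
Proof.
move=> fD sI; have : finite_set (s @^-1` D) by apply: finite_preimage fD => i j _ _; exact: sI.
move=> /finite_fsetP[X XE]; exists (\sum_(x : X) val x).+1 => i ni Di.
have iX : i \in X by have : [set` X] i by rewrite -XE.
move: ni; rewrite ltnNge => /negP; apply.
by rewrite (bigD1 [` iX]%fset) //= leq_addr.
Qed.

(** Around a closed cycle the number of changes is even; it is positive as soon as one value
    differs. *)
Lemma changes_ge2 (s : nat -> bool) p : s p = s 0 -> (exists2 k, k < p & s k != s 0) ->
  2 <= \sum_(k < p) (s k.+1 != s k).
Proof.
move=> sp [k kp sk].
have od n : odd (\sum_(i < n) (s i.+1 != s i)) = (s n != s 0).
  by elim: n => [|n IH]; rewrite ?big_ord0 ?eqxx // big_ord_recr /= oddD IH; case: (s n) (s 0) (s n.+1) => -[] [].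
have : odd (\sum_(k < p) (s k.+1 != s k)) = false by rewrite od sp eqxx.
have : \sum_(k < p) (s k.+1 != s k) != 0.
  apply: contra sk => /eqP; elim: k kp => // k IH kp E.
  have := IH (ltnW kp) E; move: E; rewrite (bigD1 (Ordinal (ltnW kp))) //= => /eqP.
  by rewrite addn_eq0 => /andP[] /eqP + _ => /eqP; rewrite eqb0 negbK => /eqP ->.
by case: (\sum_(k < p) _) => [|[|]].
Qed.

(** Otherwise the sequence doubles within every [K] steps and grows exponentially, against the
    polynomial bound. *)
Lemma growth_slow (a : nat -> nat) A D K : 0 < a 0 -> (forall k, a k <= a k.+1) ->
  (forall k, a k <= (A * k.+1) ^ D.+1) -> exists k, K * (a k.+1 - a k) <= a k.
Proof.
move=> a0 am ub; apply: contrapT => no.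
have st k : a k < K * (a k.+1 - a k) by rewrite ltnNge; apply/negP => h; apply: no; exists k.
have K0 : 0 < K by have := st 0; case: (K).
have grow k j : (K + j) * a k <= K * a (k + j).
  have mono i : a k <= a (k + i) by elim: i => [|i /leq_trans->] //; rewrite ?addn0 // addnS.
  elim: j => [|j IH]; first by rewrite !addn0.
  have := st (k + j); have := mono j; rewrite !addnS mulnBr mulSn; move: IH.
  set x := (K + j) * a k; set y := K * a (k + j); set z := K * a _; lia.
have dbl k : 2 * a k <= a (k + K).
  by have := grow k K; rewrite addnn -mul2n mulnAC mulnC leq_pmul2l.
have exp i : 2 ^ i <= a (i * K).
  elim: i => [//|i IH]; rewrite mulSn addnC expnS; apply: leq_trans (dbl _); rewrite leq_mul2l //=.
(* Evaluation after [2 * l * D.+1] doublings lets the root of order [D.+1] be taken exactly. This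
   [l] bounds the remaining linear term by l (l + 1), while the power of 2 is at least (l + 1)^2. *)
pose l := A * (2 * (D.+1 * K) + 1).
have h : 2 ^ (l.*2) <= A * (l.*2 * D.+1 * K).+1.
  rewrite -(leq_exp2r _ _ (ltn0Sn D)) -expnM; exact: leq_trans (exp _) (ub _).
have h2 : l.+1 * l.+1 <= 2 ^ (l.*2).
  by rewrite -addnn expnD leq_mul // ltn_expl.
have : A * (l.*2 * D.+1 * K).+1 <= l * l.+1.
  rewrite /l -!mulnA leq_mul2l; apply/orP; right; rewrite -/l; nia.
have := leq_trans h2 h; nia.
Qed.

End FiniteSetLemmas.

Lemma path_in_trans (G : choiceType) (adj : 'I_3 -> G -> G) S x y z :
  path_in adj S x y -> path_in adj S y z -> path_in adj S x z.
Proof. by move=> xy; elim=> // i h _ xh Si; exact: path_in_step. Qed.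

Lemma path_in_end (G : choiceType) (adj : 'I_3 -> G -> G) S x y :
  path_in adj S x y -> S x /\ S y.
Proof. by elim=> // i h _ [Sx _] Si. Qed.

Lemma path_in_sym (G : choiceType) (adj : 'I_3 -> G -> G) S x y : (forall i, involutive (adj i)) ->
  path_in adj S x y -> path_in adj S y x.
Proof.
move=> adjK; elim=> [Sx|i h xh hx Si]; first exact: path_in_refl.
apply: path_in_trans hx; rewrite -{2}(adjK i h); apply: path_in_step; first exact: path_in_refl.
by rewrite adjK; have [] := path_in_end xh.
Qed.

Notation word r w := (fun f => foldr r f w).

Lemma word_rev (F : Type) (r : 'I_3 -> F -> F) (rK : forall i, involutive (r i)) w f :
  foldr r (foldr r f w) (rev w) = f.
Proof. by elim: w f => //= i w IH f; rewrite rev_cons -cats1 foldr_cat /= rK. Qed.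

(* [F] models the flags of a map with the flag adjacencies [r], [tr] a free action of a
   lattice of translations, [rc] the choice of a representative in each translation class
   of flags, and [app] the right action of the monodromy group [G] on flags. *)
Record periodic_flags (F G : choiceType) (r : 'I_3 -> F -> F) (tr : int * int -> F -> F)
    (rc : F -> F) (app : G -> F -> F) (adj : 'I_3 -> G -> G) (f0 : F) : Prop := PeriodicFlags {
  flagsK : forall i, involutive (r i);
  flags_neq : forall i k f, i != k -> r i f <> r k f;
  flags02 : forall f, r 0 (r 2%:R f) = r 2%:R (r 0 f);
  flags_trans : forall f g, exists w, word r w f = g;
  flags_period : forall i k f, exists2 n, (0 < n)%N & iter n (fun h => r i (r k h)) f = f;
  tr0 : forall f, tr 0 f = f;
  trD : forall y z f, tr (y + z) f = tr y (tr z f);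
  tr_free : forall z f, tr z f = f -> z = 0;
  flags_tr : forall i z f, r i (tr z f) = tr z (r i f);
  rc_tr : forall z f, rc (tr z f) = rc f;
  rcP : forall f, exists z, f = tr z (rc f);
  rc_finite : finite_set (range rc);
  app_inj : forall g h, app g =1 app h -> g = h;
  app_adj : forall i g f, app (adj i g) f = r i (app g f);
  app_word : forall g, exists w, app g =1 word r w;
  word_app : forall w, exists g, app g =1 word r w }.

Section Monodromy.
Variables (F G : choiceType) (r : 'I_3 -> F -> F) (tr : int * int -> F -> F) (rc : F -> F)
  (app : G -> F -> F) (adj : 'I_3 -> G -> G) (f0 : F).
Hypothesis pf : periodic_flags r tr rc app adj f0.
Implicit Types (f : F) (g h x y : G) (z u v : int * int) (i k : 'I_3) (w : seq 'I_3).

Let rK := flagsK pf.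

Lemma adj_involutive i : involutive (adj i).
Proof. by move=> g; apply: (app_inj pf) => f; rewrite !(app_adj pf) rK. Qed.

Lemma wd_ex g : {w | app g =1 word r w}. Proof. by apply: cid; exact: (app_word pf). Qed.
Lemma wrd_ex w : {g | app g =1 word r w}. Proof. by apply: cid; exact: (word_app pf). Qed.
Let wd g := sval (wd_ex g).
Let wrd w := sval (wrd_ex w).
Let wdE g f : app g f = foldr r f (wd g). Proof. exact: (svalP (wd_ex g)). Qed.
Let wrdE w f : app (wrd w) f = foldr r f w. Proof. exact: (svalP (wrd_ex w)). Qed.

Let e := wrd [::].
(** Composition with the second factor acting first. In this order [adj i] is multiplication on the
    left by a generator and commutes with every multiplication on the right. *)
Let mul g h := wrd (wd g ++ wd h).
Let inv g := wrd (rev (wd g)).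
Let app_e f : app e f = f. Proof. by rewrite wrdE. Qed.
Let app_mul g h f : app (mul g h) f = app g (app h f).
Proof. by rewrite wrdE foldr_cat -!wdE. Qed.
Let app_invK g : cancel (app g) (app (inv g)).
Proof. by move=> f; rewrite wrdE wdE (word_rev rK). Qed.
Let app_Kinv g : cancel (app (inv g)) (app g).
Proof. by move=> f; have := word_rev rK (rev (wd g)) f; rewrite revK wdE wrdE. Qed.

Let mul_word g h : mul g h = foldr adj h (wd g).
Proof.
apply: (app_inj pf) => f; rewrite app_mul wdE.
by elim: (wd g) => //= i w ->; rewrite (app_adj pf).
Qed.

Let mulA g h x : mul g (mul h x) = mul (mul g h) x.
Proof. by apply: (app_inj pf) => f; rewrite !app_mul. Qed.
Let mule g : mul g e = g.
Proof. by apply: (app_inj pf) => f; rewrite !app_mul app_e. Qed.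
Let adj_mul i g h : mul (adj i g) h = adj i (mul g h).
Proof. by apply: (app_inj pf) => f; rewrite (app_adj pf) !app_mul (app_adj pf). Qed.

Lemma word_reach g h : exists w, foldr adj g w = h.
Proof.
exists (wd (mul h (inv g))); rewrite -mul_word; apply: (app_inj pf) => f.
by rewrite !app_mul app_invK.
Qed.

Lemma adj_connected g h : reach adj predT g h.
Proof.
have [w <-] := word_reach g h; elim: w => [|i w IH] /=; first exact: reach_refl.
exact: reach_step.
Qed.

Lemma monodromy_countable : countable [set: G].
Proof.
have -> : [set: G] = range (fun w => foldr adj e w).
  by apply/seteqP; split=> // g _; have [w <-] := word_reach e g; exists w.
exact: card_le_trans (card_image_le _ _) (countableP _).
Qed.

Let app_tr g z f : app g (tr z f) = tr z (app g f).
Proof. by rewrite !wdE; elim: (wd g) => //= i w ->; rewrite (flags_tr pf). Qed.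

Let trN z f : tr (- z) (tr z f) = f.
Proof. by rewrite -(trD pf) addNr (tr0 pf). Qed.

Let tr_inj f z u : tr z f = tr u f -> z = u.
Proof.
move=> E; apply/subr0_eq/(tr_free pf (f := f)).
by rewrite addrC (trD pf) E trN.
Qed.

Let app_inj1 g : injective (app g). Proof. exact: can_inj (app_invK g). Qed.

Lemma pos_ex f : {z | f = tr z (rc f)}. Proof. by apply: cid; exact: (rcP pf). Qed.
Let pos f := sval (pos_ex f).
Let posE f : f = tr (pos f) (rc f). Proof. exact: (svalP (pos_ex f)). Qed.

Let pos_tr z f : pos (tr z f) = z + pos f.
Proof. by apply: (@tr_inj (rc f)); rewrite -{1}(rc_tr pf z f) -posE (trD pf) -posE. Qed.

Let rcK f : rc (rc f) = rc f.
Proof. by rewrite {2}(posE f) (rc_tr pf). Qed.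

Let rc_app g f f' : rc f = rc f' -> rc (app g f) = rc (app g f').
Proof. by move=> E; rewrite (posE f) (posE f') E !app_tr !(rc_tr pf). Qed.

Let C : {fset F} := fset_set (range rc).
Let in_C f : rc f \in C.
Proof. by rewrite in_fset_set; [apply/mem_set; exists f|exact: (rc_finite pf)]. Qed.
Let cl f : C := [` in_C f]%fset.
Let rc_val (c : C) : rc (val c) = val c.
Proof.
have := valP c; rewrite in_fset_set; last exact: (rc_finite pf).
by move=> /set_mem[f _ <-]; rewrite rcK.
Qed.
Let cl_val (c : C) : cl (val c) = c. Proof. by apply: val_inj; rewrite /= rc_val. Qed.
Let cl_eq f f' : cl f = cl f' -> rc f = rc f'. Proof. by move=> /(congr1 val). Qed.

Let sg (t : F -> F) (c : C) := cl (t (val c)).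
Let equi (t : F -> F) := forall z f, t (tr z f) = tr z (t f).
Let sg_inj t : equi t -> injective t -> injective (sg t).
Proof.
move=> et it c c' /cl_eq E; rewrite -(cl_val c) -(cl_val c'); apply: val_inj => /=.
have [a Ea] := rcP pf (t (val c)); have [b Eb] := rcP pf (t (val c')).
have : t (tr (b - a) (val c)) = t (val c').
  by rewrite et Ea -(trD pf) E addrNK -Eb.
by move=> /it <-; rewrite (rc_tr pf).
Qed.

(** An injective map commuting with the translations permutes the finitely many classes; this makes
    averaging over classes possible. *)
Let sum_equi t (phi : F -> nat) : equi t -> injective t ->
  (forall z f, phi (tr z f) = phi f) ->
  (\sum_(c : C) phi (t (val c)) = \sum_(c : C) phi (val c))%N.
Proof.
move=> et it inv_phi; have pc f : phi (rc f) = phi f by rewrite [in RHS](posE f) inv_phi.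
rewrite [RHS](reindex_inj (sg_inj et it)) /=.
by apply: eq_bigr => c _; rewrite pc.
Qed.

Let app_equi g : equi (app g). Proof. by move=> z f; exact: app_tr. Qed.

Let pow g n : G := iter n (mul g) e.
Let app_pow g n f : app (pow g n) f = iter n (app g) f.
Proof. by elim: n f => [|n IH] f; rewrite /= ?app_e // app_mul IH. Qed.

Let class_power t : equi t -> injective t -> exists2 n, (0 < n)%N & forall f, rc (iter n t f) = rc f.
Proof.
move=> et it; pose p : {perm C} := perm (sg_inj et it); exists #[p]%g; first exact: order_gt0.
move=> f; set n := #[p]%g.
have it' m f' : rc f' = rc f -> rc (iter m t f') = val (iter m p (cl f)).
  elim: m f' => [|m IH] f' E //=; rewrite permE /sg /= -(IH f' E) {1}(posE (iter m t f')) et.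
  by rewrite (rc_tr pf).
by rewrite (it' n f) // -permX expg_order perm1.
Qed.

(** The vector [u] records the translation on the class of [f0] only; other classes may be moved by
    other vectors. *)
Definition tame x u := (forall f, rc (app x f) = rc f) /\ app x f0 = tr u f0.

(** An element that translates [f0] is raised to a power that fixes all classes. *)
Let tame_ex u : exists x n, (0 < n)%N /\ tame x (u *+ n).
Proof.
have [w E] := flags_trans pf f0 (tr u f0); pose g := wrd w.
have [n n0 rn] := class_power (app_equi g) (app_inj1 (g := g)).
exists (pow g n), n; split=> //; split; first by move=> f; rewrite app_pow.
rewrite app_pow; elim: n {n0 rn} => [|n IH]; first by rewrite mulr0n (tr0 pf).
by rewrite /= IH app_tr wrdE E -(trD pf) -mulrSr.
Qed.

Let tame_inv x u : tame x u -> tame (inv x) (- u).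
Proof.
move=> [h1 h2]; split=> [f|]; first by rewrite -{2}(app_Kinv x f) h1.
by apply: (@app_inj1 x); rewrite app_Kinv app_tr h2 trN.
Qed.

(* A class preserving element acts on each translation class as a translation, so that its
   conjugates are determined by maps between the finitely many classes. *)
Let conj_finite x u : tame x u -> exists2 W, finite_set W &
  forall g, exists2 h, W h & mul g x = mul h g.
Proof.
move=> [xc _]; pose d f := pos (app x (rc f)).
have dE f : app x f = tr (d f) f.
  have h : app x (rc f) = tr (d f) (rc f) by rewrite {1}(posE (app x (rc f))) xc rcK.
  by rewrite {1}(posE f) app_tr h -(trD pf) addrC (trD pf) -posE.
pose V (s : {ffun C -> C}) f := tr (d (val (s (cl f)))) f.
pose P s h := app h =1 V s.
exists ((fun s => xget e (P s)) @` setT); first exact/finite_image/finite_finset.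
move=> g; pose s : {ffun C -> C} := [ffun c => cl (app (inv g) (val c))].
have hE : app (mul (mul g x) (inv g)) =1 V s.
  move=> f; rewrite !app_mul dE app_tr app_Kinv /V ffunE; congr (tr _ _); rewrite /d /= rcK.
  by rewrite (@rc_app (inv g) (rc f) f) // rcK.
exists (mul (mul g x) (inv g)).
  exists s => //; apply: (app_inj pf) => f.
  have := @xgetPex _ e (P s); rewrite /P => /(_ (ex_intro (fun h => app h =1 V s) _ hE)) ->; by rewrite hE.
by apply: (app_inj pf) => f; rewrite !app_mul app_invK.
Qed.

Let pairMn (p : int * int) n : p *+ n = (p.1 *+ n, p.2 *+ n).
Proof. by elim: n => [|n IH]; rewrite ?mulr0n // !mulrS IH. Qed.

Let pair_mulrI (p : int * int) n m : p != 0 -> p *+ n = p *+ m -> n = m.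
Proof.
move=> p0 E; have := congr1 fst E; have := congr1 snd E.
rewrite (pairMn p n) (pairMn p m); cbv [fst snd] => h2 h1.
have : (p.1 != 0) || (p.2 != 0).
  by apply: contraNT p0; rewrite negb_or !negbK => /andP[/eqP h /eqP h']; rewrite [p]surjective_pairing h h'.
by case/orP => h; [exact: mulrIn h _ _ h1|exact: mulrIn h _ _ h2].
Qed.

(** * Subsets of the group with finite boundary *)

Section Colouring.
Variable c : G -> bool.
Hypothesis bdc : finite_set [set g | exists i, c (adj i g) != c g].

Let word_change w : finite_set [set g | c (foldr adj g w) != c g].
Proof.
elim: w => [|i w IH] /=.
  by apply: (@sub_finite_set _ _ set0) => // g /=; rewrite eqxx.
apply: (@sub_finite_set _ _ ([set g | c (foldr adj g w) != c g] `|`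
    (fun g => foldr adj g w) @^-1` [set g | exists i, c (adj i g) != c g])).
  move=> g /= h; have [E|] := eqVneq (c (foldr adj g w)) (c g); last by left.
  by right; exists i; rewrite E.
rewrite finite_setU; split=> //; apply: finite_preimage bdc => g g' _ _.
elim: w {IH} => //= k w IH /(can_inj (@adj_involutive k)); exact: IH.
Qed.

(** Finiteness of the conjugates turns right multiplication by [x] at [g] into left multiplication
    by one of finitely many words, each of which changes the colour at finitely many places. *)
Let shift_change x u : tame x u -> finite_set [set g | c (mul g x) != c g].
Proof.
move=> /conj_finite[W fW WP].
apply: (@sub_finite_set _ _ (\bigcup_(h in W) [set g | c (foldr adj g (wd h)) != c g])).
  by move=> g /= cg; have [h Wh E] := WP g; exists h => //=; rewrite -mul_word -E.
by apply: bigcup_finite => // h _; exact: word_change.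
Qed.

Let ray x g n := iter n (mul^~ x) g.
Let ray_f0 x u g n : tame x u -> app (ray x g n) f0 = tr (u *+ n) (app g f0).
Proof.
move=> [_ E]; elim: n => [|n IH]; first by rewrite mulr0n (tr0 pf).
rewrite /= app_mul E app_tr IH -(trD pf); congr (tr _ _); by rewrite mulrS.
Qed.

Let ray_inj x u g : u != 0 -> tame x u -> injective (ray x g).
Proof.
move=> u0 tx n m E; have := congr1 (fun h => app h f0) E.
rewrite !(ray_f0 _ _ tx) => /tr_inj; exact: pair_mulrI.
Qed.

Let adj_ray i x g n : ray x (adj i g) n = adj i (ray x g n).
Proof. by elim: n => //= n ->; rewrite adj_mul. Qed.

(** Rays are injective and so meet each finite set of exceptions finitely often: the colour
    stabilizes along each of them. Rays from adjacent elements stay adjacent, hence stabilize to the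
    same colour. *)
Let ray_colour x u : u != 0 -> tame x u ->
  exists col, forall g, exists n, forall i : nat, (n <= i)%N -> c (ray x g i) = col.
Proof.
move=> u0 tx.
have ev g : exists col n, forall i : nat, (n <= i)%N -> c (ray x g i) = col.
  have [n nP] := eventually_notin (shift_change tx) (ray_inj (g := g) u0 tx).
  exists (c (ray x g n)), n => i; elim: i => [|i IH]; first by rewrite leqn0 => /eqP ->.
  rewrite leq_eqVlt => /orP[/eqP <- //|/[!ltnS] ni]; rewrite -IH //=.
  by have /negP := nP _ ni; rewrite /= negbK => /eqP.
have [col [n0 n0P]] := ev e; exists col => g.
have [w <-] := word_reach e g; elim: w => [|k w [n nP]] /=; first by exists n0.
have [n1 n1P] := eventually_notin bdc (ray_inj (g := foldr adj e w) u0 tx).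
exists (maxn n n1) => i; rewrite geq_max => /andP[ni n1i]; rewrite adj_ray -(nP i ni).
by apply/eqP/negPn/negP => h; apply: (n1P i n1i); exists k.
Qed.

Lemma almost_constant : exists col, finite_set [set g | c g != col].
Proof.
have [x [a [a0 tx]]] := tame_ex (1, 0); have [y [b [b0 ty]]] := tame_ex (0, 1).
have u0 : ((1, 0) : int * int) *+ a != 0.
  by rewrite pairMn /= xpair_eqE negb_and -[_ *+ a]/(a%:R) pnatr_eq0 -lt0n a0.
have tx' := tame_inv tx; have u0' : - (((1, 0) : int * int) *+ a) != 0 by rewrite oppr_eq0.
have [k1 K1] := ray_colour u0 tx; have [k2 K2] := ray_colour u0' tx'.
pose D := [set g | c (mul g x) != c g] `|` [set g | c (mul g (inv x)) != c g].
have fD : finite_set D by rewrite finite_setU; split; [exact: shift_change tx|exact: shift_change tx'].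
have k12 : k1 = k2.
  apply: contrapT => ne.
  (* A line whose two ends differ in colour contains a change. The lines run in direction (1, 0) and
     start at powers of [y], so the second coordinate of the translate of [f0] keeps their changes
     distinct. *)
  have line g : exists h, D h /\ exists s : int, app h f0 = tr (s, 0) (app g f0).
    apply: contrapT => no.
    have cst (z : G) (u : int * int) : tame z u -> u.2 = 0 -> (forall h, ~ D h -> c (mul h z) = c h) ->
        forall n, c (ray z g n) = c g.
      move=> tz u2 DE; elim=> // n IH; rewrite /= DE ?IH // => Dh; apply: no.
      exists (ray z g n); split=> //; exists (u.1 *+ n); rewrite (ray_f0 _ _ tz) pairMn u2.
      by rewrite mul0rn.
    have [n1 /(_ _ (leqnn n1))] := K1 g; have [n2 /(_ _ (leqnn n2))] := K2 g.
    rewrite (cst _ _ tx') ?(cst _ _ tx) ?pairMn /= ?mul0rn ?oppr0 //; first by move=> -> E; exact: ne.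
    - by move=> h /not_orP[/negP + _]; rewrite /= negbK => /eqP.
    - by move=> h /not_orP[_ /negP]; rewrite /= negbK => /eqP.
  have [h hP] := choice (fun j => line (ray y e j)).
  have hI : injective h.
    move=> j j' E; have [_ [s Es]] := hP j; have [_ [s' Es']] := hP j'.
    move: Es Es'; rewrite E !(ray_f0 _ _ ty) -!(trD pf) => -> /tr_inj [_].
    rewrite !pairMn /= !add0r -!mulrnA -[_ *+ (b * j)]/(_%:R) -[_ *+ (b * j')]/(_%:R) => /eqP.
    by rewrite eqr_nat eqn_pmul2l // => /eqP.
  by have [n /(_ _ (leqnn n))] := eventually_notin fD hI; apply; have [] := hP n.
exists k1.
(* From an element of the other colour the ray in direction [x] meets a last such element, which
   lies in [D]. The way back from it has the limit colour after [N] steps, so the element is one of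
   finitely many. *)
pose N g := sval (cid (K2 g)).
have NP g (i : nat) : (N g <= i)%N -> c (ray (inv x) g i) = k1.
  by rewrite k12; exact: (svalP (cid (K2 g))).
apply: (@sub_finite_set _ _ (\bigcup_(d in D) (ray (inv x) d @` `I_(N d)))); last first.
  by apply: bigcup_finite => // d _; exact: finite_image.
have back d n : ray (inv x) (ray x d n) n = d.
  elim: n d => // n IH d; rewrite /ray iterSr -/(ray _ _ n) -/(ray _ _ n.+1) /= -mulA.
  rewrite (_ : mul x (inv x) = e) ?mule ?IH //; apply: (app_inj pf) => f.
  by rewrite app_mul app_Kinv app_e.
move=> g /= cg.
have [n [nP nm]] : exists n, c (ray x g n) != k1 /\ c (ray x g n.+1) = k1.
  apply: contrapT => no; have [n0 /(_ _ (leqnn n0)) E] := K1 g.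
  have : forall n, c (ray x g n) != k1.
    elim=> // n IH; apply/negP => /eqP En; apply: no; by exists n.
  by move=> /(_ n0); rewrite E eqxx.
exists (ray x g n); first by left => /=; rewrite -/(ray x g n.+1) nm eq_sym.
exists n; last exact: back.
by rewrite /= ltnNge; apply/negP => /NP; rewrite back => E; rewrite E eqxx in cg.
Qed.

End Colouring.

Lemma monodromy_infinite : ~ finite_set [set: G].
Proof.
move=> fG; have : finite_set (range (fun n : nat => tr ((1, 0) *+ n) f0)).
  apply: (@sub_finite_set _ _ ((fun g => app g f0) @` setT)); last exact: finite_image.
  move=> _ [n _ <-]; have [w E] := flags_trans pf f0 (tr ((1, 0) *+ n) f0).
  by exists (wrd w) => //; rewrite wrdE.
move=> fR; have I : injective (fun n : nat => tr ((1, 0) *+ n) f0).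
  by move=> n m /tr_inj; exact: pair_mulrI.
by have [n /(_ _ (leqnn n))] := eventually_notin fR I; apply; exists n.
Qed.

(** Membership in a component of the complement of [Om] changes only at [Om] and its neighbours, so
    each component is finite or cofinite, and two cofinite ones meet in the infinite group. [Y]
    collects [Om] and the finite components next to it. *)
Lemma monodromy_one_end (Om : set G) : finite_set Om -> exists2 Y, finite_set Y &
  forall x y, ~ Y x -> ~ Y y -> path_in adj (~` Om) x y.
Proof.
move=> fO; pose comp x := [set y | path_in adj (~` Om) x y].
have symP := path_in_sym adj_involutive.
have cof x : ~ finite_set (comp x) -> finite_set (~` comp x).
  move=> ninf; pose c y := `[< comp x y >].
  have bdc : finite_set [set g | exists i, c (adj i g) != c g].
    apply: (@sub_finite_set _ _ (Om `|` \bigcup_(i in [set: 'I_3]) (adj i @` Om))); last first.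
      by rewrite finite_setU; split=> //; apply: bigcup_finite => // i _; exact: finite_image.
    move=> g /= [i ci]; have [gO|gO] := pselect (Om g); first by left.
    have [giO|giO] := pselect (Om (adj i g)).
      by right; exists i => //; exists (adj i g) => //; exact: adj_involutive.
    exfalso; move/negP: ci; apply; rewrite /c; apply/eqP/asbool_equiv_eq; split=> p.
      by rewrite -(adj_involutive i g); apply: path_in_step => //; rewrite adj_involutive.
    exact: path_in_step.
  have [[] fin] := almost_constant bdc.
    by apply: sub_finite_set fin => g /= ng; rewrite /c (asboolF ng).
  by exfalso; apply: ninf; apply: sub_finite_set fin => g /= cg; rewrite /c (asboolT cg).
pose Y := Om `|` \bigcup_(p in Om `*` [set: 'I_3])
  [set y | comp (adj p.2 p.1) y /\ finite_set (comp (adj p.2 p.1))].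
have fY : finite_set Y.
  rewrite finite_setU; split=> //; apply: bigcup_finite; first exact: finite_setX.
  move=> p _; have [fc|nc] := pselect (finite_set (comp (adj p.2 p.1))).
    by apply: sub_finite_set fc => y [].
  by apply: (@sub_finite_set _ _ set0) => // y [].
have inf x : ~ Y x -> ~ finite_set (comp x).
  move=> nY fc; have nO : ~ Om x by move=> h; apply: nY; left.
  have [[y [i [xy yO]]]|no] := pselect (exists y i, comp x y /\ Om (adj i y)).
    apply: nY; right; exists (adj i y, i); rewrite /= ?adj_involutive //.
    have yx := symP _ _ _ xy; split=> //.
    by apply: sub_finite_set fc => y' yy'; exact: path_in_trans xy yy'.
  apply: monodromy_infinite; apply: sub_finite_set fc => g _.
  have [w <-] := word_reach x g; elim: w => [|i w IH] /=; first exact: path_in_refl.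
  by apply: path_in_step => // h; apply: no; exists (foldr adj x w), i.
exists Y => // x y /inf/cof fx /inf/cof fy.
have [z [xz yz]] : exists z : G, comp x z /\ comp y z.
  apply: contrapT => no; apply: monodromy_infinite.
  apply: (@sub_finite_set _ _ (~` comp x `|` ~` comp y)); last by rewrite finite_setU.
  by move=> z _; have [xz|] := pselect (comp x z); [right => yz; apply: no; exists z|left].
exact: path_in_trans xz (symP _ _ _ yz).
Qed.

(** * Balls and polynomial growth *)

Let grow (B : {fset G}) :=
  (B `|` (adj 0%R @` B `|` (adj 1%R @` B `|` adj 2%:R @` B)))%fset.
Let ball n := iter n grow [fset e]%fset.

Let ballS n g : g \in ball n -> g \in ball n.+1.
Proof. by move=> h; rewrite -[ball n.+1]/(grow (ball n)) /grow in_fsetU h. Qed.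

Let ball_adj n i g : g \in ball n -> adj i g \in ball n.+1.
Proof.
move=> gB; have h : adj i g \in (adj i @` ball n)%fset by apply/imfsetP; exists g.
move: h; rewrite -[ball n.+1]/(grow (ball n)) /grow !in_fsetU.
have [->|[->|->]] : i = 0 \/ i = 1 \/ i = 2%:R; last 3 first.
- by move=> ->; rewrite !orbT.
- by move=> ->; rewrite !orbT.
- by move=> ->; rewrite !orbT.
by case: i {gB} => -[|[|[|//]]] h; [left|right; left|right; right]; exact: val_inj.
Qed.

Let ballSP n g : g \in ball n.+1 -> g \in ball n \/ exists i h, h \in ball n /\ g = adj i h.
Proof.
rewrite -[ball n.+1]/(grow (ball n)) /grow !in_fsetU => /orP[|/orP[|/orP[]]]; first by left.
all: by move=> /imfsetP[h /= hB ->]; right; eexists; exists h.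
Qed.

Let ball_path n g : g \in ball n -> path_in adj [set` ball n] e g.
Proof.
have up m x y : path_in adj [set` ball m] x y -> path_in adj [set` ball m.+1] x y.
  elim=> [xB|i h _ IH hB]; first by apply: path_in_refl; exact: ballS.
  by apply: path_in_step => //; exact: ballS.
elim: n g => [|n IH] g.
  by rewrite /= inE => /eqP ->; apply: path_in_refl; rewrite /= inE.
move=> /[dup] gB /ballSP[/IH/up //|[i [h [hB E]]]].
by rewrite E; apply: path_in_step; [exact/up/IH|rewrite /= -E].
Qed.

Let nrm z := (absz z.1 + absz z.2)%N.
Let nrmD (y z : int * int) : (nrm (y + z)%R <= nrm y + nrm z)%N.
Proof. by rewrite /nrm; case: y z => a b [a' b'] /=; lia. Qed.

Let speed := (\sum_(c : C) \sum_(i < 3) nrm (pos (r i (val c))))%N.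

Let pos_rc f : pos (rc f) = 0.
Proof. by apply: (tr_free pf (f := rc f)); rewrite -{2}(rcK f) -posE. Qed.

Let pos_step i f : (nrm (pos (r i f) - pos f)%R <= speed)%N.
Proof.
rewrite {1}(posE f) (flags_tr pf) pos_tr addrAC subrr add0r.
rewrite /speed (bigD1 (cl f)) //= (bigD1 i) //= -addnA; exact: leq_addr.
Qed.

Let ball_pos n g f : g \in ball n -> (nrm (pos (app g f) - pos f)%R <= speed * n)%N.
Proof.
elim: n g => [|n IH] g; first by rewrite /= inE => /eqP ->; rewrite app_e subrr muln0.
move=> /ballSP[/IH h|[i [h [/IH hB ->]]]]; first by apply: leq_trans h _; rewrite leq_mul2l leqnSn orbT.
rewrite (app_adj pf) -(subrKA (pos (app h f))) mulnS.
by apply: leq_trans (nrmD _ _) _; apply: leq_add => //; exact: pos_step.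
Qed.

(** An element is determined by the images of the class representatives, and an element of the ball
    of radius n moves each of them to one of finitely many classes with displacement at most
    [speed * n]. The exponent counts two coordinates per class and is rounded up. *)
Let card_ball n : (#|` ball n| <= ((#|{: C}|.+1 * (2 * speed).+1) * n.+1) ^ (2 * #|{: C}|).+1)%N.
Proof.
pose b := (speed * n)%N; pose I := 'I_(2 * b).+1.
pose co (s : int) : I := inord (absz (s + b%:Z)).
pose enc (g : ball n) : {ffun C -> C * I * I} :=
  [ffun c => (cl (app (val g) (val c)), co (pos (app (val g) (val c))).1, co (pos (app (val g) (val c))).2)].
have coI (s t : int) : (absz s <= b)%N -> (absz t <= b)%N -> co s = co t -> s = t.
  move=> sb tb /(congr1 val); rewrite /= !inordK; move: sb tb; set b0 := b; clear; lia.
have encI : injective enc.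
  move=> g h /ffunP E; apply/val_inj/(app_inj pf) => f.
  rewrite (posE f) !app_tr; congr (tr _ _); rewrite (posE (app (val g) _)) (posE (app (val h) _)).
  have := E (cl f); rewrite !ffunE /= => -[E1 E2 E3]; rewrite E1; congr (tr _ _).
  have hg := ball_pos (rc f) (valP g); have hh := ball_pos (rc f) (valP h).
  move: E2 E3 hg hh; rewrite pos_rc !subr0 /nrm -/b.
  case: (pos _) => a a'; case: (pos _) => d d' /= E2 E3 hg hh.
  have [la la'] : (absz a <= b)%N /\ (absz a' <= b)%N by move: hg; set b0 := b; clear; lia.
  have [ld ld'] : (absz d <= b)%N /\ (absz d' <= b)%N by move: hh; set b0 := b; clear; lia.
  by rewrite (coI a d la ld E2) (coI a' d' la' ld' E3).
have -> : #|` ball n| = #|{: ball n}| by rewrite cardfE.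
apply: leq_trans (leq_card _ encI) _; rewrite card_ffun !card_prod card_ord.
apply: (@leq_trans (((#|{: C}|.+1 * (2 * speed).+1 * n.+1) ^ 2) ^ #|{: C}|)); last first.
  by rewrite -expnM leq_pexp2l // !muln_gt0.
have [->|C0] := posnP #|{: C}|; first by rewrite !expn0.
rewrite leq_exp2r // -mulnA expnS expn1 /b.
have h : ((2 * (speed * n)).+1 <= (2 * speed).+1 * n.+1)%N by rewrite mulSn mulnS; lia.
have h' : (#|{: C}| <= #|{: C}|.+1 * #|{: C}|.+1)%N by apply: leq_trans (leqnSn _) _; rewrite leq_pmulr.
by rewrite -[X in (_ <= X)%N]mulnA -![(_ * n.+1)%N]mulnA; have := leq_mul h' (leq_mul h h); rewrite mulnACA !mulnA.
Qed.

Lemma monodromy_folner n : exists (Om : {fset G}) g,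
  [/\ g \in Om, forall h, h \in Om -> path_in adj [set` Om] g h,
      (n * #|boundary_sides adj Om| <= #|{: Om}|)%N & (n <= #|{: Om}|)%N].
Proof.
(* The factor 3 allows for the three sides through which an element outside the ball may be
   entered. *)
have [k small] : exists k : nat, (3 * n * (#|` ball k.+1| - #|` ball k|) <= #|` ball k|)%N.
  have b0 : (0 < #|` ball 0|)%N by rewrite /ball /= cardfs1.
  have bm (l : nat) : (#|` ball l| <= #|` ball l.+1|)%N.
    by apply: fsubset_leq_card; apply/fsubsetP => g; exact: ballS.
  exact: (@growth_slow (fun l : nat => #|` ball l|) _ _ (3 * n)%N b0 bm card_ball).
exists (ball k), e.
have eB : e \in ball k by elim: (k) => [|l IH]; [rewrite /= inE|exact: ballS].
have bdk : (#|boundary_sides adj (ball k)| <= 3 * (#|` ball k.+1| - #|` ball k|))%N.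
  pose D := (ball k.+1 `\` ball k)%fset.
  have -> : (3 * (#|` ball k.+1| - #|` ball k|) = size [seq (g, i) | g <- enum_fset D, i <- enum 'I_3])%N.
    rewrite size_allpairs size_enum_ord mulnC cardfsD; congr ((_ - _) * _)%N.
    by congr #|` _|; apply/fsetP => g; rewrite inE andb_idl // => /ballS.
  rewrite cardE -(size_map (fun x : ball k * 'I_3 => (adj x.2 (val x.1), x.2))).
  apply: uniq_leq_size.
    rewrite map_inj_uniq ?enum_uniq // => -[g i] [h j] /= [+ ij]; rewrite -ij.
    by move=> /(can_inj (adj_involutive i))/val_inj ->.
  move=> x /mapP[[g i]]; rewrite mem_enum inE /= => gi ->.
  by apply/allpairsP; exists (adj i (val g), i); split; rewrite /= ?mem_enum // in_fsetD gi ball_adj // fsvalP.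
(* A ball without boundary would be the whole infinite group. Nonemptiness of the boundary turns the
   bound on its size into a lower bound for the ball. *)
have bd1 : (0 < #|boundary_sides adj (ball k)|)%N.
  rewrite lt0n; apply/negP => /eqP/card0_eq bd0; apply: monodromy_infinite.
  apply: (@sub_finite_set _ _ [set` ball k]); last exact: finite_fset.
  move=> g _; have [w <-] := word_reach e g; elim: w => //= i w IH.
  by have := bd0 ([` IH]%fset, i); rewrite !inE /= => /negbFE.
have h : (n * #|boundary_sides adj (ball k)| <= #|{: ball k}|)%N.
  by rewrite -cardfE; apply: leq_trans small; have := leq_mul (leqnn n) bdk; rewrite mulnCA mulnA.
split=> //; first by move=> g; exact: ball_path.
by apply: leq_trans h; rewrite leq_pmulr.
Qed.

(** * Orders of rotations and the hyperbolic inequality *)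

Let rot (j : 'I_3) f := r (j + 2%:R) (r (j + 1) f).

Let rot_equi j : equi (rot j).
Proof. by move=> z f; rewrite /rot !(flags_tr pf). Qed.

Let rot_inj j : injective (rot j).
Proof. by move=> f f' h; apply/(can_inj (rK (j + 1)))/(can_inj (rK (j + 2%:R))). Qed.

Let iter_equi t n : equi t -> equi (iter n t).
Proof. by move=> et z f; elim: n => //= n ->. Qed.

Let iter_inj (t : F -> F) n : injective t -> injective (iter n t).
Proof. by move=> it; elim: n => [|n IH] f f' //= /it; exact: IH. Qed.

Let iter_period t p q f : iter p t f = f -> iter (q * p) t f = f.
Proof. by move=> E; elim: q => //= q IH; rewrite mulSn iterD IH. Qed.

Let order_ex j : exists n, (0 < n)%N && `[< forall f, iter n (rot j) f = f >].
Proof.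
have ex (c : C) := flags_period pf (j + 2%:R) (j + 1) (val c).
pose n (c : C) := s2val (cid2 (ex c)).
have n0 c : (0 < n c)%N by exact: (s2valP (cid2 (ex c))).
have nE c : iter (n c) (rot j) (val c) = val c by exact: (s2valP' (cid2 (ex c))).
exists (\prod_(c : C) n c)%N; rewrite prodn_gt0 //=; apply/asboolP => f.
rewrite (posE f) (iter_equi _ (@rot_equi j)); congr (tr _ _).
by rewrite (bigD1 (cl f)) //= mulnC; apply: iter_period; exact: nE.
Qed.

(** The order of the rotation as a permutation of all flags. It is finite because the product of the
    periods of the finitely many class representatives annihilates it. *)
Definition rotation_order j := ex_minn (order_ex j).

Let rotation_orderP j n : (forall f, iter n (rot j) f = f) <-> (rotation_order j %| n)%N.
Proof.
rewrite /rotation_order; case: ex_minnP => p /andP[p0 /asboolP pE] pmin; split; last first.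
  by move=> /dvdnP[q ->] f; exact: iter_period.
move=> nE; rewrite /dvdn; apply/negPn/negP => h.
suff : (p <= n %% p)%N by rewrite leqNgt ltn_pmod.
apply: pmin; rewrite lt0n h /=.
apply/asboolP => f; have := nE f; rewrite {1}(divn_eq n p) addnC iterD iter_period //.
Qed.

Lemma rotation_order_gt0 j : (0 < rotation_order j)%N.
Proof. by rewrite /rotation_order; case: ex_minnP => p /andP[]. Qed.

Let rot2E : rot 2%:R = fun h : F => r 1 (r 0 h).
Proof. by apply/funext => f; rewrite /rot; congr (r _ (r _ _)); exact: val_inj. Qed.

Lemma face_rotation_order f : iter (rotation_order 2%:R) (fun h : F => r 1 (r 0 h)) f = f.
Proof. by rewrite -rot2E; move: f; apply/rotation_orderP. Qed.

Let rotation_order_gt1 j : (1 < rotation_order j)%N.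
Proof.
rewrite ltn_neqAle rotation_order_gt0 andbT; apply/eqP => E.
have /(_ f0) : forall f, iter 1 (rot j) f = f by apply/rotation_orderP; rewrite -E.
rewrite /= /rot => /(congr1 (r (j + 2%:R))); rewrite rK; apply: (flags_neq pf).
by rewrite ord3_add12.
Qed.

(** A product fixing one element of a group is trivial, so a power of a rotation fixes one triangle
    of the cover exactly when it is the identity on flags. *)
Lemma triangle_group_monodromy (col : F -> bool) : (forall i f, col (r i f) = ~~ col f) ->
  triangle_group adj (fun g => col (app g f0)) rotation_order.
Proof.
move=> colr; split.
- by move=> i g; rewrite (app_adj pf) colr.
- exact: rotation_order_gt1.
move=> j l g; rewrite -rotation_orderP.
have E f : app (iter l (fun h => adj (j + 2%:R) (adj (j + 1) h)) g) f = iter l (rot j) (app g f).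
  by elim: l => //= l IH; rewrite !(app_adj pf) IH.
split=> [Eg f|H]; first by rewrite -(app_Kinv g f) -E Eg.
by apply: (app_inj pf) => f; rewrite E.
Qed.

Section Hyperbolic.
Variable up : F -> bool.
Hypotheses (up_tr : forall z f, up (tr z f) = up f)
  (up2 : forall f, up (r 2%:R f) = up f) (up0 : forall f, up (r 0 f) = ~~ up f)
  (up_vertex : forall f, exists n, up (iter n (fun h : F => r 2%:R (r 1 h)) f) != up f)
  (up_face : forall f, exists n, up (iter n (fun h : F => r 1 (r 0 h)) f) != up f).

Let loop t p f : (0 < p)%N -> iter p t f = f -> (exists n, up (iter n t f) != up f) ->
  (2 <= \sum_(n < p) (up (iter n.+1 t f) != up (iter n t f)))%N.
Proof.
move=> p0 pE [n nE]; apply: (@changes_ge2 (fun n => up (iter n t f))); first by rewrite pE.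
exists (n %% p)%N; first exact: ltn_pmod.
by move: nE; rewrite {1}(divn_eq n p) addnC iterD iter_period.
Qed.

Let sum_rot t p (phi : F -> nat) : equi t -> injective t -> (forall z f, phi (tr z f) = phi f) ->
  (\sum_(c : C) \sum_(n < p) phi (iter n t (val c)) = p * \sum_(c : C) phi (val c))%N.
Proof.
move=> et it inv_phi; rewrite exchange_big /= (eq_bigr (fun=> \sum_(c : C) phi (val c))%N).
  by rewrite sum_nat_const card_ord.
by move=> n _; apply: sum_equi => //; [exact: iter_equi|exact: iter_inj].
Qed.

Lemma rotation_orders_hyperbolic (R : realType) :
  (exists f n, (0 < n < rotation_order 2%:R)%N /\ iter n (fun h : F => r 1 (r 0 h)) f = f) ->
  \sum_j (rotation_order j)%:R^-1 < 1 :> R.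
Proof.
move=> [f1 [n1 [/andP[n0 nQ] n1E]]].
set P := rotation_order 0; set Q := rotation_order 2%:R.
have rot0E : rot 0 = fun h : F => r 2%:R (r 1 h) by rewrite /rot !add0r.
have o1 : rotation_order 1%R = 2%N.
  have rot1E f : rot 1 f = r 0 (r 2%:R f).
    by rewrite /rot; congr (r _ (r _ _)); exact: val_inj.
  have d : (rotation_order 1%R %| 2)%N.
    by apply/rotation_orderP => f; rewrite /= !rot1E (flags02 pf) !rK.
  by apply/eqP; rewrite eqn_leq rotation_order_gt1 andbT; exact: dvdn_leq d.
pose mix f : nat := up (r 1 f) != up f; pose nmix f : nat := up (r 1 f) == up f.
pose N := #|{: C}|; pose Sm := (\sum_(c : C) mix (val c))%N; pose Sn := (\sum_(c : C) nmix (val c))%N.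
have SN : (Sm + Sn = N)%N.
  rewrite /Sm /Sn -big_split /= /N -sum1_card; apply: eq_bigr => c _.
  by rewrite /mix /nmix; case: eqP.
have SP : (2 * N <= P * Sm)%N.
  rewrite -(sum_rot P (@rot_equi 0) (@rot_inj 0)); last by move=> z f; rewrite /mix (flags_tr pf) !up_tr.
  rewrite mulnC /N -sum_nat_const; apply: leq_sum => c _.
  have := @loop (rot 0) P (val c); rewrite {2}rot0E => /(_ (rotation_order_gt0 0)).
  have E : iter P (rot 0) (val c) = val c by move: (val c); apply/rotation_orderP.
  move=> /(_ E (up_vertex _)) h; apply: leq_trans h _; apply: leq_sum => n _.
  by rewrite /mix iterS rot0E up2.
(* Along a face each step passes to the other end of an edge, where [up] is reversed. A change of
   [up] between consecutive edges therefore marks a corner whose two edges are both up or both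
   down. *)
have face f p : (0 < p)%N -> iter p (rot 2%:R%R) f = f ->
    (2 <= \sum_(n < p) nmix (r 0%R (iter n (rot 2%:R%R) f)))%N.
  move=> p0 pE; have := loop p0 pE; rewrite {1}rot2E => /(_ (up_face _)) h.
  apply: leq_trans h _; apply: leq_sum => n _.
  by rewrite /nmix iterS {1}rot2E up0; case: (up _) (up _) => -[].
have per f : iter Q (rot 2%:R%R) f = f by move: f; apply/rotation_orderP.
have Qn f : (2 <= \sum_(n < Q) nmix (r 0%R (iter n (rot 2%:R%R) f)))%N.
  by apply: face; [exact: rotation_order_gt0|exact: per].
have SQ : (2 * N < Q * Sn)%N.
  have inv0 z f : nmix (r 0 (tr z f)) = nmix (r 0 f) by rewrite /nmix !(flags_tr pf) !up_tr.
  have -> : (Q * Sn = \sum_(c : C) \sum_(n < Q) nmix (r 0%R (iter n (rot 2%:R%R) (val c))))%N.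
    rewrite (sum_rot Q (phi := fun f => nmix (r 0%R f)) (@rot_equi 2%:R) (@rot_inj 2%:R) inv0).
    rewrite (sum_equi (t := r 0)) //; [by move=> z f; rewrite (flags_tr pf)|exact: can_inj (rK 0)|].
    by move=> z f; rewrite /nmix (flags_tr pf) !up_tr.
  have -> : (2 * N = \sum_(c : C) 2)%N by rewrite sum_nat_const mulnC.
  rewrite (bigD1 (cl f1)) //= [ltnRHS](bigD1 (cl f1)) //= -addSn; apply: leq_add; last exact: leq_sum.
  have cE : iter n1 (rot 2%:R%R) (rc f1) = rc f1.
    have := n1E; rewrite -rot2E {1}(posE f1) (iter_equi _ (@rot_equi 2%:R)) {3}(posE f1).
    by move=> /(congr1 (tr (- pos f1))); rewrite !trN.
  have -> : Q = (n1 + (Q - n1))%N by rewrite subnKC // ltnW.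
  rewrite big_split_ord /=; apply: (@leq_trans (2 + 2)) => //; apply: leq_add; first exact: face.
  rewrite (eq_bigr (fun n : 'I_(Q - n1) => nmix (r 0%R (iter n (rot 2%:R%R) (rc f1))))); last first.
    by move=> n _; rewrite addnC iterD cE.
  by apply: face; [rewrite subn_gt0|have nQ' : (n1 <= Q)%N := ltnW nQ; move: (per (rc f1)); rewrite -{1}(subnK nQ') iterD cE].
have P0 : (0 < P)%N := rotation_order_gt0 0; have Q0 : (0 < Q)%N := rotation_order_gt0 2%:R.
(* From Sm >= 2N/P, Sn > 2N/Q and Sm + Sn = N it follows that 2/P + 2/Q < 1. *)
have PQ : (2 * (P + Q) < P * Q)%N.
  have N0 : (0 < N)%N by apply/card_gt0P; exists (cl f1).
  have : (N * (2 * (P + Q)) < N * (P * Q))%N by rewrite -{2}SN; nia.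
  by rewrite ltn_mul2l N0.
rewrite (sum3 _ 0) !add0r o1 -/P -/Q.
have Pr : 0 < P%:R :> R by rewrite ltr0n. have Qr : 0 < Q%:R :> R by rewrite ltr0n.
have PQr : 2 * (P%:R + Q%:R) < P%:R * Q%:R :> R by rewrite -natrD -!natrM ltr_nat.
have -> : P%:R^-1 + 2%:R^-1 + Q%:R^-1 = (2 * (P%:R + Q%:R) + P%:R * Q%:R) / (2 * (P%:R * Q%:R)) :> R.
  by field; rewrite !gt_eqF.
by rewrite ltr_pdivrMr ?mulr_gt0 //; lra.
Qed.

End Hyperbolic.

End Monodromy.

(** * The minimal regular cover *)

Section CoverGluing.
Variables (R : realType) (Y : topologicalType) (M : embedded_graph Y).
Hypothesis flag_adjK : forall i, involutive (@flag_adj Y M i).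
Local Notation X := (minimal_regular_cover_surface M R).
Local Notation Mon := (@Mon Y M).

Definition mon_adj (i : 'I_3) (g : Mon) : Mon :=
  SigSub (mem_set (Mon_mul (set_valP g) (@Mon_gen Y M i))).

Lemma mon_adjE i g : val (mon_adj i g) = @flag_adj Y M i \o val g.
Proof. by []. Qed.

Lemma Mon_word (g : flag M -> flag M) : Mon g -> exists w, g =1 word (@flag_adj Y M) w.
Proof.
elim=> {g} [i||g h _ [w gw] _ [w' hw]|g h _ [w gw] gh hg].
- by exists [:: i].
- by exists [::].
- by exists (w' ++ w) => f; rewrite /= foldr_cat -gw -hw.
by exists (rev w) => f; rewrite -{2}(hg f) gw (word_rev flag_adjK).
Qed.

Lemma word_Mon w : Mon (word (@flag_adj Y M) w).
Proof.
elim: w => [|i w IH]; first exact: Mon_one.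
exact: (Mon_mul IH (@Mon_gen Y M i)).
Qed.

Lemma ctr_in_simplex : ctr R \in simplex 3. Proof. exact/mem_set/simplex_ctr. Qed.

(** The interface wants maps defined on all row vectors; outside the simplex the centre is taken. *)
Definition to_simplex (p : 'rV[R]_3) : @simplex R 3 := insubd (SigSub ctr_in_simplex) p.

Lemma to_simplexE (p : 'rV[R]_3) : simplex 3 p -> val (to_simplex p) = p.
Proof. by move=> sp; rewrite insubdK //; exact/mem_set. Qed.

Lemma to_simplex_val (p : @simplex R 3) : to_simplex (val p) = p.
Proof. by apply/val_inj/to_simplexE/set_valP. Qed.

Let proj (a : cover_triangles M R) : X := (\pi_({eq_quot (@glued_equiv Y M R)}) a)%qT.

Definition cover_tri (g : Mon) (p : 'rV[R]_3) : X := proj (g : discrete_topology Mon, to_simplex p).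

Let mon_adjK i : involutive (mon_adj i).
Proof. by move=> g; apply: val_inj; apply/funext => f /=; rewrite flag_adjK. Qed.

Let glued_reach (a b : cover_triangles M R) : glued a b <->
  a.2 = b.2 /\ reach mon_adj (fun i => val a.2 ord0 i == 0) (b.1 : Mon) (a.1 : Mon).
Proof.
split=> [/asboolP|].
  elim=> {a b} [a b [i [E p0 a0]]|a|a b _ [E h]|a b c _ [E1 h1] _ [E2 h2]].
  - split=> //; have -> : a.1 = mon_adj i b.1 by apply: val_inj; rewrite mon_adjE -E.
    by apply: reach_step; [exact/eqP|exact: reach_refl].
  - by split=> //; exact: reach_refl.
  - by split=> //; rewrite -E; exact: (reach_sym mon_adjK).
  by split; [rewrite E1|apply: (reach_trans _ h1); rewrite E1].
case: a b => [g p] [h q] /= [-> gh]; apply/asboolP.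
elim: gh => [|i k Pi _ IH]; first exact: Relation_Operators.rst_refl.
apply: Relation_Operators.rst_trans IH; apply: Relation_Operators.rst_step; exists i; split=> //; exact/eqP.
Qed.

Lemma cover_gluing : gluing mon_adj cover_tri.
Proof.
split.
- exact: mon_adjK.
- move=> U UV; change (open (proj @^-1` U)).
  rewrite openE => -[g p] /= Up; have [V oV VU] := UV g.
  have vp : V (val p) by apply/VU; [exact: set_valP|rewrite /cover_tri to_simplex_val].
  exists ([set g], [set q : @simplex R 3 | V (val q)]) => /=.
    split; first exact: discrete_set1.
    by apply: (@initial_continuous _ _ (@set_val _ (simplex 3)) p); apply: open_nbhs_nbhs.
  move=> -[h q] /= [-> Vq]; rewrite /= -(to_simplex_val q); apply/VU => //; exact: set_valP.
- move=> g; apply/subspace_continuousP => p sp U nU.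
  have : nbhs ((g : discrete_topology Mon, to_simplex p) : cover_triangles M R) (proj @^-1` U).
    exact: (@pi_continuous (cover_triangles M R) {eq_quot (@glued_equiv Y M R)}%qT).
  move=> [[A B] /= [nA nB] AB]; move: nB; rewrite nbhsE => -[Q [ [W oW WO] Op] OB].
  have Wp : W p by move: Op; rewrite -WO -{2}(to_simplexE sp).
  apply: filterS (open_nbhs_nbhs (conj oW Wp)) => q Wq sq.
  apply: (AB (g, to_simplex q)); split=> /=; first exact: (nbhs_singleton nA).
  by apply: OB; move: Wq; rewrite -WO -{1}(to_simplexE sq).
- move=> x; have <- : proj (generic_quotient.repr (x : {eq_quot (@glued_equiv Y M R)}%qT)) = x by exact: reprK.
  case: (generic_quotient.repr _) => g p; exists g, (val p); split; first exact: set_valP.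
  by rewrite /cover_tri to_simplex_val.
move=> g h p q sp sq; split.
  move=> /eqmodP/glued_reach [/= /(congr1 val)]; rewrite !to_simplexE // => pq gh.
  by split=> //; exact: (reach_sym mon_adjK).
move=> [pq gh]; apply/eqmodP/glued_reach; split=> /=; first by rewrite pq.
by rewrite to_simplexE //; exact: (reach_sym mon_adjK).
Qed.

End CoverGluing.

(** * Plane maps with convex faces *)

Section OpenConvex.
Variable R : realType.
Notation plane := 'rV[R]_2.
Implicit Types (x y z p q : plane) (A F : set plane).

Lemma near_affine (c : R) (b x : plane) A : nbhs (c *: x + b) A -> \forall w \near x, A (c *: w + b).
Proof.
have h : (fun w : plane => c *: w + b) @ nbhs x --> (c *: x + b).
  apply: cvg_rV => i; rewrite vaddE vscaleE; under eq_cvg do rewrite vaddE vscaleE.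
  apply: cvgD; last exact: cvg_cst.
  by apply: cvgM; [exact: cvg_cst|exact: coord_continuous].
by move=> nA; exact: (h _ nA).
Qed.

Lemma near_box x A : nbhs x A -> exists2 e : R, 0 < e &
  forall w : plane, `|w ord0 i0| < e -> `|w ord0 i1| < e -> A (x + w).
Proof.
move=> /nbhs_ballP[e /= e0 eA]; exists e => // w w0 w1; apply: eA; split=> // i j; rewrite (ord1 i).
have jE : j = i0 \/ j = i1 by case: j => -[|[|//]] h; [left|right]; exact: val_inj.
by rewrite -ball_normE /= vaddE opprD addrA subrr add0r normrN; case: jE => ->.
Qed.

Lemma plane_coord (u w v : plane) : det2 u w != 0 ->
  v = (det2 v w / det2 u w) *: u + (det2 u v / det2 u w) *: w.
Proof. by rewrite /det2 => D0; apply: row2P; rewrite !vecE; field. Qed.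

Lemma convex_polygonP F : convex_polygon F ->
  [/\ open F, forall x y (t : R), F x -> F y -> 0 <= t <= 1 -> F (x + t *: (y - x)) &
      exists B : R, forall p i, F p -> `|p ord0 i| <= B].
Proof.
move=> [s ->]; set C := smallest _ _.
have cC x y (t : R) : C x -> C y -> 0 <= t <= 1 -> C (x + t *: (y - x)).
  move=> Cx Cy /andP[t0 t1] S [/= cS sS].
  have Sx : x \in S by apply/mem_set; exact: (Cx S (conj cS sS)).
  have Sy : y \in S by apply/mem_set; exact: (Cy S (conj cS sS)).
  have := cS y x (Itv01 t0 t1) Sy Sx => /set_mem; rewrite /conv /= => h.
  suff -> : x + t *: (y - x) = t *: y + (1 - t) *: x by [].
  by apply: row2P; rewrite !vecE; ring.
split; first exact: open_interior.
- move=> x y t Cx Cy t01; set z := x + _.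
  have h1 : \forall w \near z, C (1 *: w + (x - z)).
    by apply: near_affine; rewrite scale1r addrC subrK.
  have h2 : \forall w \near z, C (1 *: w + (y - z)).
    by apply: near_affine; rewrite scale1r addrC subrK.
  rewrite /interior; apply: filterS2 h1 h2 => w w1 w2.
  have := cC _ _ t w1 w2 t01; congr C; apply: row2P; rewrite /z !vecE; ring.
exists (\sum_(v <- s) (`|v ord0 i0| + `|v ord0 i1|)) => p i Cp.
pose Q : set plane := [set v | forall i, `|v ord0 i| <= \sum_(v <- s) (`|v ord0 i0| + `|v ord0 i1|)].
have : C `<=` Q.
  apply: smallest_sub; last first.
    move=> v /= vs j; rewrite (big_rem v) //=.
    apply: (@le_trans _ _ (`|v ord0 i0| + `|v ord0 i1|)); last first.
      by rewrite lerDl sumr_ge0 // => u _; rewrite addr_ge0.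
    have jE : j = i0 \/ j = i1 by case: j => -[|[|//]] h; [left|right]; exact: val_inj.
    by case: jE => ->; [rewrite lerDl|rewrite lerDr].
  move=> x y l /set_mem Qx /set_mem Qy; apply/mem_set => j; rewrite /conv /= !vecE.
  have l0 : 0 <= l%:num by []. have l1 : 0 <= 1 - l%:num by rewrite subr_ge0.
  apply: le_trans (ler_normD _ _) _; rewrite !normrM (ger0_norm l0) (ger0_norm l1).
  have := Qx j; have := Qy j; set a := `|_|; set b := `|_|; set S := \sum_(_ <- _) _; nra.
by move=> /(_ p (interior_subset Cp)) /(_ i).
Qed.

Variable F : set plane.
Hypotheses (oF : open F) (cF : forall x y (t : R), F x -> F y -> 0 <= t <= 1 -> F (x + t *: (y - x))).

(** A small displacement of the closure point [x] into [F] is compensated by a displacement of [p],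
    for which there is room because [F] is open. *)
Lemma closure_open_segment x p (t : R) : closure F x -> F p -> 0 < t <= 1 -> F (x + t *: (p - x)).
Proof.
move=> cx Fp /andP[t0 t1]; have tn : t != 0 by rewrite gt_eqF.
have h : \forall w \near x, F ((- ((1 - t) / t)) *: w + (p + ((1 - t) / t) *: x)).
  apply: near_affine; apply: open_nbhs_nbhs; split=> //.
  by rewrite scaleNr addrCA addNr addr0.
have [w [Fw Fw']] := cx _ h.
have := cF Fw Fw'; move=> /(_ t); rewrite (ltW t0) t1 => /(_ isT); congr F.
by apply: row2P; rewrite !vecE; field.
Qed.

Lemma closure_segment x y (t : R) : closure F x -> closure F y -> 0 <= t <= 1 ->
  closure F (x + t *: (y - x)).
Proof.
move=> cx cy /andP[t0 t1]; have [->|tn] := eqVneq t 0; first by rewrite scale0r addr0.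
move=> U nU; have h : \forall w \near y, U (t *: w + (1 - t) *: x).
  apply: near_affine; move: nU; congr (nbhs _ U); apply: row2P; rewrite !vecE; ring.
have [w [Fw Uw]] := cy _ h; exists (x + t *: (w - x)); split.
  by apply: closure_open_segment => //; rewrite lt_neqAle eq_sym tn t0.
by move: Uw; congr U; apply: row2P; rewrite !vecE; ring.
Qed.

(** The given point is pushed slightly away from a point [p] of [F]. The result still lies in the
    closed triangle, hence in the closure of [F], and the given point lies strictly between it and
    [p]. *)
Lemma open_triangle x y z (b c : R) : closure F x -> closure F y -> closure F z ->
  det2 (y - x) (z - x) != 0 -> 0 < b -> 0 < c -> b + c < 1 ->
  F (x + (b *: (y - x) + c *: (z - x))).
Proof.
move=> cx cy cz D0 b0 c0 bc; have [p [Fp _]] := cx _ (@filterT _ (nbhs x) _).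
set D := det2 _ _ in D0; pose be := det2 (p - x) (z - x) / D; pose ga := det2 (y - x) (p - x) / D.
have pE : p = x + (be *: (y - x) + ga *: (z - x)).
  by rewrite -plane_coord // addrC subrK.
(* [m] is the margin by which the point is inside the triangle; a push of relative size [e] moves
   the two coordinates by at most half of it in total. *)
pose K := `|b - be| + `|c - ga| + 1; pose m := Num.min b (Num.min c (1 - b - c)).
have m0 : 0 < m by rewrite !lt_min b0 c0 /=; lra.
have K0 : 0 < K by rewrite /K; have := normr_ge0 (b - be); have := normr_ge0 (c - ga); lra.
pose e := m / (2 * K); have e0 : 0 < e by rewrite divr_gt0 // mulr_gt0.
have eK : e * K = m / 2 by rewrite /e; field; rewrite gt_eqF.
have [mb [mc mbc]] : m <= b /\ m <= c /\ m <= 1 - b - c.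
  by split; [rewrite ge_min lexx|split; rewrite !ge_min lexx ?orbT].
pose b' := b + e * (b - be); pose c' := c + e * (c - ga).
have nb : `|e * (b - be)| + `|e * (c - ga)| <= m / 2.
  by rewrite (normrM e (b - be)) (normrM e (c - ga)) (gtr0_norm e0) -mulrDr -eK ler_pM2l // /K lerDl.
have := ler_norm (e * (b - be)); have := ler_norm (e * (c - ga)).
have := ler_norm (- (e * (b - be))); have := ler_norm (- (e * (c - ga))); rewrite !normrN => n1 n2 n3 n4.
have b'0 : 0 < b' by rewrite /b'; have := normr_ge0 (e * (c - ga)); lra.
have c'0 : 0 < c' by rewrite /c'; have := normr_ge0 (e * (b - be)); lra.
have bc' : b' + c' < 1 by rewrite /b' /c'; lra.
pose s := b' + c'; have s0 : 0 < s by rewrite addr_gt0.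
have cw : closure F (y + (c' / s) *: (z - y)).
  by apply: closure_segment => //; apply/andP; split; [exact: divr_ge0 (ltW c'0) (ltW s0)|rewrite ler_pdivrMr // mul1r /s lerDr; exact: ltW].
have cq : closure F (x + s *: (y + (c' / s) *: (z - y) - x)).
  by apply: closure_segment => //; rewrite (ltW s0) (ltW bc').
have := @closure_open_segment _ _ (e / (1 + e)) cq Fp.
have e1 : 0 < 1 + e by rewrite addr_gt0.
rewrite divr_gt0 //= ler_pdivrMr // mul1r lerDr ler01 => /(_ isT); congr F.
have sE : s = b + e * (b - be) + (c + e * (c - ga)) by [].
have sn : s != 0 by rewrite gt_eqF. have en : 1 + e != 0 by rewrite gt_eqF.
have -> : s *: (y + (c' / s) *: (z - y) - x) = b' *: (y - x) + c' *: (z - x).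
  by apply: row2P; rewrite !vecE /s; field.
by rewrite {1}pE /b' /c'; apply: row2P; rewrite !vecE; field.
Qed.

End OpenConvex.

(** * Straight edges and the sides of an edge *)

Section PlaneMapGeometry.
Variables (R : realType) (M : embedded_graph 'rV[R]_2).
Hypotheses (Mm : is_map M R) (Mc : forall F, is_face M F -> convex_polygon F).
Notation plane := 'rV[R]_2.
Notation flag := (flag M).
Implicit Types (F : set plane) (e : set plane) (x y p q v d : plane) (f g h : flag).

Lemma face_open F : is_face M F -> open F. Proof. by move=> /Mc/convex_polygonP[]. Qed.
Lemma face_convex F : is_face M F -> forall x y (t : R), F x -> F y -> 0 <= t <= 1 -> F (x + t *: (y - x)).
Proof. by move=> /Mc/convex_polygonP[]. Qed.

Lemma face_skeleton F x : is_face M F -> F x -> ~ skeleton M x.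
Proof. by move=> [y _ ->] /connected_component_sub. Qed.

Lemma face_eq F F' x : is_face M F -> is_face M F' -> F x -> F' x -> F = F'.
Proof.
by move=> [y _ ->] [z _ ->] /same_connected_component -> /same_connected_component ->.
Qed.

Lemma face_nonempty F : is_face M F -> exists x, F x.
Proof. by move=> [y ny ->]; exists y; exact: connected_component_refl. Qed.

Definition vtx f : plane := (val f).1.1.
Definition edg f : set plane := (val f).1.2.
Definition fce f : set plane := (val f).2.

Lemma flagP f : [/\ vertices M (vtx f), edges M (edg f), is_face M (fce f),
  edg f (vtx f) & edg f `<=` closure (fce f)].
Proof. exact: (set_valP f). Qed.

Lemma mk_flag v e F : vertices M v -> edges M e -> is_face M F -> e v -> e `<=` closure F ->
  exists f, [/\ vtx f = v, edg f = e & fce f = F].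
Proof. by move=> h1 h2 h3 h4 h5; have h : is_flag M (v, e, F); [by []|exists (SigSub (mem_set h))]. Qed.

Lemma flag_eq f g : vtx f = vtx g -> edg f = edg g -> fce f = fce g -> f = g.
Proof.
rewrite /vtx /edg /fce => h1 h2 h3; apply: val_inj.
by move: h1 h2 h3; case: (val f) => [[a b] c]; case: (val g) => [[a' b'] c'] /= -> -> ->.
Qed.

Let fv f : vertices M (vtx f). Proof. by case: (flagP f). Qed.
Let fe f : edges M (edg f). Proof. by case: (flagP f). Qed.
Let ff f : is_face M (fce f). Proof. by case: (flagP f). Qed.
Let fev f : edg f (vtx f). Proof. by case: (flagP f). Qed.
Let fcl f : edg f `<=` closure (fce f). Proof. by case: (flagP f). Qed.

Lemma edge_skeleton e x : edges M e -> e x -> skeleton M x.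
Proof. by move=> Ee ex; right; exists e. Qed.

Let T := sval (cid (map_triangulated Mm)).
Let TP := svalP (cid (map_triangulated Mm)).
Definition tri_of f : set plane := T (val f) @` simplex 3.

Let T1 f : [/\ {within simplex 3, continuous (T (val f))},
  forall p : 'rV[R]_3, simplex 3 p -> p ord0 0 = 1 -> T (val f) p = vtx f,
  forall p : 'rV[R]_3, simplex 3 p -> p ord0 2%:R = 0 -> edg f (T (val f) p) &
  forall p : 'rV[R]_3, simplex 3 p -> p ord0 2%:R != 0 -> fce f (T (val f) p)].
Proof. have [h _ _ _] := TP; exact: (h (val f) (set_valP f)). Qed.

Lemma tri_meet f g x : tri_of f x -> tri_of g x ->
  [\/ fce f = fce g, edg f = edg g | vtx f = vtx g].
Proof.
move=> [p sp px] [q sq qx]; have [_ h _ _] := TP.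
have [pq H] : p = q /\ forall i, p ord0 i != 0 -> same_element i (val f) (val g).
  by apply/(h (val f) (val g)); [exact: set_valP|exact: set_valP|by []|by []|exact: etrans px (esym qx)].
have [i ni] : exists i, p ord0 i != 0.
  apply: contrapT => no; have [_ ] := sp; rewrite big1 => [/eqP|i _]; first by rewrite eq_sym oner_eq0.
  by apply/eqP/negPn/negP => ni; apply: no; exists i.
by case: i ni => -[|[|[|//]]] k3 /H; [constructor 3|constructor 2|constructor 1].
Qed.

Lemma tri_compact f : compact (tri_of f).
Proof.
apply: continuous_compact; [by have [] := T1 f|exact: simplex_compact].
Qed.

Lemma tri_vertex f : tri_of f (vtx f).
Proof.
have [_ h _ _] := T1 f; exists (row3 0 1 0 0); first exact: vertex_simplex.
by apply: h; [exact: vertex_simplex|rewrite row3_0].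
Qed.

Lemma tri_sub f x : tri_of f x -> fce f x \/ edg f x.
Proof.
have [_ _ h1 h2] := T1 f; move=> [p sp <-].
by have [p0|p0] := eqVneq (p ord0 2%:R) 0; [right; exact: h1|left; exact: h2].
Qed.

Lemma tri_cover x : exists f, tri_of f x.
Proof.
have [_ _ h _] := TP; have : setT x by []; rewrite -h => -[f Ff [p sp E]].
by exists (SigSub (mem_set Ff)); exists p.
Qed.

Lemma tri_locally_finite x : exists2 U, nbhs x U & finite_set [set f | tri_of f `&` U !=set0].
Proof.
have [_ _ _ h] := TP; have [U nU fU] := h x; exists U => //.
apply: (@sub_finite_set _ _ ((fun f : flag => val f) @^-1`
   [set f | is_flag M f /\ T f @` simplex 3 `&` U !=set0])).
  by move=> f /= ?; split=> //; exact: set_valP.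
by apply: finite_preimage fU => f g _ _; exact: val_inj.
Qed.

Lemma tri_union_closed (P : set flag) : closed (\bigcup_(f in P) tri_of f).
Proof.
move=> x cx; have [U nU fU] := tri_locally_finite x.
pose L := P `&` [set f | tri_of f `&` U !=set0].
have fL : finite_set L by apply: sub_finite_set fU => f [].
suff : (\bigcup_(f in L) tri_of f) x by move=> [f [Pf _] fx]; exists f.
have cK : closed (\bigcup_(f in L) tri_of f).
  apply: compact_closed; first exact: norm_hausdorff.
  rewrite -(bigsetU_fset_set _ fL); apply: bigsetU_compact => f _; exact: tri_compact.
apply: cK => W nW; have [y [[f Pf fy] [Wy Uy]]] := cx _ (filterI nW nU).
by exists y; split=> //; exists f => //; split=> //; exists y.
Qed.

Lemma compact_tri_finite (K : set plane) : compact K -> finite_set [set f | tri_of f `&` K !=set0].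
Proof.
move=> /compact_near_coveringP cK.
pose F := filter_from [set Om : set flag | finite_set Om] (fun Om => [set Om' | Om `<=` Om']).
have FF : Filter F.
  apply: filter_from_filter; first by exists set0; exact: finite_set0.
  move=> A B fA fB; exists (A `|` B); first by rewrite /= finite_setU.
  by move=> C AB; split=> z zA; apply: AB; [left|right].
have [|Om fOm H] := cK _ F (fun Om x => forall h, tri_of h x -> Om h) FF.
  move=> x _; have [U nU fU] := tri_locally_finite x.
  exists (U, [set Om | [set f | tri_of f `&` U !=set0] `<=` Om]).
    by split=> //; exists [set f | tri_of f `&` U !=set0].
  by move=> [y Om] [/= Uy sOm] h hy; apply: sOm; exists y.
apply: sub_finite_set fOm => h [x [hx Kx]]; exact: (H Om _ x Kx h hx).
Qed.

Lemma tri_face f F x : is_face M F -> tri_of f x -> F x -> fce f = F.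
Proof.
move=> fF /tri_sub [fx|ex] Fx; first exact: face_eq fx Fx.
by have := face_skeleton fF Fx; case; exact: edge_skeleton ex.
Qed.

Lemma closure_face_tri F x : is_face M F -> closure F x -> exists2 f, fce f = F & tri_of f x.
Proof.
move=> fF cx.
have sub : F `<=` \bigcup_(f in [set f | fce f = F]) tri_of f.
  by move=> y Fy; have [f fy] := tri_cover y; exists f => //=; exact: tri_face fy Fy.
have [f /= fE fx] : (\bigcup_(f in [set f | fce f = F]) tri_of f) x.
  by apply: tri_union_closed; exact: closure_subset sub _ cx.
by exists f.
Qed.

Definition seg_of (a b : plane) : set plane := [set x | exists2 t : R, 0 <= t <= 1 & x = a + t *: (b - a)].

Lemma dot2_gt0 d : d != 0 -> 0 < dot2 d d.
Proof.
move=> d0; rewrite lt_neqAle; apply/andP; split; last first.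
  by rewrite /dot2 -!expr2 addr_ge0 // sqr_ge0.
apply: contra d0; rewrite eq_sym /dot2 -!expr2 paddr_eq0 ?sqr_ge0 // !sqrf_eq0.
by move=> /andP[/eqP h0 /eqP h1]; apply/eqP/row2P; rewrite ?h0 ?h1 mxE.
Qed.

Lemma det2_eq0 d v : d != 0 -> det2 d v = 0 -> v = (dot2 v d / dot2 d d) *: d.
Proof.
move=> /dot2_gt0 n0 D0; have n : dot2 d d != 0 by rewrite gt_eqF.
apply: row2P; rewrite !vecE; apply: (mulIf n); rewrite mulrAC divfK //; move: D0; rewrite /det2 /dot2.
  by move=> D0; rewrite -[RHS]addr0 -[0](mulr0 (- d ord0 i1)) -D0; ring.
by move=> D0; rewrite -[RHS]addr0 -[0](mulr0 (d ord0 i0)) -D0; ring.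
Qed.

Lemma edge_faces e : edges M e -> exists F F',
  [/\ F <> F', is_face M F /\ e `<=` closure F, is_face M F' /\ e `<=` closure F' &
      forall G, is_face M G -> e `<=` closure G -> G = F \/ G = F'].
Proof.
move=> Ee; have [F [F' [FF' E]]] := map_two_faces Mm Ee; exists F, F'; split=> //.
- by have : [set F; F'] F; [left|rewrite -E].
- by have : [set F; F'] F'; [right|rewrite -E].
by move=> G fG eG; have : [set F; F'] G by rewrite -E.
Qed.

(** The edge lies in the closures of two different convex faces. If a point of it were off the line
    through its ends, the open triangle so obtained would lie in both faces. The arc is therefore
    collinear, and the intermediate value theorem identifies it with the segment. *)
Lemma edge_segment e : edges M e -> exists a b,
  [/\ a != b, vertices M a, vertices M b, e = seg_of a b & e `&` vertices M = [set a; b]].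
Proof.
move=> Ee; have [ga [cg ig eE eV]] := map_arcs Mm Ee.
have i0_ : (0 : R) \in `[0, 1] by rewrite in_itv /= lexx ler01.
have i1_ : (1 : R) \in `[0, 1] by rewrite in_itv /= lexx ler01.
pose a := ga 0; pose b := ga 1.
have ab : a != b by apply/eqP => /(ig _ _ i0_ i1_)/eqP; rewrite eq_sym oner_eq0.
have Va : vertices M a by have : [set a; b] a; [left|rewrite -eV => -[]].
have Vb : vertices M b by have : [set a; b] b; [right|rewrite -eV => -[]].
have ea : e a by have : [set a; b] a; [left|rewrite -eV => -[]].
have eb : e b by have : [set a; b] b; [right|rewrite -eV => -[]].
exists a, b; split=> //; pose d := b - a; have d0 : d != 0 by rewrite subr_eq0 eq_sym.
have n0 : dot2 d d != 0 by rewrite gt_eqF // dot2_gt0.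
have coll x : e x -> det2 d (x - a) = 0.
  move=> ex; have [F [F' [FF' [fF eF] [fF' eF'] _]]] := edge_faces Ee.
  apply/eqP/negPn/negP => D0; apply: FF'.
  have t0 : 0 < 3^-1 :> R by rewrite invr_gt0.
  have t1 : 3^-1 + 3^-1 < 1 :> R by lra.
  have h := open_triangle (face_open fF) (face_convex fF) (eF _ ea) (eF _ eb) (eF _ ex) D0 t0 t0 t1.
  have h' := open_triangle (face_open fF') (face_convex fF') (eF' _ ea) (eF' _ eb) (eF' _ ex) D0 t0 t0 t1.
  exact: face_eq h h'.
pose ph s := (dot2 (ga s) d - dot2 a d) / dot2 d d.
have phE s : s \in `[0, 1] -> ga s = a + ph s *: d.
  move=> s01; have es : e (ga s) by rewrite eE; exists s.
  rewrite -[LHS](subrK a) addrC (det2_eq0 d0 (coll _ es)); congr (_ + _ *: _); congr (_ / _).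
  by rewrite /dot2 !vecE; ring.
have cph : {within `[0, 1], continuous ph}.
  move=> s; apply: cvgM; last exact: cvg_cst.
  by apply: cvgB; [apply: cvg_dot2; [exact: cg|exact: cvg_cst]|exact: cvg_cst].
have ph0 : ph 0 = 0 by rewrite /ph subrr mul0r.
have ph1 : ph 1 = 1.
  rewrite /ph -/b (_ : _ - _ = dot2 d d) ?divff // /dot2 /d !vecE; ring.
have sub s t : 0 <= s -> t <= 1 -> {within `[s, t], continuous ph}.
  by move=> s0 t1; apply: continuous_subspaceW cph => x /=; rewrite !in_itv /= => /andP[h1 h2]; apply/andP; split; lra.
apply/seteqP; split=> [x ex|x [t /andP[t0 t1] ->]].
  have : (ga @` `[0, 1]) x by rewrite -eE.
  move=> [s s01 <-]; exists (ph s); last exact: phE.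
  have /andP[s0 s1] : 0 <= s <= 1 by move: s01; rewrite /= in_itv.
  rewrite !leNgt; apply/andP; split; apply/negP => hs.
    (* Overshooting an end would make the arc pass through this end again, against injectivity. *)
    have [c c01 c0] : exists2 c, c \in `[s, 1] & ph c = 0.
      by apply: IVT => //; [exact: sub|rewrite ph1 ge_min le_max ler01 (ltW hs) orbT].
    have c01' : c \in `[0, 1] by move: c01; rewrite !in_itv /= => /andP[h1 h2]; apply/andP; split; lra.
    have : c = 0 by apply: ig => //; rewrite phE // phE // ph0 c0.
    move=> cz; move: c01; rewrite in_itv /= cz => /andP[sc _].
    have sz : s = 0 by lra. by move: hs; rewrite sz ph0 ltxx.
  have [c c01 c1] : exists2 c, c \in `[0, s] & ph c = 1.
    by apply: IVT => //; [exact: sub|rewrite ph0 ge_min le_max ler01 (ltW hs) orbT].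
  have c01' : c \in `[0, 1] by move: c01; rewrite !in_itv /= => /andP[h1 h2]; apply/andP; split; lra.
  have : c = 1 by apply: ig => //; rewrite phE // phE // ph1 c1.
  move=> cz; move: c01; rewrite in_itv /= cz => /andP[_ sc].
  have sz : s = 1 by lra. by move: hs; rewrite sz ph1 ltxx.
have [s s01 st] : exists2 s, s \in `[0, 1] & ph s = t.
  by apply: IVT => //; rewrite ph0 ph1 minEle maxEle ler01 t0.
by rewrite eE; exists s => //; rewrite phE // st.
Qed.

Lemma flag_edge f : exists w, [/\ w != vtx f, vertices M w, edg f = seg_of (vtx f) w &
  edg f `&` vertices M = [set vtx f; w]].
Proof.
have [a [b [ab Va Vb eE eV]]] := edge_segment (fe f).
have : [set a; b] (vtx f) by rewrite -eV; split; [exact: fev|exact: fv].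
move=> [->|->]; first by exists b; rewrite eq_sym.
exists a; split=> //; last by rewrite eV setUC.
rewrite eE; apply/seteqP; split=> x [t /andP[t0 t1] ->]; exists (1 - t); try (by apply/andP; split; lra).
  by apply: row2P; rewrite !vecE; ring.
by apply: row2P; rewrite !vecE; ring.
Qed.

Definition hd f := sval (cid (flag_edge f)).
Lemma hdP f : [/\ hd f != vtx f, vertices M (hd f), edg f = seg_of (vtx f) (hd f) &
  edg f `&` vertices M = [set vtx f; hd f]].
Proof. exact: (svalP (cid (flag_edge f))). Qed.

Lemma hd_edg f : edg f (hd f).
Proof. by have [_ _ _ E] := hdP f; have : [set vtx f; hd f] (hd f); [right|rewrite -E => -[]]. Qed.

Lemma vertex_of_edge f v : edg f v -> vertices M v -> v = vtx f \/ v = hd f.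
Proof. by move=> ev Vv; have [_ _ _ E] := hdP f; have : [set vtx f; hd f] v by rewrite -E. Qed.

Lemma hd_eq f g : vtx f = vtx g -> edg f = edg g -> hd f = hd g.
Proof.
move=> vE eE; have [n1 V1 _ _] := hdP f; have [n2 _ _ _] := hdP g.
have := hd_edg f; rewrite eE => /vertex_of_edge/(_ V1) [E|//].
by move: n1; rewrite vE E eqxx.
Qed.

Definition dir f := hd f - vtx f.

Lemma dir_neq0 f : dir f != 0. Proof. by rewrite subr_eq0; case: (hdP f). Qed.

Lemma dir_eq f g : vtx f = vtx g -> edg f = edg g -> dir f = dir g.
Proof. by move=> vE eE; rewrite /dir (hd_eq vE eE) vE. Qed.

Definition side f p := det2 (dir f) (p - vtx f).

Lemma edg_point f (t : R) : 0 <= t <= 1 -> edg f (vtx f + t *: dir f).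
Proof. by move=> t01; have [_ _ -> _] := hdP f; exists t. Qed.

Let vskel v : vertices M v -> skeleton M v. Proof. by left. Qed.

(** A point of the face on the line of the edge would lie on the edge, or beyond one of its ends; in
    the latter case that vertex would be strictly between the point and the other end, hence in the
    face. *)
Lemma side_neq0 f p : fce f p -> side f p != 0.
Proof.
move=> Fp; apply/eqP => /(det2_eq0 (dir_neq0 f)); set s := _ / _ => E.
have pE : p = vtx f + s *: dir f by rewrite -E addrC subrK.
have cv := fcl (fev f); have ch := fcl (hd_edg f).
have [_ Vh _ _] := hdP f.
have [s0|s0] := ltP s 0.
  apply: (face_skeleton (ff f) _ (vskel (fv f))).
  have h0 : 0 < 1 - s by rewrite subr_gt0 (lt_trans s0 ltr01).
  have h1 : 1 <= 1 - s by rewrite lerDl oppr_ge0 ltW.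
  have := closure_open_segment (face_open (ff f)) (face_convex (ff f)) ch Fp (t := (1 - s)^-1).
  rewrite invr_gt0 (invf_le1 h0) h0 h1 => /(_ isT); congr (fce f); rewrite pE /dir.
  by apply: row2P; rewrite !vecE; field; rewrite gt_eqF.
have [s1|s1] := ltP 1 s.
  apply: (face_skeleton (ff f) _ (vskel Vh)).
  have h0 : 0 < s by rewrite (lt_trans ltr01 s1).
  have := closure_open_segment (face_open (ff f)) (face_convex (ff f)) cv Fp (t := s^-1).
  rewrite invr_gt0 (invf_le1 h0) h0 (ltW s1) => /(_ isT); congr (fce f); rewrite pE /dir.
  by apply: row2P; rewrite !vecE; field; rewrite gt_eqF.
apply: (face_skeleton (ff f) Fp); apply: edge_skeleton (fe f) _.
by rewrite pE; apply: edg_point; rewrite s0.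
Qed.

Lemma side_same f p q : fce f p -> fce f q -> 0 < side f p * side f q.
Proof.
move=> Fp Fq; have p0 := side_neq0 Fp; have q0 := side_neq0 Fq.
rewrite lt_neqAle eq_sym mulf_neq0 //= leNgt; apply/negP => neg.
set a := side f p in p0 neg *; set b := side f q in q0 neg *.
have D0 : a - b != 0.
  apply: contra_neq p0 => E; have E' : b = a by lra.
  by move: neg; rewrite E' -expr2 ltNge sqr_ge0.
pose t := a / (a - b).
have tE : t * (a - b) = a by rewrite divfK.
have t01 : 0 <= t <= 1.
  have [ab|ab|ab] := ltgtP (a - b) 0; last by rewrite ab eqxx in D0.
    have [a0 b0] : a <= 0 /\ 0 <= b by split; nra.
    have -> : t = - a / (b - a) by rewrite /t -(opprB a b) invrN mulrNN.
    by rewrite divr_ge0 ?ler_pdivrMr /=; lra.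
  have [a0 b0] : 0 <= a /\ b <= 0 by split; nra.
  by rewrite divr_ge0 ?ler_pdivrMr /=; lra.
have := side_neq0 (face_convex (ff f) Fp Fq t01); apply/negP/negPn/eqP.
have -> : side f (p + t *: (q - p)) = a - t * (a - b).
  by rewrite /a /b /side /det2 !vecE; ring.
by rewrite tE subrr.
Qed.

(** The orientation of the flag: whether its face is to the left of its edge directed away from its
    vertex. *)
Definition col f : bool := `[< exists2 p, fce f p & 0 < side f p >].
Definition sg f : R := if col f then 1 else -1.

Lemma side_pos f p : fce f p -> 0 < sg f * side f p.
Proof.
move=> Fp; rewrite /sg /col; case: asboolP => [[q Fq q0]|no].
  by have := side_same Fp Fq; rewrite mul1r pmulr_lgt0.
rewrite mulN1r oppr_gt0 ltNge le_eqVlt negb_or eq_sym side_neq0 //=.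
by apply/negP => p0; apply: no; exists p.
Qed.

Lemma side_cl f p : closure (fce f) p -> 0 <= sg f * side f p.
Proof.
move=> cp; rewrite leNgt; apply/negP => neg.
have c : {for p, continuous (fun x : plane => sg f * side f x)}.
  rewrite (_ : (fun x => _) = fun x : plane => sg f *
    (dir f ord0 i0 * (x ord0 i1 - vtx f ord0 i1) - dir f ord0 i1 * (x ord0 i0 - vtx f ord0 i0))); last first.
    by apply/funext => x; rewrite /side /det2 !vecE.
  apply: contM; first exact: cont_cst.
  by apply: contB; (apply: contM; first exact: cont_cst); apply: contB; (exact: cont_cst || exact: coord_continuous).
have [x [Fx xn]] := cp _ (near_lt c neg).
by have := lt_trans xn (side_pos Fx); rewrite ltxx.
Qed.

(** Two faces on the same side of an edge overlap close to its midpoint, hence coincide. *)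
Lemma two_sides f g : vtx f = vtx g -> edg f = edg g -> col f = col g -> fce f = fce g.
Proof.
move=> vE eE cE; have [p Fp] := face_nonempty (ff f); have [p' Fp'] := face_nonempty (ff g).
have dE := dir_eq vE eE; have := side_pos Fp; have := side_pos Fp'.
rewrite /sg -cE /side -dE -vE; set s := if _ then _ else _; set d := dir f; set v := vtx f.
set D' := det2 _ _; set D := det2 _ _ => sD' sD.
pose m := v + 2^-1 *: d.
have Dm : det2 d (p - m) = D by rewrite /D /m /det2 !vecE; ring.
have D'm : det2 d (p' - m) = D' by rewrite /D' /m /det2 !vecE; ring.
have D0 : D != 0 by apply/eqP => E; move: sD; rewrite E mulr0 ltxx.
have rho0 : 0 < D' / D.
  have : 0 < (s * D') * (s * D) by rewrite mulr_gt0.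
  rewrite mulrACA => h; have h' : 0 < D' * D.
    have ss : s * s = 1 by rewrite /s; case: (col f); rewrite ?mulr1 ?mulN1r ?opprK.
    by rewrite ss mul1r in h.
  have D2 : 0 < D ^+ 2 by rewrite exprn_even_gt0.
  by rewrite (_ : D' / D = D' * D / D ^+ 2) ?divr_gt0 //; field.
set rho := D' / D in rho0; pose la := det2 (p' - m) (p - m) / D.
(* A common point is sought on the segment from the midpoint [m] to [p'] and on one from a shifted
   point of the edge to [p]. With 1/(2K) as step all three of [ep], [ep * rho] and the shift [ka]
   are small enough to stay on these segments and on the edge. *)
pose K := 1 + rho + 2 * `|la|; have la0 := normr_ge0 la.
have K0 : 0 < K by rewrite /K; lra.
pose ep := (2 * K)^-1; have e0 : 0 < ep by rewrite invr_gt0; lra.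
have eK : ep * K = 2^-1 by rewrite /ep; field; rewrite gt_eqF.
have er : 0 < ep * rho by rewrite mulr_gt0.
have el : 0 <= ep * `|la| by rewrite mulr_ge0 // ltW.
have eKE : ep + ep * rho + 2 * (ep * `|la|) = 2^-1 by rewrite -eK /K; ring.
have ga0 : 0 < 1 - ep * rho by lra.
pose ka := ep * la / (1 - ep * rho).
have kaE : ka * (1 - ep * rho) = ep * la by rewrite /ka divfK // gt_eqF.
have hla : - (ep * `|la|) <= ep * la <= ep * `|la|.
  by rewrite -mulrN !ler_pM2l // -ler_norml lexx.
have ka2 : 0 <= 2^-1 + ka <= 1.
  by case/andP: hla => h1 h2; apply/andP; split; nra.
have cm : closure (fce f) m by apply/fcl/edg_point; apply/andP; split; lra.
have cm' : closure (fce g) m by apply: fcl; rewrite -eE; apply: edg_point; apply/andP; split; lra.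
have cb := fcl (@edg_point f _ ka2).
have e1 : 0 < ep <= 1 by rewrite e0 /=; lra.
have r1 : 0 < ep * rho <= 1 by rewrite er /=; lra.
have q1 := closure_open_segment (face_open (ff f)) (face_convex (ff f)) cb Fp r1.
have q2 := closure_open_segment (face_open (ff g)) (face_convex (ff g)) cm' Fp' e1.
apply: (face_eq (ff f) (ff g) q1); move: q2; congr (fce g).
have pE : p' - m = la *: d + rho *: (p - m).
  by rewrite /la /rho -D'm -Dm; apply: plane_coord; rewrite Dm.
rewrite pE scalerDr !scalerA -kaE /m -/d -/v; apply: row2P; rewrite !vecE; ring.
Qed.

(** Each edge direction lies on the closed face side of the other; as the orientations agree, the
    two conditions force the directions to be parallel, and the common face makes them equal. The
    end of the shorter edge would then be a vertex in the longer one. *)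
Lemma same_side_edge f g : vtx f = vtx g -> fce f = fce g -> col f = col g -> edg f = edg g.
Proof.
move=> vE FE cE.
have sE : sg f = sg g by rewrite /sg cE.
have h1 : 0 <= sg f * det2 (dir f) (dir g).
  have := @side_cl f (hd g); rewrite {1}FE => /(_ (fcl (hd_edg g))).
  by rewrite /side {1}vE.
have h2 : 0 <= sg f * det2 (dir g) (dir f).
  have := @side_cl g (hd f); rewrite -{1}FE => /(_ (fcl (hd_edg f))).
  by rewrite /side -{1}vE -sE.
have D0 : det2 (dir f) (dir g) = 0.
  have E : det2 (dir g) (dir f) = - det2 (dir f) (dir g) by rewrite /det2; ring.
  by move: h1 h2; rewrite E /sg; case: (col f) => h1 h2; lra.
have dE := det2_eq0 (dir_neq0 f) D0; set la := _ / _ in dE.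
have [p Fp] := face_nonempty (ff f).
have l0 : 0 < la.
  have h := side_pos Fp; have := @side_pos g p; rewrite -FE => /(_ Fp).
  have -> : side g p = la * side f p by rewrite /side dE -vE /det2 !vecE; ring.
  by rewrite -sE mulrCA pmulr_lgt0.
have hdE : hd f = hd g -> edg f = edg g.
  by move=> E; have [_ _ -> _] := hdP f; have [_ _ -> _] := hdP g; rewrite vE E.
apply: hdE; have [nf Vf _ _] := hdP f; have [ng Vg _ _] := hdP g.
have [l1|l1] := leP la 1.
  have : edg f (hd g).
    by rewrite (_ : hd g = vtx f + la *: dir f); [apply: edg_point; rewrite l1 ltW|rewrite -dE vE addrC subrK].
  by move=> /vertex_of_edge/(_ Vg) [E|//]; move: ng; rewrite -vE E eqxx.
have : edg g (hd f).
  rewrite (_ : hd f = vtx g + la^-1 *: dir g).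
    by apply: edg_point; rewrite invr_ge0 (ltW l0) /= invf_le1 // ltW.
  by rewrite dE scalerA mulVf ?gt_eqF // scale1r -vE addrC subrK.
by move=> /vertex_of_edge/(_ Vf) [E|//]; move: nf; rewrite vE E eqxx.
Qed.

End PlaneMapGeometry.

(** * Upward directions *)

Section Lexicographic.
Variable R : realType.
Notation plane := 'rV[R]_2.
Implicit Types (x y d : plane).

(* Which of the two directions of an edge points upwards; horizontal edges point to the right. *)
Definition lexpos x : bool := (0 < x ord0 i1) || ((x ord0 i1 == 0) && (0 < x ord0 i0)).

Lemma lexpos_cases x : lexpos x <-> 0 < x ord0 i1 \/ (x ord0 i1 = 0 /\ 0 < x ord0 i0).
Proof.
rewrite /lexpos; split=> [/orP[|/andP[/eqP]]|[->|[-> ->]]]; [by left|by right| by []|].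
by rewrite eqxx orbT.
Qed.

Lemma lexpos0 : ~ lexpos 0. Proof. by move/lexpos_cases; rewrite !mxE ltxx; case=> [|[]]. Qed.

Lemma lexposN x : x != 0 -> lexpos (- x) = ~~ lexpos x.
Proof.
move=> x0; rewrite /lexpos !vecE !oppr_gt0 oppr_eq0.
have : (x ord0 i0 != 0) || (x ord0 i1 != 0).
  apply: contraNT x0; rewrite negb_or !negbK => /andP[/eqP h0 /eqP h1].
  by apply/eqP/row2P; rewrite ?h0 ?h1 mxE.
move: (x ord0 i0) (x ord0 i1) => a b.
move=> ab; case: (ltgtP b 0) => hb //=.
by move: ab; rewrite hb eqxx orbF; case: (ltgtP a 0).
Qed.

Lemma lexposD x y : lexpos x -> lexpos y -> lexpos (x + y).
Proof.
by move=> /lexpos_cases hx /lexpos_cases hy; apply/lexpos_cases; rewrite !vecE; case: hx => [h|[h h']]; case: hy => [k|[k k']]; [left|left|left|right]; lra.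
Qed.

Lemma lexposZ (a : R) x : 0 < a -> lexpos (a *: x) = lexpos x.
Proof. by move=> a0; rewrite /lexpos !vecE !pmulr_rgt0 // mulf_eq0 gt_eqF. Qed.

Lemma lexpos_cone (a b : R) x y : 0 <= a -> 0 <= b -> ~ lexpos x -> ~ lexpos y ->
  ~ lexpos (a *: x + b *: y).
Proof.
have H z : ~ lexpos z -> z ord0 i1 < 0 \/ (z ord0 i1 = 0 /\ z ord0 i0 <= 0).
  move=> n; have [h|h|h] := ltgtP (z ord0 i1) 0; first by left.
    by case: n; apply/lexpos_cases; left.
  by right; split=> //; rewrite leNgt; apply/negP => h'; apply: n; apply/lexpos_cases; right.
move=> a0 b0 /H hx /H hy /lexpos_cases; rewrite !vecE.
move: (x ord0 i0) (x ord0 i1) (y ord0 i0) (y ord0 i1) hx hy => x0 x1 y0 y1 hx hy.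
have x1' : x1 <= 0 by case: hx => [|[]]; lra.
have y1' : y1 <= 0 by case: hy => [|[]]; lra.
have ax : a * x1 <= 0 by rewrite mulr_ge0_le0.
have bx : b * y1 <= 0 by rewrite mulr_ge0_le0.
case=> [h|[h h']]; first lra.
have [ax0 bx0] : a * x1 = 0 /\ b * y1 = 0 by split; lra.
have ax2 : a * x0 <= 0.
  case: hx => [h1|[_ h1]]; last by rewrite mulr_ge0_le0.
  by move/eqP: ax0; rewrite mulf_eq0 (lt_eqF h1) orbF => /eqP ->; rewrite mul0r.
have bx2 : b * y0 <= 0.
  case: hy => [h1|[_ h1]]; last by rewrite mulr_ge0_le0.
  by move/eqP: bx0; rewrite mulf_eq0 (lt_eqF h1) orbF => /eqP ->; rewrite mul0r.
lra.
Qed.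

(** The relation det(y,z) x + det(x,y) z = det(x,z) y: if the last determinant had the wrong sign, a
    positive combination of [x] and [z] would be a nonnegative multiple of [- y], outside their half
    plane. *)
Lemma lexpos_det_trans (s : R) x y z : x != 0 -> y != 0 -> z != 0 ->
  lexpos x = lexpos y -> lexpos z = lexpos y ->
  0 < s * det2 x y -> 0 < s * det2 y z -> 0 < s * det2 x z.
Proof.
move=> x0 y0 z0 xy zy hxy hyz; rewrite ltNge; apply/negP => h.
set c := - (s * det2 x z); have c0 : 0 <= c by rewrite oppr_ge0.
have E : c *: (- y) = (s * det2 y z) *: x + (s * det2 x y) *: z.
  by apply: row2P; rewrite /c !vecE /det2; ring.
have E' : c *: y = (s * det2 y z) *: (- x) + (s * det2 x y) *: (- z).
  by apply: oppr_inj; rewrite -scalerN E opprD !scalerN !opprK.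
have [yp|yn] := boolP (lexpos y).
  have : lexpos (c *: (- y)) by rewrite E; apply: lexposD; rewrite lexposZ // ?xy ?zy.
  move: c0; rewrite le_eqVlt => /orP[/eqP <-|c0]; first by rewrite scale0r => /lexpos0.
  by rewrite lexposZ // lexposN // yp.
have : lexpos (c *: y).
  by rewrite E'; apply: lexposD; rewrite lexposZ // lexposN // ?xy ?zy.
move: c0; rewrite le_eqVlt => /orP[/eqP <-|c0]; first by rewrite scale0r => /lexpos0.
by rewrite lexposZ // (negbTE yn).
Qed.

(** For small [ep] the lexicographic order is detected by a linear functional, the determinant with
    the direction (1, -ep) just below the horizontal. *)
Lemma lexpos_small x : lexpos x -> exists2 dl : R, 0 < dl &
  forall ep, 0 < ep < dl -> 0 < x ord0 i1 + ep * x ord0 i0.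
Proof.
move=> /lexpos_cases [h|[-> h]]; last by exists 1 => // ep /andP[e0 _]; rewrite add0r mulr_gt0.
have n0 := normr_ge0 (x ord0 i0); have k0 : 0 < `|x ord0 i0| + 1 by lra.
exists (x ord0 i1 / (`|x ord0 i0| + 1)); first by rewrite divr_gt0.
move=> ep /andP[e0]; rewrite ltr_pdivlMr // => e1.
have : - `|x ord0 i0| <= x ord0 i0 by rewrite lerNl -normrN ler_norm.
by move=> /(ler_wpM2l (ltW e0)); lra.
Qed.

End Lexicographic.

Lemma periodic_drop (s : nat -> bool) p : (0 < p)%N -> (forall n, s (n + p)%N = s n) ->
  (exists k, s k != s 0%N) -> exists n, s n && ~~ s n.+1.
Proof.
move=> p0 per [k sk]; apply: contrapT => no.
have mono n l : s n -> s (n + l)%N.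
  elim: l => [|l IH] sn; first by rewrite addn0.
  rewrite addnS; apply: contrapT => /negP h; apply: no; exists (n + l)%N; by rewrite IH.
have perm q n : s (n + q * p)%N = s n.
  by elim: q => [|q IH]; rewrite ?addn0 // mulSn addnCA addnC per.
case s0 : (s 0%N) sk => sk; first by have := mono 0%N k s0; move: sk; rewrite add0n; case: (s k).
have : s k by move: sk; case: (s k).
move=> /(mono k (k * p - k)%N); rewrite subnKC ?leq_pmulr // -[(k * p)%N]add0n perm s0 //.
Qed.

Lemma finite_orbit_period (T : Type) (t : T -> T) (A : set T) x : injective t -> finite_set A ->
  (forall n, A (iter n t x)) -> exists2 n, (0 < n)%N & iter n t x = x.
Proof.
move=> it fA Ax; have [inj|ninj] := pselect (injective (fun n => iter n t x)).
  by have [n /(_ n (leqnn n))] := eventually_notin fA inj; case.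
have [a [b [ab E]]] : exists a b, (a < b)%N /\ iter a t x = iter b t x.
  apply: contrapT => no; apply: ninj => a b E; have [h|h|//] := ltngtP a b.
    by case: no; exists a, b.
  by case: no; exists b, a.
exists (b - a)%N; first by rewrite subn_gt0.
have iti : injective (iter a t) by elim: (a) => [|n IH] u v //= /it; exact: IH.
by apply: iti; rewrite -iterD subnKC ?(ltnW ab).
Qed.

(** * Existence, uniqueness and orientation of adjacent flags *)

Section FlagAdjacency.
Variables (R : realType) (M : embedded_graph 'rV[R]_2).
Hypotheses (Mm : is_map M R) (Mc : forall F, is_face M F -> convex_polygon F).
Notation plane := 'rV[R]_2.
Notation flag := (flag M).
Implicit Types (F : set plane) (e : set plane) (p q v d : plane) (f g h x z : flag).

Local Notation hd := (hd Mm Mc).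
Local Notation dir := (dir Mm Mc).
Local Notation side := (side Mm Mc).
Local Notation col := (col Mm Mc).
Local Notation sg := (sg Mm Mc).
Local Notation tri_of := (tri_of Mm).

Let fv f : vertices M (vtx f). Proof. by case: (flagP f). Qed.
Let fe f : edges M (edg f). Proof. by case: (flagP f). Qed.
Let ff f : is_face M (fce f). Proof. by case: (flagP f). Qed.
Let fev f : edg f (vtx f). Proof. by case: (flagP f). Qed.
Let fcl f : edg f `<=` closure (fce f). Proof. by case: (flagP f). Qed.

Let oF F (fF : is_face M F) := face_open Mc fF.
Let cF F (fF : is_face M F) := face_convex Mc fF.

Let dir_neq0 := @dir_neq0 R M Mm Mc.
Let hdP := @hdP R M Mm Mc.
Let hd_edg := @hd_edg R M Mm Mc.
Let hd_eq := @hd_eq R M Mm Mc.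
Let dir_eq := @dir_eq R M Mm Mc.
Let vertex_of_edge := @vertex_of_edge R M Mm Mc.
Let edg_point := @edg_point R M Mm Mc.
Let side_neq0 := @side_neq0 R M Mm Mc.
Let side_pos := @side_pos R M Mm Mc.
Let side_cl := @side_cl R M Mm Mc.
Let two_sides := @two_sides R M Mm Mc.
Let same_side_edge := @same_side_edge R M Mm Mc.
Let closure_face_tri := @closure_face_tri R M Mm.
Let tri_union_closed := @tri_union_closed R M Mm.

Lemma adjacentE (i : 'I_3) f g : Defs.adjacent i f g <->
  [/\ vtx f = vtx g <-> 0 <> i, edg f = edg g <-> 1 <> i & fce f = fce g <-> 2%:R <> i].
Proof.
split=> [H|[h0 h1 h2] j]; first by split; [exact: (H 0)|exact: (H 1)|exact: (H 2%:R)].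
have [->|->|->] : [\/ j = 0, j = 1 | j = 2%:R] by [case: j => -[|[|[|//]]] h; [constructor 1|constructor 2|constructor 3]; exact: val_inj].
- exact: h0.
- exact: h1.
- exact: h2.
Qed.

Lemma adjacent_sym (i : 'I_3) f g : Defs.adjacent i f g -> Defs.adjacent i g f.
Proof.
by move=> /adjacentE[[h0 h0'] [h1 h1'] [h2 h2']]; apply/adjacentE; split; split=> ?; try (apply: h0 => //; by symmetry); try (apply: h1 => //; by symmetry); try (apply: h2 => //; by symmetry); symmetry; [exact: h0'|exact: h1'|exact: h2'].
Qed.

Let o3 (i : 'I_3) : [\/ i = 0, i = 1 | i = 2%:R].
Proof. by case: i => -[|[|[|//]]] h; [constructor 1|constructor 2|constructor 3]; exact: val_inj. Qed.

Lemma adjacent0 f g : Defs.adjacent 0 f g <-> [/\ vtx f <> vtx g, edg f = edg g & fce f = fce g].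
Proof.
split=> [/adjacentE[[h0 _] [_ h1] [_ h2]]|[h0 h1 h2]].
  by split; [move=> /h0|exact: h1|exact: h2].
by apply/adjacentE; split; split.
Qed.

Lemma adjacent1 f g : Defs.adjacent 1 f g <-> [/\ vtx f = vtx g, edg f <> edg g & fce f = fce g].
Proof.
split=> [/adjacentE[[_ h0] [h1 _] [_ h2]]|[h0 h1 h2]].
  by split; [exact: h0|move=> /h1|exact: h2].
by apply/adjacentE; split; split.
Qed.

Lemma adjacent2 f g : Defs.adjacent 2%:R f g <-> [/\ vtx f = vtx g, edg f = edg g & fce f <> fce g].
Proof.
split=> [/adjacentE[[_ h0] [_ h1] [h2 _]]|[h0 h1 h2]].
  by split; [exact: h0|exact: h1|move=> /h2].
by apply/adjacentE; split; split.
Qed.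

Lemma other_face f : exists F, [/\ is_face M F, edg f `<=` closure F, F <> fce f &
  forall G, is_face M G -> edg f `<=` closure G -> G = fce f \/ G = F].
Proof.
have [F [F' [FF' [fF eF] [fF' eF'] H]]] := edge_faces Mm (fe f).
have [E|E] := H _ (ff f) (@fcl f).
  by exists F'; split=> //; [move=> E'; apply: FF'; rewrite -E E'|move=> G fG eG; rewrite E; exact: H].
exists F; split=> //; [by move=> E'; apply: FF'; rewrite -E E'|].
by move=> G fG eG; rewrite E; have [->|->] := H _ fG eG; [right|left].
Qed.

(* The triangles of the flags of a face [F] whose edge misses [v] form a closed set not
   containing [v]; a boundary point of [F] near [v] and off the edge of [f] therefore lies on
   another edge at [v]. *)
Lemma other_edge f : exists g, [/\ vtx g = vtx f, fce g = fce f & edg g <> edg f].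
Proof.
set v := vtx f; set d := dir f; set F := fce f.
pose Q := \bigcup_(g in [set g | fce g = F /\ ~ edg g v]) tri_of g.
have nQ : ~ Q v.
  move=> [g [gF gv] /(tri_sub)[Fv|//]].
  by apply: (face_skeleton (ff g) Fv); left; exact: fv.
have nbQ : nbhs v (~` Q).
  by apply: open_nbhs_nbhs; split=> //; apply: closed_openC; exact: tri_union_closed.
have [p Fp] := face_nonempty (ff f).
have cv : closure F v := fcl (fev f).
pose n := side f p; have n0 : n != 0 := side_neq0 Fp.
(* For [a = 0] the point is on the line of the edge, beyond [v], hence not in the face; for [a = ta]
   and small [b] it is in the face. Between them connectedness of the segment yields a boundary
   point, close to [v] and off the edge. *)
pose pt (a b : R) : plane := v + a *: (p - v) - b *: d.
have [e1 e10 U1] : exists2 e1 : R, 0 < e1 & forall w : plane, `|w ord0 i0| < e1 -> `|w ord0 i1| < e1 -> ~ Q (v + w).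
  exact: near_box nbQ.
pose N := `|(p - v) ord0 i0| + `|(p - v) ord0 i1| + 1; pose D := `|d ord0 i0| + `|d ord0 i1| + 1.
have [N0 N1] : 0 <= `|(p - v) ord0 i0| /\ 0 <= `|(p - v) ord0 i1| by [].
have [D0 D1] : 0 <= `|d ord0 i0| /\ 0 <= `|d ord0 i1| by [].
have Np : 0 < N by rewrite /N; lra. have Dp : 0 < D by rewrite /D; lra.
pose ta := Num.min 1 (e1 / (2 * N)).
have ta0 : 0 < ta by rewrite lt_min ltr01 divr_gt0 ?mulr_gt0.
have ta1 : ta <= 1 by rewrite ge_min lexx.
have taN : ta * N <= e1 / 2.
  have : ta <= e1 / (2 * N) by rewrite ge_min lexx orbT.
  by move=> /(ler_wpM2r (ltW Np)); rewrite (_ : e1 / (2 * N) * N = e1 / 2) //; field; rewrite gt_eqF.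
have Fta : F (v + ta *: (p - v)).
  by apply: (closure_open_segment (oF (ff f)) (cF (ff f)) cv Fp); rewrite ta0.
have [e2 e20 U2] : exists2 e2 : R, 0 < e2 & forall w : plane, `|w ord0 i0| < e2 -> `|w ord0 i1| < e2 -> F (v + ta *: (p - v) + w).
  by apply: near_box; apply: open_nbhs_nbhs; split=> //; exact: oF (ff f).
pose tb := Num.min e1 e2 / (2 * D).
have m0 : 0 < Num.min e1 e2 by rewrite lt_min e10.
have tb0 : 0 < tb by rewrite divr_gt0 ?mulr_gt0.
have tbD : tb * D = Num.min e1 e2 / 2 by rewrite /tb; field; rewrite gt_eqF.
have [me1 me2] : Num.min e1 e2 <= e1 /\ Num.min e1 e2 <= e2 by split; rewrite ge_min lexx ?orbT.
have nb i : i = i0 \/ i = i1 -> `|(tb *: d) ord0 i| < Num.min e1 e2 / 2.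
  move=> ii; rewrite vecE normrM (gtr0_norm tb0) -tbD ltr_pM2l // /D.
  by case: ii => ->; lra.
have na s i : 0 <= s <= ta -> i = i0 \/ i = i1 -> `|(s *: (p - v)) ord0 i| <= e1 / 2.
  move=> /andP[s0 sta] ii; rewrite vscaleE normrM (ger0_norm s0); apply: le_trans taN.
  by apply: ler_pM => //; rewrite /N; case: ii => ->; lra.
have Hnb s : 0 <= s <= ta -> ~ Q (pt s tb).
  move=> st; rewrite /pt -addrA; apply: U1; rewrite vaddE voppE.
    have := na s i0 st (or_introl erefl); have := nb i0 (or_introl erefl) => h1 h2.
    by apply: le_lt_trans (ler_normB _ _) _; lra.
  have := na s i1 st (or_intror erefl); have := nb i1 (or_intror erefl) => h1 h2.
  by apply: le_lt_trans (ler_normB _ _) _; lra.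
have HF : F (pt ta tb).
  apply: U2; rewrite voppE normrN.
    by have := nb i0 (or_introl erefl); lra.
  by have := nb i1 (or_intror erefl); lra.
have F0 : ~ F (pt 0 tb).
  move=> /side_neq0; apply/negP/negPn; rewrite /side /pt scale0r addr0 -/d /det2 !vecE; apply/eqP; ring.
have [s [st cs nFs]] : exists s, [/\ 0 <= s <= ta, closure F (pt s tb) & ~ F (pt s tb)].
  apply: contrapT => no; apply: F0.
  pose S : set plane := [set x | exists2 s, 0 <= s <= ta & x = pt s tb].
  have cS : connected S.
    apply: (@star_shaped_connected _ _ _ (pt 0 tb)).
      by exists 0 => //; rewrite lexx ltW.
    move=> _ t [s /andP[s0 s1] ->] /andP[t0 t1]; exists (t * s).
      by rewrite mulr_ge0 //= (le_trans _ s1) // ler_piMl.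
    by rewrite /pt; apply: row2P; rewrite !vecE; ring.
  have : S `&` F = S.
    apply: cS.
    - by exists (pt ta tb); split=> //; exists ta => //; rewrite lexx ltW.
    - by exists F => //; exact: oF (ff f).
    exists (closure F); first exact: closed_closure.
    apply/seteqP; split=> x [Sx Fx]; split=> //; first exact: subset_closure.
    apply: contrapT => nFx; apply: no; case: Sx Fx nFx => s st -> cs nFs; by exists s.
  by move=> E; have : S (pt 0 tb) by [exists 0 => //; rewrite lexx ltW]; rewrite -E => -[].
have [h hF hx] := closure_face_tri (ff f) cs.
have ehx : edg h (pt s tb) by have [|//] := tri_sub hx; rewrite hF.
have ehv : edg h v by apply: contrapT => nv; apply: (Hnb s st); exists h.
have [g [gv ge gF]] := mk_flag (fv f) (fe h) (ff h) ehv (@fcl h).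
exists g; split=> //; first by rewrite gF.
rewrite ge => E; have : edg f (pt s tb) by rewrite -E.
have [_ _ -> _] := hdP f; move=> [t /andP[t0 t1]]; rewrite -/(dir f) -/d -/v => Et.
have sn : s * n = 0.
  have : side f (pt s tb) = s * n by rewrite /n /side /pt -/d -/v /det2 !vecE; ring.
  by move=> <-; rewrite Et /side -/d -/v /det2 !vecE; ring.
move/eqP: sn; rewrite mulf_eq0 (negbTE n0) orbF => /eqP s0.
have : (tb + t) *: d = 0.
  move: Et; rewrite /pt s0 scale0r addr0 => /addrI E2; by rewrite scalerDl -E2 subrr.
move/eqP; rewrite scaler_eq0 (negbTE (dir_neq0 f)) orbF => /eqP; lra.
Qed.

Lemma adj_ex (i : 'I_3) f : exists g, Defs.adjacent i f g.
Proof.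
case: (o3 i) => ->.
- have [nh Vh _ _] := hdP f.
  have [g [gv ge gF]] := mk_flag Vh (fe f) (ff f) (hd_edg f) (@fcl f).
  by exists g; apply/adjacent0; split=> //; rewrite gv => E; rewrite -E eqxx in nh.
- by have [g [gv gF ge]] := other_edge f; exists g; apply/adjacent1; split=> // E; exact: ge.
have [F [fF eF nF _]] := other_face f.
have [g [gv ge gF]] := mk_flag (fv f) (fe f) fF (fev f) eF.
by exists g; apply/adjacent2; split=> //; rewrite gF => E; exact: nF.
Qed.

Lemma adj_uniq (i : 'I_3) f g h : Defs.adjacent i f g -> Defs.adjacent i f h -> g = h.
Proof.
case: (o3 i) => ->.
- move=> /adjacent0[v1 e1 F1] /adjacent0[v2 e2 F2]; apply: flag_eq; [|by rewrite -e1|by rewrite -F1].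
  have := fev g; rewrite -e1 => /vertex_of_edge/(_ (fv g)) [E|->]; first by case: v1.
  by have := fev h; rewrite -e2 => /vertex_of_edge/(_ (fv h)) [E|->]; first by case: v2.
- move=> /adjacent1[v1 e1 F1] /adjacent1[v2 e2 F2].
  have c1 : col g <> col f by move=> c; apply: e1; apply: same_side_edge.
  have c2 : col h <> col f by move=> c; apply: e2; apply: same_side_edge.
  apply: flag_eq; [by rewrite -v1| |by rewrite -F1].
  apply: same_side_edge; rewrite -?v1 -?F1 //.
  by move: c1 c2; case: (col g) (col h) (col f) => -[] [].
move=> /adjacent2[v1 e1 F1] /adjacent2[v2 e2 F2]; apply: flag_eq; [by rewrite -v1|by rewrite -e1|].
have [F [fF eF nF H]] := other_face f.
have := H _ (ff g); rewrite {1}e1 => /(_ (@fcl g)) [E|->]; first by case: F1.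
by have := H _ (ff h); rewrite {1}e2 => /(_ (@fcl h)) [E|->]; first by case: F2.
Qed.

Local Notation r := (@flag_adj _ M).

Lemma flag_adjP (i : 'I_3) f : Defs.adjacent i f (r i f).
Proof. exact: (xgetPex f (adj_ex i f)). Qed.

Lemma flag_adj_eq (i : 'I_3) f g : Defs.adjacent i f g -> r i f = g.
Proof. exact/adj_uniq/flag_adjP. Qed.

Lemma flag_adjK (i : 'I_3) : involutive (r i).
Proof. by move=> f; apply/flag_adj_eq/adjacent_sym/flag_adjP. Qed.

Lemma flag_adj_neq (i k : 'I_3) f : i != k -> r i f <> r k f.
Proof.
move=> /eqP ik E; have := flag_adjP i f; have := flag_adjP k f; rewrite -E => Hk Hi.
by have := (Hi k).2 (fun ki : k = i => ik (esym ki)) => /(Hk k).1; apply.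
Qed.

Lemma flag_adj0 f : [/\ vtx (r 0 f) = hd f, edg (r 0 f) = edg f & fce (r 0 f) = fce f].
Proof.
have /adjacent0[v1 e1 F1] := flag_adjP 0 f; split=> //.
by have := fev (r 0 f); rewrite -e1 => /vertex_of_edge/(_ (fv _)) [E|//]; case: v1.
Qed.

Lemma flag_adj1 f : [/\ vtx (r 1 f) = vtx f, edg (r 1 f) <> edg f & fce (r 1 f) = fce f].
Proof. by have /adjacent1[v1 e1 F1] := flag_adjP 1 f; split=> // E; exact: e1. Qed.

Lemma flag_adj2 f : [/\ vtx (r 2%:R f) = vtx f, edg (r 2%:R f) = edg f & fce (r 2%:R f) <> fce f].
Proof. by have /adjacent2[v1 e1 F1] := flag_adjP 2%:R f; split=> // E; exact: F1. Qed.

Lemma hd_adj0 f : hd (r 0 f) = vtx f.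
Proof.
have [v1 e1 _] := flag_adj0 f; have := hd_edg (r 0 f); have [n V _ _] := hdP (r 0 f).
by rewrite e1 => /vertex_of_edge/(_ V) [//|E]; rewrite E v1 eqxx in n.
Qed.

Lemma dir_adj0 f : dir (r 0 f) = - dir f.
Proof. by rewrite /dir hd_adj0; have [-> _ _] := flag_adj0 f; rewrite opprB. Qed.

Lemma dir_adj2 f : dir (r 2%:R f) = dir f.
Proof. by have [v1 e1 _] := flag_adj2 f; exact: dir_eq. Qed.

Lemma flag_adj02 f : r 0 (r 2%:R f) = r 2%:R (r 0 f).
Proof.
apply: flag_adj_eq; have [v0 e0 F0] := flag_adj0 f.
have [v1 e1 F1] := flag_adj2 f; have [v2 e2 F2] := flag_adj2 (r 0 f).
apply/adjacent0; split; rewrite ?v1 ?e1 ?v2 ?e2 ?e0 ?v0 //.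
  by move=> E; have [n _ _ _] := hdP f; rewrite -E eqxx in n.
have [F [fF eF nF H]] := other_face f.
have := H _ (ff (r 2%:R f)); rewrite -{1}e1 => /(_ (@fcl _)) [E|->]; first by case: F1.
have := H _ (ff (r 2%:R (r 0 f))); rewrite -{1}e0 -{1}e2 => /(_ (@fcl _)) [E|->//].
by case: F2; rewrite E F0.
Qed.

Lemma sg_neg f g : col f = ~~ col g -> sg f = - sg g.
Proof. by rewrite /sg => ->; case: (col g); rewrite ?opprK. Qed.

Lemma col_adj (i : 'I_3) f : col (r i f) = ~~ col f.
Proof.
suff : col (r i f) <> col f by case: (col _) (col _) => -[].
case: (o3 i) => ->.
- move=> cE; have [v1 e1 F1] := flag_adj0 f; have [p Fp] := face_nonempty (ff f).
  have := side_pos Fp; have := @side_pos (r 0 f) p; rewrite {1}F1 => /(_ Fp).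
  have -> : side (r 0 f) p = - side f p.
    by rewrite /side dir_adj0 v1 -[X in p - X](subrK (vtx f)) -/(dir f) /det2 !vecE; ring.
  by rewrite /sg cE; lra.
- by have [v1 e1 F1] := flag_adj1 f => cE; apply: e1; exact: same_side_edge.
by have [v1 e1 F1] := flag_adj2 f => cE; apply: F1; exact: two_sides.
Qed.

Definition up f := lexpos (dir f).

Lemma up_adj0 f : up (r 0 f) = ~~ up f.
Proof. by rewrite /up dir_adj0 lexposN. Qed.

Lemma up_adj2 f : up (r 2%:R f) = up f.
Proof. by rewrite /up dir_adj2. Qed.

Lemma adj1_sides f : sg (r 1 f) = - sg f /\ 0 <= sg f * det2 (dir f) (dir (r 1 f)).
Proof.
split; first exact/sg_neg/col_adj.
have [v1 e1 F1] := flag_adj1 f.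
have := @side_cl f (hd (r 1 f)); rewrite -{1}F1 => /(_ (fcl (hd_edg _))).
by rewrite /side /dir v1.
Qed.

Lemma adj1_parallel f : det2 (dir f) (dir (r 1 f)) = 0 ->
  exists2 l : R, l < 0 & dir (r 1 f) = l *: dir f.
Proof.
move=> D0; have dE := det2_eq0 (dir_neq0 f) D0; set l := _ / _ in dE; exists l => //.
have [v1 e1 F1] := flag_adj1 f; have [sE _] := adj1_sides f.
have [p Fp] := face_nonempty (ff f).
have h := side_pos Fp; have := @side_pos (r 1 f) p; rewrite {1}F1 => /(_ Fp).
have -> : side (r 1 f) p = l * side f p by rewrite /side dE v1 /det2 !vecE; ring.
by rewrite sE mulNr mulrCA -mulNr pmulr_lgt0 // oppr_gt0.
Qed.

(** At a straight corner the two directions are opposite, so exactly one is up. If [up] agrees, the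
    angle is strictly between 0 and pi. *)
Lemma corner_det f : up (r 1 f) = up f -> 0 < sg f * det2 (dir f) (dir (r 1 f)).
Proof.
move=> uE; have [_ h] := adj1_sides f; rewrite lt_neqAle h andbT eq_sym mulf_neq0 //.
  by rewrite /sg; case: (col f); rewrite ?oppr_eq0 oner_eq0.
apply/eqP => /adj1_parallel [l l0 E]; move: uE; rewrite /up E -[l]opprK scaleNr -scalerN.
by rewrite lexposZ ?oppr_gt0 // lexposN //; case: (lexpos _).
Qed.

Lemma vertex_flags_finite v : finite_set [set f : flag | vtx f = v].
Proof.
have [U nU fU] := tri_locally_finite Mm v; apply: sub_finite_set fU => f /= fE.
by exists (vtx f); split; [exact: tri_vertex|rewrite fE; exact: nbhs_singleton].
Qed.

Lemma bounded_flags_finite (B : R) :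
  finite_set [set f : flag | forall i, `|vtx f ord0 i| <= B].
Proof.
have cK : compact [set v : plane | forall i, `[- B, B]%classic (v ord0 i)].
  exact: (@rV_compact R 2 (fun=> `[- B, B]%classic) (fun _ => @segment_compact R _ _)).
apply: sub_finite_set (compact_tri_finite Mm cK) => f /= fB.
exists (vtx f); split; first exact: tri_vertex.
by move=> i; rewrite /= in_itv /= -ler_norml.
Qed.

Lemma face_flags_finite F : is_face M F -> finite_set [set f : flag | fce f = F].
Proof.
move=> fF; have [_ _ [B FB]] := convex_polygonP (Mc fF).
apply: sub_finite_set (bounded_flags_finite B) => f /= fE i.
have : closure F (vtx f) by rewrite -fE; exact: (fcl (fev f)).
move=> cv; rewrite leNgt; apply/negP => h.
have c : {for vtx f, continuous (fun x : plane => `|x ord0 i|)}.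
  by apply: cont_norm; exact: coord_continuous.
by have [x [Fx]] := cv _ (near_gt c h); rewrite /= ltNge FB.
Qed.

Lemma iter_inv (A : set flag) (t : flag -> flag) f : (forall g, A g -> A (t g)) -> A f ->
  forall n, A (iter n t f).
Proof. by move=> At Af; elim=> //= n; exact: At. Qed.

Lemma flag_period (i k : 'I_3) f : exists2 n, (0 < n)%N & iter n (fun h => r i (r k h)) f = f.
Proof.
have tI : injective (fun h => r i (r k h)).
  by move=> g h /(can_inj (flag_adjK i))/(can_inj (flag_adjK k)).
have vK (l : 'I_3) g : l != 0 -> vtx (r l g) = vtx g.
  by case: (o3 l) => -> // _; [case: (flag_adj1 g)|case: (flag_adj2 g)].
have FK (l : 'I_3) g : l != 2%:R -> fce (r l g) = fce g.
  by case: (o3 l) => -> // _; [case: (flag_adj0 g)|case: (flag_adj1 g)].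
have [/andP[i0 k0]|n0] := boolP ((i != 0) && (k != 0)).
  apply: (finite_orbit_period tI (vertex_flags_finite (vtx f))).
  by apply: (@iter_inv [set g | vtx g = vtx f]) => // g /=; rewrite !vK.
have [/andP[i2 k2]|n2] := boolP ((i != 2%:R) && (k != 2%:R)).
  apply: (finite_orbit_period tI (face_flags_finite (ff f))).
  by apply: (@iter_inv [set g | fce g = fce f]) => // g /=; rewrite !FK.
exists 2%N => //=.
have : (i = 0 /\ k = 2%:R) \/ (i = 2%:R /\ k = 0).
  by move: n0 n2; case: (o3 i) => ->; case: (o3 k) => -> //; [left|right].
by case=> -[-> ->]; rewrite ?flag_adj02 flag_adjK -?flag_adj02 ?flag_adjK // flag_adj02 !flag_adjK.
Qed.

(** If all edges at the vertex pointed into one half plane, every turn would go the same way by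
    transitivity of the determinant sign, and the rotation could never return to its start. *)
Lemma up_vertex f : exists n, up (iter n (fun h => r 2%:R (r 1 h)) f) != up f.
Proof.
set t := fun h => _; apply: contrapT => no.
have cst n : up (iter n t f) = up f by apply/eqP/negPn/negP => h; apply: no; exists n.
have sE n : sg (iter n t f) = sg f.
  elim: n => //= n <-; rewrite /t (sg_neg (col_adj _ _)) (sg_neg (col_adj _ _)) opprK //.
have step n : 0 < sg f * det2 (dir (iter n t f)) (dir (iter n.+1 t f)).
  rewrite -(sE n) /= /t dir_adj2; apply: corner_det.
  by have := cst n.+1; rewrite /= /t up_adj2 => ->; rewrite -(cst n).
have chain n : 0 < sg f * det2 (dir f) (dir (iter n.+1 t f)).
  elim: n => [|n IH]; first exact: (step 0%N).
  have u k : lexpos (dir (iter k t f)) = up f := cst k.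
  exact: (lexpos_det_trans (dir_neq0 _) (dir_neq0 _) (dir_neq0 _) (esym (u n.+1))
    (etrans (u n.+2) (esym (u n.+1))) IH (step n.+1)).
have [[//|n] _ E] := flag_period 2%:R 1 f.
by have := chain n; rewrite E (_ : det2 _ _ = 0) ?mulr0 ?ltxx // /det2; ring.
Qed.

(** A walk around the face along edges that all point up, or all down, would be lexicographically
    monotone and could not close. *)
Lemma up_face f : exists n, up (iter n (fun h => r 1 (r 0 h)) f) != up f.
Proof.
set t := fun h => _; apply: contrapT => no.
have cst n : up (iter n t f) = up f by apply/eqP/negPn/negP => h; apply: no; exists n.
have vt g : vtx (t g) = vtx g + dir g.
  by rewrite /t; have [-> _ _] := flag_adj1 (r 0 g); have [-> _ _] := flag_adj0 g; rewrite addrC subrK.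
pose s : R := if up f then 1 else -1.
have step n : lexpos (s *: dir (iter n t f)).
  rewrite /s; have := cst n; rewrite /up -/(up f); case: ifP => _ h; first by rewrite scale1r.
  by rewrite scaleN1r lexposN // h.
have chain n : lexpos (s *: (vtx (iter n.+1 t f) - vtx f)).
  elim: n => [|n IH]; first by rewrite vt addrC addKr; exact: (step 0%N).
  by rewrite vt addrAC scalerDr; exact: (lexposD IH (step n.+1)).
have [[//|n] _ E] := flag_period 1 0 f.
by have := chain n; rewrite E subrr scaler0 => /lexpos0.
Qed.

End FlagAdjacency.

(** * Connectedness of the flag graph *)

Section FlagOrbits.
Variables (R : realType) (M : embedded_graph 'rV[R]_2).
Hypotheses (Mm : is_map M R) (Mc : forall F, is_face M F -> convex_polygon F).
Notation plane := 'rV[R]_2.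
Notation flag := (flag M).
Implicit Types (F : set plane) (p v d : plane) (f g x z : flag).

Local Notation hd := (hd Mm Mc).
Local Notation dir := (dir Mm Mc).
Local Notation side := (side Mm Mc).
Local Notation col := (col Mm Mc).
Local Notation sg := (sg Mm Mc).
Local Notation up := (up Mm Mc).
Local Notation tri_of := (tri_of Mm).
Local Notation r := (@flag_adj _ M).

Let fv f : vertices M (vtx f). Proof. by case: (flagP f). Qed.
Let fe f : edges M (edg f). Proof. by case: (flagP f). Qed.
Let ff f : is_face M (fce f). Proof. by case: (flagP f). Qed.
Let fev f : edg f (vtx f). Proof. by case: (flagP f). Qed.
Let fcl f : edg f `<=` closure (fce f). Proof. by case: (flagP f). Qed.

Let oF F (fF : is_face M F) := face_open Mc fF.
Let cF F (fF : is_face M F) := face_convex Mc fF.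
Let rK := flag_adjK Mm Mc.
Let adj0 := flag_adj0 Mm Mc.
Let adj1 := flag_adj1 Mm Mc.
Let adj2 := flag_adj2 Mm Mc.
Let dir0 := dir_neq0 Mm Mc.
Let up0 := up_adj0 Mm Mc.
Let up2 := up_adj2 Mm Mc.
Let colr := col_adj Mm Mc.

(* The face lies in the cone spanned at the corner by its two edges. *)
Lemma max_corner z p : ~~ up z -> ~~ up (r 1 z) -> closure (fce z) p -> ~ lexpos (p - vtx z).
Proof.
move=> u1 u2 cp; have D0 : 0 < sg z * det2 (dir z) (dir (r 1 z)).
  by apply: corner_det; rewrite (negbTE u1) (negbTE u2).
have [v1 _ F1] := adj1 z; have [sE _] := adj1_sides Mm Mc z.
set s := sg z in D0 sE; set d := dir z in D0 *; set d' := dir (r 1 z) in D0 *; set w := p - vtx z.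
have ratio (a b : R) : 0 <= s * a -> 0 < s * b -> 0 <= a / b.
  move=> a0 b0; have sb : s * b != 0 by rewrite gt_eqF.
  have sn : s != 0 by apply: contraNneq sb => ->; rewrite mul0r.
  by rewrite -[a / b]mul1r -(divff sn) mulf_div divr_ge0 // ltW.
have n0 : det2 d d' != 0.
  by apply: contraTneq D0 => ->; rewrite mulr0 ltxx.
rewrite (plane_coord w n0); apply: lexpos_cone.
- apply: ratio => //; have := @side_cl _ _ Mm Mc (r 1 z) p; rewrite F1 => /(_ cp).
  by rewrite sE /side v1 -/d' -/w (_ : det2 d' w = - det2 w d') ?mulrNN // /det2; ring.
- by apply: ratio => //; exact: (side_cl Mm Mc cp).
- by apply/negP.
- by apply/negP.
Qed.

Lemma same_corner z x : vtx z = vtx x -> fce z = fce x -> x = z \/ x = r 1 z.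
Proof.
move=> vE FE; have [v1 _ F1] := adj1 z.
have [cE|cN] := eqVneq (col z) (col x).
  by left; apply: flag_eq; rewrite -?vE -?FE //; apply/esym/(same_side_edge vE FE cE).
have cE : col x = col (r 1 z) by rewrite colr; case: (col x) (col z) cN => -[].
right; apply: flag_eq; rewrite ?v1 ?F1 //.
by apply: (same_side_edge _ _ cE); rewrite ?v1 ?F1.
Qed.

(** On a walk around the face an up edge is at some point followed by a down one; seen from the
    vertex between them both edges are down. *)
Lemma face_max f : exists z, [/\ reach r (fun i => i != 2%:R) f z, fce z = fce f,
  ~~ up z & ~~ up (r 1 z)].
Proof.
pose t (h : flag) := r 1 (r 0 h); have [q q0 qE] := flag_period Mm Mc 1 0 f.
have [n /andP[un un1]] := periodic_drop (s := fun n => up (iter n t f)) q0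
  (fun n => congr1 up (etrans (iterD n q t f) (congr1 (iter n t) qE))) (up_face Mm Mc f).
have H m : reach r (fun i => i != 2%:R) f (iter m t f) /\ fce (iter m t f) = fce f.
  elim: m => [|m [rm Fm]]; first by split=> //; exact: reach_refl.
  split; first by do 2!apply: reach_step => //.
  by rewrite /= /t; have [_ _ ->] := adj1 (r 0 (iter m t f)); have [_ _ ->] := adj0 (iter m t f).
have [rn Fn] := H n.+1; exists (iter n.+1 t f); split=> //.
by rewrite /= /t rK up0 un.
Qed.

(** Both orbits contain a flag at a lexicographically largest vertex of the face, and there is only
    one such vertex. *)
Lemma face_orbit f g : fce f = fce g -> reach r (fun i => i != 2%:R) f g.
Proof.
move=> FE; have [z [fz Fz z1 z2]] := face_max f; have [x [gx Fx x1 x2]] := face_max g.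
have E : fce z = fce x by rewrite Fz Fx.
have h1 : ~ lexpos (vtx x - vtx z) by apply: max_corner => //; rewrite E; exact: (fcl (fev x)).
have h2 : ~ lexpos (vtx z - vtx x) by apply: max_corner => //; rewrite -E; exact: (fcl (fev z)).
have vE : vtx z = vtx x.
  apply/eqP; rewrite -subr_eq0; apply/negPn/negP => n0.
  by apply: h1; rewrite -opprB lexposN //; apply/negP.
apply: (reach_trans fz); apply: (reach_trans _ (reach_sym rK gx)).
have [->|->] := same_corner vE E; first exact: reach_refl.
exact: reach1.
Qed.

(** Counterclockwise from a down edge to an up edge the corner sweeps over the direction just below
    the positive horizontal. Being common to all such corners at a vertex, this direction will show
    that they belong to one face. *)
Lemma rise_corner x : col x -> ~~ up x -> up (r 1 x) -> exists2 dl : R, 0 < dl &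
  forall ep, 0 < ep < dl -> exists2 ta : R, 0 < ta &
    forall t, 0 < t < ta -> fce x (vtx x + t *: row2 1 (- ep)).
Proof.
move=> cx u1 u2; set v := vtx x; set d := dir x; set d' := dir (r 1 x).
have [sE D0] := adj1_sides Mm Mc x; have [v1 _ F1] := adj1 x.
have s1 : sg x = 1 by rewrite /sg cx.
rewrite s1 mul1r -/d -/d' in D0.
have Nd : lexpos (- d) by rewrite lexposN ?dir0.
have [dl1 dl10 H1] := lexpos_small Nd; have [dl2 dl20 H2] := lexpos_small u2.
exists (Num.min dl1 dl2); first by rewrite lt_min dl10.
move=> ep; rewrite lt_min => /andP[e0 /andP[e1 e2]].
have := H1 ep; have := H2 ep; rewrite e0 e1 e2 => /(_ isT) + /(_ isT).
rewrite -/d'; set h : plane := row2 1 (- ep) => h2' h1'.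
have h1 : 0 < det2 d h.
  by move: h1'; rewrite /det2 /h !row2E !vecE; lra.
have h2 : 0 < det2 h d'.
  by move: h2'; rewrite /det2 /h !row2E; lra.
have cv : closure (fce x) v := fcl (fev x).
have cd : closure (fce x) (v + d).
  by rewrite /d /dir addrC subrK; exact: (fcl (hd_edg Mm Mc x)).
have cd' : closure (fce x) (v + d').
  by rewrite /d' /dir v1 addrC subrK -F1; exact: (fcl (hd_edg Mm Mc (r 1 x))).
move: D0; rewrite le_eqVlt => /orP[/eqP D0|D0]; last first.
  pose al := det2 h d' / det2 d d'; pose be := det2 d h / det2 d d'.
  have a0 : 0 < al by rewrite divr_gt0. have b0 : 0 < be by rewrite divr_gt0.
  have ab0 : 0 < al + be by rewrite addr_gt0.
  exists (al + be)^-1; first by rewrite invr_gt0.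
  move=> t /andP[t0]; rewrite -[X in _ < X]mul1r ltr_pdivlMr // mulrDr => t1.
  rewrite (@plane_coord _ d d' h) ?gt_eqF // -/al -/be scalerDr !scalerA.
  have e1' : v + d - v = d by rewrite addrC addKr.
  have e2' : v + d' - v = d' by rewrite addrC addKr.
  rewrite -{1}e1' -{1}e2'; apply: (open_triangle (oF (ff x)) (cF (ff x))) => //.
  - by rewrite e1' e2' gt_eqF.
  - exact: mulr_gt0.
  - exact: mulr_gt0.
(* The corner is straight, so its two edges span no triangle. A small multiple of [h] is instead
   placed on a segment from a point of the two collinear edges to an interior point [p]. *)
have [l l0 dE] : exists2 l : R, l < 0 & d' = l *: d by apply: adj1_parallel; rewrite -/d -/d'.
have [p Fp] := face_nonempty (ff x).
have Dp : 0 < det2 d (p - v) by have := side_pos Mm Mc Fp; rewrite s1 mul1r.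
have Dn : det2 d (p - v) != 0 by rewrite gt_eqF.
pose a := det2 h (p - v) / det2 d (p - v); pose b := det2 d h / det2 d (p - v).
have hE : h = a *: d + b *: (p - v) by exact: plane_coord.
have b0 : 0 < b by rewrite divr_gt0.
have na := normr_ge0 a.
pose mu := Num.min 1 (- l); have mu0 : 0 < mu by rewrite lt_min ltr01 oppr_gt0.
have [mu1 mul] : mu <= 1 /\ mu <= - l by rewrite /mu; split; rewrite ge_min lexx ?orbT.
pose K := 2 * (`|a| + b + 1); have K0 : 0 < K by rewrite /K; lra.
exists (mu / K); first by rewrite divr_gt0.
move=> t /andP[t0]; rewrite ltr_pdivlMr // => tK.
have ta0 : 0 <= t * `|a| by rewrite mulr_ge0 // ltW.
have tb0 : 0 < t * b by rewrite mulr_gt0.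
have tKE : t * K = 2 * (t * `|a|) + 2 * (t * b) + 2 * t by rewrite /K; ring.
have tb1 : t * b < 2^-1 by lra.
have tam : 2 * (t * `|a|) < mu by lra.
pose c := 1 - t * b; have c0 : 0 < c by rewrite /c; lra. have c2 : 2^-1 < c by rewrite /c; lra.
pose si := t * a / c.
have siE : si * c = t * a by rewrite /si divfK // gt_eqF.
have hta : - (t * `|a|) <= t * a <= t * `|a|.
  by rewrite -mulrN !ler_pM2l // -ler_norml lexx.
have si1 : - mu <= si <= mu.
  by case/andP: hta => x1 x2; apply/andP; split; nra.
have cb : closure (fce x) (v + si *: d).
  have l1 : 0 < 1 - l by lra.
  have : 0 <= (si - l) / (1 - l) <= 1.
    case/andP: si1 => x1 x2; apply/andP; split; first by rewrite divr_ge0; lra.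
    by rewrite ler_pdivrMr //; lra.
  move=> /(closure_segment (oF (ff x)) (cF (ff x)) cd' cd).
  by congr (closure _ _); rewrite dE; apply: row2P; rewrite !vecE; field; rewrite gt_eqF.
have tb01 : 0 < t * b <= 1 by rewrite tb0 /=; lra.
have := closure_open_segment (oF (ff x)) (cF (ff x)) cb Fp tb01; congr (fce x).
have -> : t *: h = (si * c) *: d + (t * b) *: (p - v) by rewrite hE scalerDr !scalerA siE.
by apply: row2P; rewrite !vecE /c; ring.
Qed.

Lemma vertex_rise f : exists x, [/\ reach r (fun i => i != 0) f x, vtx x = vtx f, col x,
  ~~ up x & up (r 1 x)].
Proof.
have [g [rg gv cg]] : exists g, [/\ reach r (fun i => i != 0) f g, vtx g = vtx f & col g].
  have [cf|cf] := boolP (col f); first by exists f; split=> //; exact: reach_refl.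
  by exists (r 1 f); split; [exact: reach1|case: (adj1 f)|rewrite colr].
pose t (h : flag) := r 2%:R (r 1 h); have [q q0 qE] := flag_period Mm Mc 2%:R 1 g.
have [n /andP[un un1]] : exists n, ~~ up (iter n t g) && ~~ ~~ up (iter n.+1 t g).
  apply: (periodic_drop (s := fun n => ~~ up (iter n t g)) q0).
    by move=> n; rewrite iterD qE.
  have [k uk] := up_vertex Mm Mc g; exists k; move: uk => /=.
  by case: (up _) (up _) => -[].
have H m : [/\ reach r (fun i => i != 0) f (iter m t g), vtx (iter m t g) = vtx f & col (iter m t g)].
  elim: m => [//|m [rm vm cm]]; split; first by do 2!apply: reach_step => //.
    by rewrite /= /t; have [-> _ _] := adj2 (r 1 (iter m t g)); have [-> _ _] := adj1 (iter m t g).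
  by rewrite /= /t !colr cm.
have [rn vn cn] := H n; exists (iter n t g); split=> //.
by move: un1; rewrite negbK /= /t up2.
Qed.

Lemma vertex_orbit f g : vtx f = vtx g -> reach r (fun i => i != 0) f g.
Proof.
move=> vE; have [z [fz vz cz z1 z2]] := vertex_rise f; have [x [gx vx cx x1 x2]] := vertex_rise g.
have vzx : vtx z = vtx x by rewrite vz vx.
have [dl1 dl10 H1] := rise_corner cz z1 z2; have [dl2 dl20 H2] := rise_corner cx x1 x2.
pose ep := Num.min dl1 dl2 / 2; have m0 : 0 < Num.min dl1 dl2 by rewrite lt_min dl10.
have [m1 m2] : Num.min dl1 dl2 <= dl1 /\ Num.min dl1 dl2 <= dl2 by split; rewrite ge_min lexx ?orbT.
have [] := H1 ep; first by rewrite /ep; apply/andP; split; lra.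
move=> ta1 ta10 K1; have [] := H2 ep; first by rewrite /ep; apply/andP; split; lra.
move=> ta2 ta20 K2; pose t := Num.min ta1 ta2 / 2.
have n0 : 0 < Num.min ta1 ta2 by rewrite lt_min ta10.
have [n1 n2] : Num.min ta1 ta2 <= ta1 /\ Num.min ta1 ta2 <= ta2 by split; rewrite ge_min lexx ?orbT.
have F1 : fce z (vtx z + t *: row2 1 (- ep)) by apply: K1; rewrite /t; apply/andP; split; lra.
have F2 : fce x (vtx z + t *: row2 1 (- ep)) by rewrite vzx; apply: K2; rewrite /t; apply/andP; split; lra.
have E := face_eq (ff z) (ff x) F1 F2.
apply: (reach_trans fz); apply: (reach_trans _ (reach_sym rK gx)).
have [->|->] := same_corner vzx E; first exact: reach_refl.
exact: reach1.
Qed.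

Lemma edge_orbit f g : edg f = edg g -> reach r predT f g.
Proof.
move=> eE.
have [f1 [rf1 e1 v1]] : exists f1, [/\ reach r predT f f1, edg f1 = edg f & vtx f1 = vtx g].
  have := fev g; rewrite -eE => /(vertex_of_edge Mm Mc)/(_ (fv g)) [->|->].
    by exists f; split=> //; exact: reach_refl.
  by exists (r 0 f); have [v0 e0 _] := adj0 f; split=> //; exact: reach1.
apply: (reach_trans rf1).
have [cE|cN] := eqVneq (col f1) (col g).
  rewrite (_ : g = f1); first exact: reach_refl.
  apply: flag_eq; rewrite ?e1 //; apply/esym; apply: (two_sides v1 _ cE); by rewrite e1.
rewrite (_ : g = r 2%:R f1); first exact: reach1.
have [v2 e2 _] := adj2 f1; apply: flag_eq; rewrite ?v2 ?e2 ?e1 //.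
apply/esym; apply: (two_sides (Mm := Mm) (Mc := Mc)); rewrite ?v2 ?e2 ?e1 // colr.
by case: (col _) (col _) cN => -[].
Qed.

(** Triangles that meet share a vertex, an edge or a face and hence lie in one orbit. The triangles
    of an orbit and the remaining ones therefore cover disjoint closed sets, and the plane is
    connected. *)
Lemma flags_connected f g : reach r predT f g.
Proof.
pose S := [set h : flag | reach r predT f h].
have [//|nS] := pselect (S g).
pose A := \bigcup_(h in S) tri_of h; pose B := \bigcup_(h in ~` S) tri_of h.
have AB (x : plane) : A x -> ~ B x.
  move=> [h Sh hx] [k Sk kx]; apply: Sk; apply: (reach_trans Sh).
  have [E|E|E] := tri_meet hx kx.
  - by apply: reach_sub (face_orbit E).
  - exact: edge_orbit.
  - by apply: reach_sub (vertex_orbit E).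
have AE : A = ~` B.
  apply/seteqP; split=> x; first exact: AB.
  move=> nB; have [h hx] := tri_cover Mm x; exists h => //.
  by apply: contrapT => nh; apply: nB; exists h.
have cT : connected [set: plane] by apply: (@star_shaped_connected _ _ _ 0).
have ET : A = setT.
  apply: cT.
  - by exists (vtx f); exists f; [exact: reach_refl|exact: tri_vertex].
  - by exists A; rewrite ?setTI // AE; apply: closed_openC; exact: tri_union_closed.
  - by exists A; rewrite ?setTI //; exact: tri_union_closed.
have : A (vtx g) by rewrite ET.
by move=> /AB; case; exists g => //; exact: tri_vertex.
Qed.

End FlagOrbits.

(** * Face sizes and rotations *)

Section FaceSize.
Variables (R : realType) (M : embedded_graph 'rV[R]_2).
Hypotheses (Mm : is_map M R) (Mc : forall F, is_face M F -> convex_polygon F).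
Notation flag := (flag M).
Local Notation r := (@flag_adj _ M).
Local Notation rot := (fun h : flag => r 1 (r 0 h)).

Lemma face_has_flag F : is_face M F -> exists f : flag, fce f = F.
Proof.
move=> fF; have [x Fx] := face_nonempty fF.
by have [f fE _] := closure_face_tri Mm fF (subset_closure Fx); exists f.
Qed.

(* The rotations about the face are its flags of one colour, one for each edge. *)
Lemma face_size (f : flag) Q : (0 < Q)%N -> iter Q rot f = f ->
  (forall n, (0 < n < Q)%N -> iter n rot f <> f) -> (edges_of_face M (fce f) #= `I_Q)%card.
Proof.
move=> Q0 QE Qmin.
have rK := flag_adjK Mm Mc.
have rotI : injective rot by move=> g h /(can_inj (rK 1))/(can_inj (rK 0)).
have iterI n : injective (iter n rot) by elim: n => [|n IH] g h //= /rotI; exact: IH.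
have Fn n : fce (iter n rot f) = fce f.
  elim: n => //= n IH; have [_ _ ->] := flag_adj1 Mm Mc (r 0 (iter n rot f)).
  by have [_ _ ->] := flag_adj0 Mm Mc (iter n rot f).
have cn n : col Mm Mc (iter n rot f) = col Mm Mc f.
  by elim: n => //= n IH; rewrite !(col_adj Mm Mc) negbK.
have same g h : edg g = edg h -> fce g = fce h -> col Mm Mc g = col Mm Mc h -> g = h.
  move=> eE FE cE; have [_ _ _ gv _] := flagP g.
  have [hv _ _ _ _] := flagP g; have := gv; rewrite eE => /(vertex_of_edge Mm Mc)/(_ hv) [vE|vE].
    exact: flag_eq.
  have [v0 e0 F0] := flag_adj0 Mm Mc h.
  have E : g = r 0 h by apply: flag_eq; rewrite ?v0 ?e0 ?F0.
  by move: cE; rewrite E (col_adj Mm Mc); case: (col _ _ _).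
apply/card_esym/card_set_bijP; exists (fun n => edg (iter n rot f)); split.
- move=> n /= nQ; split; first by have [_ ee _ _ _] := flagP (iter n rot f).
  by have [_ _ _ _] := flagP (iter n rot f); rewrite Fn.
- have lt n m : (n < m)%N -> (m < Q)%N -> edg (iter n rot f) <> edg (iter m rot f).
    move=> nm mQ eE; have : iter n rot f = iter m rot f by apply: same; rewrite ?Fn ?cn.
    rewrite -(subnKC (ltnW nm)) iterD => /iterI /esym; apply: Qmin.
    by rewrite subn_gt0 nm (leq_ltn_trans (leq_subr _ _)).
  move=> n m; rewrite !inE /= => nQ mQ E; have [h|h|//] := ltngtP n m.
    by case: (lt _ _ h mQ).
  by case: (lt _ _ h nQ).
move=> e [Ee ef]; have ff : is_face M (fce f) by have [] := flagP f.
have [a [b [_ Va _ eE eV]]] := edge_segment Mm Mc Ee.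
have ea : e a by rewrite eE; exists 0; rewrite ?lexx ?ler01 // scale0r addr0.
have [g [_ ge gF]] := mk_flag Va Ee ff ea ef.
have [h [he hF hc]] : exists h, [/\ edg h = e, fce h = fce f & col Mm Mc h = col Mm Mc f].
  have [cE|cN] := eqVneq (col Mm Mc g) (col Mm Mc f); first by exists g.
  have [v0 e0 F0] := flag_adj0 Mm Mc g; exists (r 0 g); rewrite e0 F0; split=> //.
  by rewrite (col_adj Mm Mc); case: (col _ _ _) (col _ _ _) cN => -[].
have rh := face_orbit Mm Mc (esym hF).
have [n [hn|hn]] : exists n, h = iter n rot f \/ r 0 h = iter n rot f.
  elim: rh => [|i k ni _ [n IH]]; first by exists 0%N; left.
  have : i = 0 \/ i = 1.
    by move: ni; case: i => -[|[|[|//]]] i3 ni; [left|right|]; try exact: val_inj; case/eqP: ni; exact: val_inj.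
  case=> ->; first by exists n; case: IH => IH; [right; rewrite rK|left].
  case: IH => IH; last first.
    by exists n.+1; left; rewrite /= -IH rK.
  (* One step backwards, written as [Q - 1] steps forwards. *)
  exists (n + Q.-1)%N; right; apply: rotI; rewrite !rK.
  have E : iter (n + Q.-1).+1 rot f = iter n rot f by rewrite -addnS prednK // iterD QE.
  by rewrite IH -E.
- exists (n %% Q)%N; first by rewrite /= ltn_pmod.
  rewrite -he hn {2}(divn_eq n Q) addnC iterD.
  by congr (edg (iter _ _ _)); elim: (n %/ Q)%N => //= q IH; rewrite mulSn iterD -IH QE.
by move: hc; rewrite -(cn n) -hn (col_adj Mm Mc); case: (col _ _ _).
Qed.

End FaceSize.

(** * The lattice of translations acting on flags *)

Section Translations.
Variables (R : realType) (M : embedded_graph 'rV[R]_2).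
Hypotheses (Mm : is_map M R) (Mc : forall F, is_face M F -> convex_polygon F).
Notation plane := 'rV[R]_2.
Notation flag := (flag M).
Implicit Types (A B F : set plane) (a b x y : plane) (f g : flag) (z : int * int).
Local Notation r := (@flag_adj _ M).

Definition shift a A : set plane := [set x | A (x - a)].

Lemma shift_image a A : shift a A = (fun x => x + a) @` A.
Proof.
apply/seteqP; split=> [x Ax|_ [x Ax <-]]; last by rewrite /shift /= addrK.
by exists (x - a) => //; rewrite subrK.
Qed.

Lemma shift0 A : shift 0 A = A.
Proof. by apply/seteqP; split=> x; rewrite /shift /= subr0. Qed.

Lemma shiftD a b A : shift a (shift b A) = shift (a + b) A.
Proof. by apply/seteqP; split=> x; rewrite /shift /= opprD addrA. Qed.

Lemma shift_inj a : injective (shift a).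
Proof. by move=> A B E; rewrite -[A]shift0 -[B]shift0 -(addNr a) -!shiftD E. Qed.

Lemma shift_closure a A : shift a (closure A) = closure (shift a A).
Proof.
have H b B x : closure B x -> closure (shift b B) (x + b).
  move=> cx U nU; have h : \forall w \near x, U (1 *: w + b) by apply: near_affine; rewrite scale1r.
  by have [w [Bw Uw]] := cx _ h; exists (w + b); split; [rewrite /shift /= addrK|move: Uw; rewrite scale1r].
apply/seteqP; split=> x cx; first by rewrite -(subrK a x); exact: H.
by rewrite /shift /= -[A]shift0 -(addNr a) -shiftD; exact: H.
Qed.

Lemma shift_connected a A : connected A -> connected (shift a A).
Proof.
move=> cA; rewrite shift_image; apply: connected_continuous_connected => //.
apply: continuous_subspaceT => x U nU; have : \forall w \near x, U (1 *: w + a).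
  by apply: near_affine; rewrite scale1r.
by apply: filterS => w; rewrite scale1r.
Qed.

Lemma shift_component a A x : shift a (connected_component A x) = connected_component (shift a A) (x + a).
Proof.
have [Ax|nAx] := pselect (A x); last first.
  have nA' : ~ shift a A (x + a) by rewrite /shift /= addrK.
  by rewrite (connected_component_out nAx) (connected_component_out nA'); apply/seteqP; split.
have H b B y : B y -> shift b (connected_component B y) `<=` connected_component (shift b B) (y + b).
  move=> By; apply: connected_component_max.
  - by rewrite /shift /= addrK; exact: connected_component_refl.
  - by move=> w; rewrite /shift /=; exact: connected_component_sub.
  exact/shift_connected/component_connected.
apply/seteqP; split; first exact: H.
move=> y cy; have Ax' : shift a A (x + a) by rewrite /shift /= addrK.
have := H (- a) (shift a A) (x + a) Ax' (y - a).
by rewrite shiftD addNr shift0 addrK; apply; rewrite /shift /= opprK subrK.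
Qed.

Definition translation_symmetry a := shift a (vertices M) = vertices M /\
  forall e, edges M (shift a e) <-> edges M e.

Lemma translation_symmetryP a : is_symmetry M (fun p => p + a) -> translation_symmetry a.
Proof.
move=> [_ hV hE]; split; first by rewrite shift_image.
move=> e; split=> [|Ee]; last by rewrite shift_image -hE; exists e.
by rewrite -{1}hE => -[e' Ee']; rewrite -shift_image => /shift_inj <-.
Qed.

Lemma translation_symmetryD a b : translation_symmetry a -> translation_symmetry b ->
  translation_symmetry (a + b).
Proof.
by move=> [a1 a2] [b1 b2]; split=> [|e]; rewrite -shiftD ?b1 // a2 b2.
Qed.

Lemma translation_symmetryN a : translation_symmetry a -> translation_symmetry (- a).
Proof.
by move=> [a1 a2]; split=> [|e]; [rewrite -{1}a1|rewrite -a2]; rewrite shiftD ?addNr ?addrN shift0.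
Qed.

Lemma translation_symmetry_int a (n : int) : translation_symmetry a -> translation_symmetry (n%:~R *: a).
Proof.
move=> sa; have nat_case (k : nat) : translation_symmetry (k%:R *: a).
  elim: k => [|k IH]; first by rewrite scale0r; split=> [|e]; rewrite shift0.
  by rewrite -natr1 scalerDl scale1r; exact: translation_symmetryD.
case: n => n; first exact: nat_case.
by rewrite NegzE mulrNz scaleNr; apply: translation_symmetryN; exact: nat_case.
Qed.

Lemma skeleton_shift a : translation_symmetry a -> shift a (skeleton M) = skeleton M.
Proof.
move=> sa; have H b : translation_symmetry b -> shift b (skeleton M) `<=` skeleton M.
  move=> [b1 b2] x [Vx|[e Ee ex]]; first by left; rewrite -b1.
  by right; exists (shift b e) => //; exact/b2.
apply/seteqP; split; first exact: H.
move=> x sx; apply: (H _ (translation_symmetryN sa)).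
by rewrite /shift /= opprK subrK.
Qed.

Lemma face_shift a F : translation_symmetry a -> is_face M F -> is_face M (shift a F).
Proof.
move=> sa [x nx ->]; rewrite shift_component; exists (x + a).
  by rewrite -(skeleton_shift sa) /= /shift /= addrK.
congr (connected_component _ _); apply/funext => y; rewrite /shift /=.
by rewrite -[in RHS](skeleton_shift sa).
Qed.

Variables (u w : plane).
Hypotheses (fuw : free [:: u; w]) (su : is_symmetry M (fun p => p + u))
  (sw : is_symmetry M (fun p => p + w)).

Definition lattice z : plane := z.1%:~R *: u + z.2%:~R *: w.

Lemma lattice_symmetry z : translation_symmetry (lattice z).
Proof.
by apply: translation_symmetryD; apply: translation_symmetry_int; exact: translation_symmetryP.
Qed.

Lemma latticeD (y z : int * int) : lattice (y + z) = lattice y + lattice z.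
Proof. by rewrite /lattice !intrD !scalerDl addrACA. Qed.

Lemma det_uw : det2 u w != 0.
Proof.
move: fuw; rewrite free_cons seq1_free span_seq1 => /andP[uw w0].
apply: contra uw => /eqP D0.
have D0' : det2 w u = 0.
  have -> : det2 w u = - det2 u w by rewrite /det2; ring.
  by rewrite D0 oppr0.
by rewrite (det2_eq0 w0 D0'); apply: memvZ; exact: memv_line.
Qed.

Lemma lattice_eq0 z : lattice z = 0 -> z = 0.
Proof.
move=> E; have E1 : z.1%:~R * det2 u w = 0.
  have : det2 (lattice z) w = 0 by rewrite E /det2 !mxE; ring.
  by move=> <-; rewrite /lattice /det2 !vecE; ring.
have E2 : z.2%:~R * det2 u w = 0.
  have : det2 u (lattice z) = 0 by rewrite E /det2 !mxE; ring.
  by move=> <-; rewrite /lattice /det2 !vecE; ring.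
move: E1 E2 => /eqP + /eqP; rewrite !mulf_eq0 (negbTE det_uw) !orbF !intr_eq0.
by case: z {E} => a b /= /eqP -> /eqP ->.
Qed.

Lemma tr_flag z f : is_flag M (vtx f + lattice z, shift (lattice z) (edg f), shift (lattice z) (fce f)).
Proof.
have [fv fe ff fev fcl] := flagP f; have sz := lattice_symmetry z; split=> /=.
- by case: sz => <- _; rewrite /shift /= addrK.
- by apply/(proj2 sz).
- exact: face_shift.
- by rewrite /shift /= addrK.
by rewrite -shift_closure => x; exact: fcl.
Qed.

Definition tr z f : flag := SigSub (mem_set (tr_flag z f)).

Lemma tr_translation0 f : tr 0 f = f.
Proof.
have E : lattice 0 = 0 by rewrite /lattice !scale0r addr0.
by apply: flag_eq; rewrite /vtx /edg /fce /= E ?addr0 ?shift0.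
Qed.

Lemma tr_translationD (y z : int * int) f : tr (y + z) f = tr y (tr z f).
Proof.
by apply: flag_eq; rewrite /vtx /edg /fce /= ?shiftD latticeD // addrA addrAC.
Qed.

Lemma tr_translation_free z f : tr z f = f -> z = 0.
Proof.
move=> /(congr1 (@vtx R M)); rewrite [vtx (tr z f)]/vtx /= => E; apply: lattice_eq0.
by apply: (addrI (vtx f)); rewrite E addr0.
Qed.

Lemma tr_adj (i : 'I_3) z f : r i (tr z f) = tr z (r i f).
Proof.
apply: (flag_adj_eq Mm Mc); have /adjacentE[h0 h1 h2] := flag_adjP Mm Mc i f.
apply/adjacentE; split.
- by rewrite -h0; split=> E; [exact: (@addIr _ (lattice z) _ _ E)|exact: (congr1 (fun v => v + lattice z) E)].
- by rewrite -h1; split=> E; [exact: (shift_inj E)|exact: (congr1 (shift (lattice z)) E)].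
- by rewrite -h2; split=> E; [exact: (shift_inj E)|exact: (congr1 (shift (lattice z)) E)].
Qed.

Lemma tr_up z f : up Mm Mc (tr z f) = up Mm Mc f.
Proof.
rewrite /up; congr lexpos; rewrite /dir.
suff -> : hd Mm Mc (tr z f) = hd Mm Mc f + lattice z by rewrite /vtx /= opprD addrACA subrr addr0.
have [n V _ _] := hdP Mm Mc f; have e := hd_edg Mm Mc f.
have e' : edg (tr z f) (hd Mm Mc f + lattice z) by rewrite /edg /= /shift /= addrK.
have V' : vertices M (hd Mm Mc f + lattice z).
  by have [<- _] := lattice_symmetry z; rewrite /shift /= addrK.
have [/addIr E|//] := vertex_of_edge Mm Mc e' V'.
by rewrite E eqxx in n.
Qed.

Definition tr_rep f0 f : flag := xget f0 [set g | exists z, g = tr z f].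

Lemma tr_rep_tr f0 z f : tr_rep f0 (tr z f) = tr_rep f0 f.
Proof.
congr xget; apply/seteqP; split=> g [y ->]; first by exists (y + z); rewrite tr_translationD.
by exists (y - z); rewrite -tr_translationD subrK.
Qed.

Lemma tr_repP f0 f : exists z, f = tr z (tr_rep f0 f).
Proof.
have [z E] : exists z, tr_rep f0 f = tr z f.
  by apply: (@xgetPex _ f0 [set g | exists z, g = tr z f]); exists f, 0; rewrite tr_translation0.
by exists (- z); rewrite E -tr_translationD addNr tr_translation0.
Qed.

(** Subtracting the integer parts of the lattice coordinates moves the vertex into a bounded
    parallelogram, which meets finitely many flags. *)
Lemma tr_rep_finite f0 : finite_set (range (tr_rep f0)).
Proof.
pose B := `|u ord0 i0| + `|u ord0 i1| + `|w ord0 i0| + `|w ord0 i1|.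
apply: (@sub_finite_set _ _ (tr_rep f0 @` [set f | forall i, `|vtx f ord0 i| <= B])); last first.
  by apply: finite_image; exact: bounded_flags_finite.
move=> _ [f _ <-].
pose s := det2 (vtx f) w / det2 u w; pose t := det2 u (vtx f) / det2 u w.
pose z : int * int := (- Num.floor s, - Num.floor t); exists (tr z f); last exact: tr_rep_tr.
have frac (x : R) : 0 <= x - (Num.floor x)%:~R <= 1.
  have /andP[h1 h2] := floor_itv x; move: h2; rewrite intrD => h2; apply/andP; split; lra.
have vE : vtx (tr z f) = (s - (Num.floor s)%:~R) *: u + (t - (Num.floor t)%:~R) *: w.
  rewrite [vtx _]/vtx /= {1}(plane_coord (vtx f) det_uw) -/s -/t /lattice /z /= !mulrNz.
  by apply: row2P; rewrite !vecE; ring.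
move=> i; rewrite vE !vecE; have /andP[s0 s1] := frac s; have /andP[t0 t1] := frac t.
apply: le_trans (ler_normD _ _) _; rewrite !normrM (ger0_norm s0) (ger0_norm t0).
have := normr_ge0 (u ord0 i0); have := normr_ge0 (u ord0 i1).
have := normr_ge0 (w ord0 i0); have := normr_ge0 (w ord0 i1).
have iE : i = i0 \/ i = i1 by case: i => -[|[|//]] h; [left|right]; exact: val_inj.
rewrite /B; case: iE => -> h1 h2 h3 h4.
  have := ler_piMl h4 s1; have := ler_piMl h2 t1; lra.
have := ler_piMl h3 s1; have := ler_piMl h1 t1; lra.
Qed.

End Translations.

(** * Assembly: the surface of the cover, its genus and its end *)

Theorem theorem4p4 (R : realType) (M : embedded_graph 'rV[R]_2)
  (M_map : is_map M R)
  (M_convex : forall F, is_face M F -> convex_polygon F)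
  (M_sizes : exists F F', [/\ is_face M F, is_face M F' &
     ~~ (edges_of_face M F #= edges_of_face M F')%card])
  (M_translations : exists u w : 'rV[R]_2,
     [/\ free [:: u; w], is_symmetry M (fun p => p + u) &
         is_symmetry M (fun p => p + w)]) :
  loch_ness_monster R (minimal_regular_cover_surface M R).
Proof.
have [u [w [fuw su sw]]] := M_translations; have [f0 _] := tri_cover M_map 0.
have adjK := flag_adjK M_map M_convex.
have pf : periodic_flags (@flag_adj _ M) (tr su sw) (tr_rep su sw f0)
    (fun g : @Mon _ M => val g) (@mon_adj _ M) f0.
  split=> //.
  - exact: flag_adj_neq M_map M_convex.
  - exact: flag_adj02 M_map M_convex.
  - move=> f g; elim: (flags_connected M_map M_convex f g) => [|i h _ _ [s <-]].
      by exists [::].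
    by exists (i :: s).
  - exact: flag_period M_map M_convex.
  - exact: tr_translation0.
  - exact: tr_translationD.
  - exact: (tr_translation_free fuw).
  - exact: (tr_adj M_map M_convex).
  - exact: tr_rep_tr.
  - exact: tr_repP.
  - exact: (tr_rep_finite M_map fuw).
  - by move=> g h E; apply/val_inj/funext.
  - by move=> g; exact: (Mon_word adjK (set_valP g)).
  - by move=> s; exists (SigSub (mem_set (word_Mon M s))).
have gl := cover_gluing R adjK.
have tg := triangle_group_monodromy pf (col_adj M_map M_convex).
have hyp : \sum_j (rotation_order pf j)%:R^-1 < 1 :> R.
  apply: (rotation_orders_hyperbolic (pf := pf) (tr_up M_map M_convex su sw) (up_adj2 M_map M_convex)
    (up_adj0 M_map M_convex) (up_vertex M_map M_convex) (up_face M_map M_convex) R).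
  (* If no flag returned before a full period, every face would have exactly Q edges, against the
     two faces of different sizes. *)
  apply: contrapT => no; have [F [F' [fF fF' /negP]]] := M_sizes; apply.
  have faces_size (f : flag M) : (edges_of_face M (fce f) #= `I_(rotation_order pf 2%:R))%card.
    have q0 : (0 < rotation_order pf 2%:R)%N by exact: rotation_order_gt0.
    have qE := face_rotation_order pf f.
    have qmin n : (0 < n < rotation_order pf 2%:R)%N ->
        iter n (fun h => flag_adj 1 (flag_adj 0 h)) f <> f.
      by move=> nQ nE; apply: no; exists f, n.
    exact: (face_size M_map M_convex q0 qE qmin).
  have [f fE] := face_has_flag M_map fF; have [f' fE'] := face_has_flag M_map fF'.
  by rewrite -fE -fE'; apply: card_eq_trans (faces_size f) _; rewrite card_eq_sym; exact: faces_size.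
split.
- exact: surface_gluing gl tg (adj_connected pf) (monodromy_countable pf).
- exact: infinite_genus_gluing gl tg hyp (monodromy_folner pf).
exact: one_end_gluing gl tg (monodromy_infinite pf) (monodromy_one_end pf).
Qed.
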